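(* The variety $CG$ parametrizing four dimensional subalgebras of the complex octonions $\mathbb{O}$ is a smooth irreducible variety of dimension eight. The action of $G_2$ on $CG$ is spherical, in particular quasi-homogeneous, and has only three orbits.
   Context: $\mathbb{O}$ denotes the complexified algebra of octonions (the real Cayley algebra tensored with $\mathbb{C}$), with unit $1$, conjugation $x\mapsto \bar x$ and multiplicative norm $q$ (a nondegenerate complex quadratic form with $x\bar x=q(x)1$). $\mathrm{Im}(\mathbb{O})=1^{\perp}$ is the seven dimensional space of imaginary octonions, and $G_2=\mathrm{Aut}(\mathbb{O})$. Subalgebras of $\mathbb{O}$ are understood to contain the unit, so a subalgebra $\mathbb{A}$ decomposes as $\mathbb{A}=\mathbb{C}1\oplus \mathrm{Im}(\mathbb{A})$ with $\mathrm{Im}(\mathbb{A})=\mathbb{A}\cap \mathrm{Im}(\mathbb{O})$. $CG$ is the set of four dimensional subalgebras of $\mathbb{O}$, considered via $\mathbb{A}\mapsto \mathrm{Im}(\mathbb{A})$ as a closed $G_2$-stable subvariety of the Grassmannian $G(3,\mathrm{Im}(\mathbb{O}))=G(3,7)$. An action of a reductive group is spherical if a Borel subgroup has a dense orbit; quasi-homogeneous means that the group itself has a dense orbit. *)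

(* Defs.v *)
From HB Require Import structures.
From mathcomp Require Import all_boot all_order all_algebra.
From mathcomp Require Import complex mpoly ring.
From mathcomp Require Import boolp classical_sets functions cardinality reals topology.

Set Implicit Arguments.
Unset Strict Implicit.
Unset Printing Implicit Defensive.

Import GRing.Theory.

Local Open Scope classical_set_scope.
Local Open Scope ring_scope.

Section CayleyDickson.
Variable K : fieldType.

(* Iterated Cayley-Dickson doubling with K-linear conjugation.  For K real   *)
(* closed, cd K 3 is the real Cayley algebra; the structure constants are    *)
(* integers, so that for K = R[i] it is the scalar extension of the latter.  *)
Fixpoint cd (n : nat) : vectType K :=
  if n is m.+1 then (cd m * cd m)%type else K^o.

Fixpoint cd_one (n : nat) : cd n :=
  if n is m.+1 then (cd_one m, 0) else 1.

Fixpoint cd_conj (n : nat) : cd n -> cd n :=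
  if n is m.+1 then fun x => (cd_conj x.1, - x.2) else id.

Fixpoint cd_mul (n : nat) : cd n -> cd n -> cd n :=
  if n is m.+1 then
    fun x y => (cd_mul x.1 y.1 - cd_mul (cd_conj y.2) x.2,
                cd_mul y.2 x.1 + cd_mul x.2 (cd_conj y.1))
  else fun x y : K => x * y.

Fixpoint cd_norm (n : nat) : cd n -> K :=
  if n is m.+1 then fun x => cd_norm x.1 + cd_norm x.2 else fun x : K => x * x.

Definition octonion : vectType K := cd 3.

Definition oct_one : octonion := cd_one 3.
Definition oct_conj : octonion -> octonion := @cd_conj 3.
Definition oct_mul : octonion -> octonion -> octonion := @cd_mul 3.
Definition oct_norm : octonion -> K := @cd_norm 3.

Definition oct_polar (x y : octonion) : K :=
  oct_norm (x + y) - oct_norm x - oct_norm y.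

Definition imO : {vspace octonion} :=
  lker (linfun (oct_polar oct_one : octonion -> K^o)).
End CayleyDickson.

Arguments oct_one K : clear implicits.
Arguments imO K : clear implicits.

Section OctonionTheory.
Variable K : fieldType.
Implicit Types x y : octonion K.

Lemma oct_normM x y : oct_norm (oct_mul x y) = oct_norm x * oct_norm y.
Proof.
case: x y => [[[a b] [c d]] [[e f] [g h]]].
case=> [[[a' b'] [c' d']] [[e' f'] [g' h']]].
rewrite /oct_norm /oct_mul /=.
move: a b c d e f g h a' b' c' d' e' f' g' h'; rewrite /GRing.regular => *.
by ring.
Qed.

Lemma oct_mul_conj x : oct_mul x (oct_conj x) = oct_norm x *: oct_one K.
Proof.
case: x => [[[a b] [c d]] [[e f] [g h]]]; rewrite /oct_norm /oct_mul /=.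
congr ((_, _), (_, _), ((_, _), (_, _))); move: a b c d e f g h;
  rewrite /= /GRing.scale /= /GRing.regular => *; rewrite ?mulr1 ?mulr0; ring.
Qed.

Definition oct_re x : K := x.1.1.1.

Lemma oct_polar1 x : oct_polar (oct_one K) x = 2 * oct_re x.
Proof.
case: x => [[[a b] [c d]] [[e f] [g h]]].
rewrite /oct_polar /oct_norm /oct_re /=.
by move: a b c d e f g h; rewrite /GRing.regular => *; ring.
Qed.

Lemma oct_polar1_linear :
  linear (oct_polar (oct_one K) : octonion K -> K^o).
Proof.
by move=> a x y; rewrite !oct_polar1 /oct_re /= mulrDr /GRing.scale /= mulrCA.
Qed.

Lemma mem_imO x : (x \in imO K) = (oct_polar (oct_one K) x == 0).
Proof.
pose f := HB.pack_for {linear octonion K -> K^o}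
  (oct_polar (oct_one K) : octonion K -> K^o)
  (GRing.isLinear.Build _ _ _ _ _ oct_polar1_linear).
by rewrite memv_ker -[oct_polar (oct_one K)]/(f : _ -> _) lfunE.
Qed.

Lemma dim_octonion : \dim {:octonion K} = 8.
Proof. by rewrite dimvf. Qed.

Lemma dim_imO : 2 != 0 :> K -> \dim (imO K) = 7.
Proof.
move=> K2; pose f := linfun (oct_polar (oct_one K) : octonion K -> K^o).
have := limg_ker_dim f fullv; rewrite dim_octonion capfv -/(imO K).
suff -> : limg f = fullv.
  by rewrite dimvf /= => /eqP; rewrite addn1 eqSS => /eqP.
apply/eqP; rewrite eqEdim subvf dimvf /= lt0n dimv_eq0.
apply: contraNneq K2 => e.
have : oct_one K \in imO K by rewrite memv_ker -memv0 -e memv_img ?memvf.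
by rewrite mem_imO oct_polar1 /oct_re /= mulr1.
Qed.

End OctonionTheory.

Section ZariskiTopology.
Variables (K : fieldType) (T : Type).
Implicit Types (F S : set (T -> K)) (U : set T).

Definition nonvanishing S : set T := [set t | exists2 f, S f & f t != 0].

Definition zariski_open F : set (set T) :=
  [set U | exists2 S, S `<=` F & U = nonvanishing S].

Lemma zariski_openT F : F (fun=> 1) -> zariski_open F setT.
Proof.
move=> F1; exists [set (fun=> 1)]; first by move=> f ->.
by apply/seteqP; split=> t // _; exists (fun=> 1) => //; exact: oner_neq0.
Qed.

Lemma zariski_openI F : (forall f g, F f -> F g -> F (f \* g)) ->
  setI_closed (zariski_open F).
Proof.
move=> FM _ _ [S SF ->] [S' S'F ->].
exists [set h | exists f, exists g, [/\ S f, S' g & h = f \* g]].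
  by move=> _ [f [g [/SF Ff /S'F Fg ->]]]; exact: FM.
apply/seteqP; split=> t.
  case=> -[f Sf ft] [g Sg gt]; exists (f \* g); first by exists f, g.
  by rewrite mulf_neq0.
case=> _ [f [g [Sf Sg ->]]] /=; rewrite mulf_eq0 negb_or => /andP[ft gt].
by split; [exists f|exists g].
Qed.

Lemma zariski_open_bigU F (I : Type) (U : I -> set T) :
  (forall i, zariski_open F (U i)) -> zariski_open F (\bigcup_i U i).
Proof.
move=> oU; exists [set f | F f /\ nonvanishing [set f] `<=` \bigcup_i U i].
  by move=> f [].
apply/seteqP; split=> t.
  case=> i _ Uit; have [S SF eS] := oU i.
  move: (Uit); rewrite eS => -[f Sf ft]; exists f => //; split; first exact: SF.
  by move=> s [g -> fs]; exists i => //; rewrite eS; exists f.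
by case=> f [_ sf] ft; apply: sf; exists f.
Qed.

End ZariskiTopology.

Section Topological.
Variable T : topologicalType.
Implicit Types X Y : set T.

Definition closed_in X Y := exists2 C, closed C & Y = X `&` C.

Definition irreducible X := X !=set0 /\
  forall A B, closed A -> closed B -> X `<=` A `|` B -> X `<=` A \/ X `<=` B.

Definition irreducible_chain X (n : nat) (Z : nat -> set T) :=
  (forall i, (i <= n)%N -> closed_in X (Z i) /\ irreducible (Z i)) /\
  (forall i, (i < n)%N -> Z i `<` Z i.+1).

Definition krull_dim X (d : nat) :=
  (exists Z, irreducible_chain X d Z) /\
  (forall n Z, irreducible_chain X n Z -> (n <= d)%N).

Definition dense_in X Y := Y `<=` X /\ X `<=` closure Y.

End Topological.

Section AffineSpace.
Variables (K : fieldType) (V : vectType K).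

Definition coords (v : V) : 'I_(\dim {:V}) -> K :=
  fun i => coord (vbasis {:V}) i v.

Definition polyfuns : set (V -> K) :=
  [set f | exists p : {mpoly K[\dim {:V}]}, f = fun v => p.@[coords v]].

Definition affine_space : Type := V.

HB.instance Definition _ := Choice.on affine_space.

Let polyfun1 : polyfuns (fun=> 1).
Proof. by exists 1; apply: funext => v; rewrite meval1. Qed.

Let polyfunM f g : polyfuns f -> polyfuns g -> polyfuns (f \* g).
Proof.
by move=> [p ->] [q ->]; exists (p * q); apply: funext => v; rewrite /= mevalM.
Qed.

HB.instance Definition _ := isOpenTopological.Build affine_space
  (zariski_openT polyfun1) (zariski_openI polyfunM)
  (@zariski_open_bigU K V polyfuns).

End AffineSpace.

Section Grassmannian.
Variables (K : fieldType) (V : vectType K) (k : nat) (E : {vspace V}).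

Definition grassmannian : Type :=
  {U : {vspace V} | (U <= E)%VS && (\dim U == k)}.

HB.instance Definition _ := Choice.on grassmannian.

Implicit Types (U W : grassmannian) (X : set grassmannian).

Definition increasing (s : {ffun 'I_k -> 'I_(\dim E)}) : bool :=
  [forall i : 'I_k, forall j : 'I_k, (i < j)%N ==> (s i < s j)%N].

Definition plucker_index : finType :=
  {s : {ffun 'I_k -> 'I_(\dim E)} | increasing s}.

Definition frame U : 'M[K]_(k, \dim E) :=
  \matrix_(i < k, j < \dim E) coord (vbasis E) j (vbasis (val U))`_i.

(* A representative, given by the chosen bases, of the point of projective   *)
(* space attached to U; only homogeneous polynomials are evaluated at it.    *)
Definition plucker U : 'I_#|plucker_index| -> K :=
  fun a => \det (colsub (val (enum_val a)) (frame U)).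

Definition homogeneous (p : {mpoly K[#|plucker_index|]}) :=
  exists d, p \is d.-homog.

(* Restrictions of homogeneous forms, used through their zero loci only.     *)
Definition formfuns : set (grassmannian -> K) :=
  [set f | exists2 p, homogeneous p & f = fun U => p.@[plucker U]].

Let formfun1 : formfuns (fun=> 1).
Proof.
exists 1; first by exists 0; exact: dhomog1.
by apply: funext => U; rewrite meval1.
Qed.

Let formfunM f g : formfuns f -> formfuns g -> formfuns (f \* g).
Proof.
move=> [p [d hp] ->] [q [e hq] ->]; exists (p * q).
  by exists (d + e)%N; exact: dhomogM.
by apply: funext => U; rewrite /= mevalM.
Qed.

HB.instance Definition _ := isOpenTopological.Build grassmannian
  (zariski_openT formfun1) (zariski_openI formfunM)
  (@zariski_open_bigU K grassmannian formfuns).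

(* Zariski tangent space, at the vector plucker U, of the affine cone over   *)
(* the projective variety X.                                                 *)
Definition cone_tangent X U : set 'rV[K]_#|plucker_index| :=
  [set w | forall p, homogeneous p ->
     (forall W, X W -> p.@[plucker W] = 0) ->
     \sum_i (p^`M(i)).@[plucker U] * w 0 i = 0].

(* The tangent space of X at U is the quotient of that of the cone by the    *)
(* line spanned by plucker U.                                                *)
Definition tangent_dim X U (d : nat) :=
  exists2 T : {vspace 'rV[K]_#|plucker_index|},
    [set` T] = cone_tangent X U & \dim T = d.+1.

(* For irreducible X, whose dimension is the same at all points.             *)
Definition smooth X :=
  exists2 d, krull_dim X d & forall U, X U -> tangent_dim X U d.

End Grassmannian.

Section LinearGroups.
Variables (K : fieldType) (V : vectType K).
Implicit Types (f g : 'End(V)) (G H B : set 'End(V)).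

Definition linear_group G :=
  [/\ forall g, G g -> lker g == 0%VS, G \1%VF,
      forall f g, G f -> G g -> G (f \o g)%VF
    & forall g, G g -> G (g^-1)%VF].

Definition derived_group G : set 'End(V) :=
  smallest linear_group
    [set (f \o g \o f^-1 \o g^-1)%VF | f in G & g in G].

Definition solvable_group G := exists n, iter n derived_group G = [set \1%VF].

Definition connected_solvable_subgroup G H :=
  [/\ linear_group H, closed_in (G : set (affine_space 'End(V))) H,
      connected (H : set (affine_space 'End(V))) & solvable_group H].

Definition borel_subgroup G B := connected_solvable_subgroup G B /\
  forall H, connected_solvable_subgroup G H -> B `<=` H -> H = B.

Variables (k : nat) (E : {vspace V}).
Implicit Types (U W : grassmannian k E) (X : set (grassmannian k E)).

Definition grass_orbit G U : set (grassmannian k E) :=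
  [set W | exists2 g, G g & val W = (g @: val U)%VS].

Definition acts_on G X := forall g U, G g -> X U ->
  exists2 W, X W & val W = (g @: val U)%VS.

Definition orbits G X : set (set (grassmannian k E)) :=
  [set grass_orbit G U | U in X].

Definition quasi_homogeneous G X :=
  exists2 U, X U & dense_in X (grass_orbit G U).

Definition spherical G X :=
  exists2 B, borel_subgroup G B & quasi_homogeneous B X.

End LinearGroups.

Section Octonions.
Variable K : fieldType.
Local Notation O := (octonion K).

Definition G2 : set 'End(O) :=
  [set g | [/\ lker g == 0%VS, g (oct_one K) = oct_one K
             & forall x y, g (oct_mul x y) = oct_mul (g x) (g y)]].

Definition oct_subalgebra (A : {vspace O}) :=
  oct_one K \in A /\ forall x y, x \in A -> y \in A -> oct_mul x y \in A.

Definition CG : set (grassmannian 3 (imO K)) :=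
  [set U | exists A, [/\ oct_subalgebra A, \dim A = 4
                       & val U = (A :&: imO K)%VS]].

End Octonions.

Arguments G2 K : clear implicits.
Arguments CG K : clear implicits.

(* Main.v *)
Require Import Defs.
From HB Require Import structures.
From mathcomp Require Import all_boot all_order all_algebra perm.
From mathcomp Require Import complex mpoly ring zify.
From mathcomp Require Import boolp classical_sets functions cardinality reals topology.

Set Implicit Arguments.
Unset Strict Implicit.
Unset Printing Implicit Defensive.

Import GRing.Theory Num.Theory.

(** Imaginary octonions carry the cross product, which is the imaginary part of
    the product, and a four-dimensional subalgebra amounts to a three-space that
    is closed under it ([subalg_varietyP]). The arguments take place in an
    abstract octonion algebra over an algebraically closed field of characteristic
    zero.

    Orbits. A basic triple, three orthonormal imaginary elements of which the
    last is also perpendicular to the product of the other two, generates the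
    whole algebra by iterated doubling, so that automorphisms act
    transitively on basic triples ([basic_triple_trans]). Every closed
    three-space is one of three models attached to a basic triple, according to
    the norm on it being nondegenerate, of rank one, or zero ([classification]);
    hence there are exactly three orbits ([card_orbits]).

    Geometry. Closed three-spaces are generated by two elements, and form a closed
    set since, by Cramer's rule, a failure of closedness is detected by a cubic
    form ([subalg_closed]). Two of them can be joined by a rational curve, namely
    a line in the space of pairs of generators, and this gives irreducibility
    ([curve_connected_irreducible]). In the open cell of the flag of null
    coordinates the pair of generators can be normalized, and has then eight free
    entries: the cell is an affine space, with coordinates that are quotients of
    linear forms in the Plücker coordinates ([subalg_chart]), and such cells cover
    ([big_cell_cover]). Tangent spaces can be read off in a chart
    ([chart_tangent]), and so can the dimension: the closures of the coordinate
    subspaces form a chain of length eight, and by counting monomials there is no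
    longer chain in affine eight-space ([chain_length]).

    Sphericity. A maximal torus of the automorphism group grades the algebra, the
    null coordinates being homogeneous, and the Borel subgroup consists of the
    automorphisms that stabilize the resulting flag. It is solvable because
    commutators raise the filtration degree ([triangular_solvable]), and connected
    because conjugation with a one-parameter subgroup of the torus contracts it to
    the torus along rational curves ([scale_curve]). It is maximal because a larger
    connected solvable group would stabilize a flag by the Lie-Kolchin theorem
    ([lie_kolchin]), while a regular unipotent element stabilizes no flag of
    imaginary elements but the given one ([triangular_aut_maximal]). Its orbit of
    the nondegenerate model is dense: projecting the first two vectors of the flag
    to a nondegenerate closed three-space in general position yields a basic triple
    whose null coordinates define the same flag ([adapted_triple]), so that the
    automorphism carrying one triple to the other is triangular; and general
    position is a polynomial condition, which along a line of generator pairs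
    ending at the model holds for almost all parameters ([triangular_aut_dense]).
    Since a Borel orbit lies in an orbit of the whole group, the action is
    quasi-homogeneous as well. *)

(** * The octonion algebra *)

Section CayleyDickson.
Local Open Scope ring_scope.
Variable K : fieldType.

Fixpoint cd_dot (n : nat) : cd K n -> cd K n -> K :=
  if n is m.+1 then fun x y => cd_dot x.1 y.1 + cd_dot x.2 y.2
  else fun x y : K => x * y.

Lemma cd_dotC n (x y : cd K n) : cd_dot x y = cd_dot y x.
Proof.
elim: n x y => [|n IHn] x y /=; first exact: mulrC.
by rewrite (IHn x.1) (IHn x.2).
Qed.

Lemma cd_dotDl n (x y z : cd K n) : cd_dot (x + y) z = cd_dot x z + cd_dot y z.
Proof.
elim: n x y z => [|n IHn] x y z /=; first exact: mulrDl.
by rewrite !IHn addrACA.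
Qed.

Lemma cd_dotZl n a (x y : cd K n) : cd_dot (a *: x) y = a * cd_dot x y.
Proof.
elim: n x y => [|n IHn] x y /=; first by rewrite /GRing.scale /= mulrA.
by rewrite !IHn mulrDr.
Qed.

Lemma cd_dot_eq0 n (x : cd K n) : (forall y, cd_dot x y = 0) -> x = 0.
Proof.
have d0 m (y : cd K m) : cd_dot y 0 = 0.
  by rewrite cd_dotC -[0](scale0r y) cd_dotZl mul0r.
elim: n x => [|n IHn] /= x xy0; first by have := xy0 1; rewrite mulr1.
case: x xy0 => x1 x2 xy0; congr (_, _); apply: IHn => y.
  by have := xy0 (y, 0); rewrite /= d0 addr0.
by have := xy0 (0, y); rewrite /= d0 add0r.
Qed.

Lemma cd_normE n (x : cd K n) : cd_norm x = cd_dot x x.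
Proof. by elim: n x => [|n IHn] x //=; rewrite !IHn. Qed.

Lemma cd_conjD n (x y : cd K n) : cd_conj (x + y) = cd_conj x + cd_conj y.
Proof. by elim: n x y => [|n IHn] x y //=; rewrite IHn opprD. Qed.

Lemma cd_conjZ n a (x : cd K n) : cd_conj (a *: x) = a *: cd_conj x.
Proof. by elim: n x => [|n IHn] x //=; rewrite IHn -scalerN. Qed.

Lemma cd_mul_bilinear n :
  (forall x y z : cd K n, cd_mul (x + y) z = cd_mul x z + cd_mul y z) /\
  (forall x y z : cd K n, cd_mul x (y + z) = cd_mul x y + cd_mul x z).
Proof.
elim: n => [|n [IHl IHr]] /=.
  by split=> x y z; [exact: mulrDl | exact: mulrDr].
by split=> x y z; rewrite !(cd_conjD, IHl, IHr) opprD; congr (_, _) => /=;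
  rewrite addrACA.
Qed.

Lemma cd_mulDl n (x y z : cd K n) : cd_mul (x + y) z = cd_mul x z + cd_mul y z.
Proof. exact: (cd_mul_bilinear n).1. Qed.

Lemma cd_mulDr n (x y z : cd K n) : cd_mul x (y + z) = cd_mul x y + cd_mul x z.
Proof. exact: (cd_mul_bilinear n).2. Qed.

Lemma cd_mulZ n a :
  (forall x y : cd K n, cd_mul (a *: x) y = a *: cd_mul x y) /\
  (forall x y : cd K n, cd_mul x (a *: y) = a *: cd_mul x y).
Proof.
elim: n => [|n [IHl IHr]] /=.
  by split=> x y; [exact/esym/mulrA | exact: mulrCA].
by split=> x y; rewrite !(cd_conjZ, IHl, IHr) -scalerBr -scalerDr.
Qed.

Lemma cd_mulZl n a (x y : cd K n) : cd_mul (a *: x) y = a *: cd_mul x y.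
Proof. exact: (cd_mulZ n a).1. Qed.

Lemma cd_mulZr n a (x y : cd K n) : cd_mul x (a *: y) = a *: cd_mul x y.
Proof. exact: (cd_mulZ n a).2. Qed.

End CayleyDickson.

Section CompAlg.

Local Open Scope ring_scope.

(** Octonions with their norm and their imaginary part, forgetting the
    coordinates: an abstract algebra keeps the terms small, where a product of
    concrete octonions would unfold into eight polynomials. Conjugation is
    spelled out as [2 (1, x) - x]. The axioms on products say that it reverses
    them, and that left multiplication by the conjugate of [x] is, up to the
    norm, inverse to left multiplication by [x], and is its adjoint. The
    concrete octonions are the instance [oct_alg]. *)
Record compAlg (K : fieldType) := CompAlg {
  ca_sort :> vectType K;
  oone : ca_sort;
  omul : ca_sort -> ca_sort -> ca_sort;
  dot : ca_sort -> ca_sort -> K;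
  im : {vspace ca_sort};
  omulDl : forall x y z, omul (x + y) z = omul x z + omul y z;
  omulDr : forall x y z, omul x (y + z) = omul x y + omul x z;
  omulZl : forall a x y, omul (a *: x) y = a *: omul x y;
  omulZr : forall a x y, omul x (a *: y) = a *: omul x y;
  omul1l : forall x, omul oone x = x;
  dotC : forall x y, dot x y = dot y x;
  dotDl : forall x y z, dot (x + y) z = dot x z + dot y z;
  dotZl : forall a x y, dot (a *: x) y = a * dot x y;
  dot_eq0 : forall x, (forall y, dot x y = 0) -> x = 0;
  dot11 : dot oone oone = 1;
  mem_im : forall x, (x \in im) = (dot oone x == 0);
  omul_conj_axiom : forall x y, (2 * dot oone (omul x y)) *: oone - omul x y =
    omul ((2 * dot oone y) *: oone - y) ((2 * dot oone x) *: oone - x);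
  omul_conjK_axiom : forall x y,
    omul ((2 * dot oone x) *: oone - x) (omul x y) = dot x x *: y;
  dot_mull_axiom : forall x y z,
    dot (omul x y) z = dot y (omul ((2 * dot oone x) *: oone - x) z);
  dim_alg : \dim {:ca_sort} = 8
}.

End CompAlg.

Arguments oone {K c}.
Arguments dot {K c}.

(* Coordinates live in the regular module [K^o], which has to be unfolded to [K]
   before [ring] can treat them.                                              *)
Ltac oct_ring :=
  rewrite /oct_mul /oct_conj /oct_one /=;
  try congr ((_, _), (_, _), ((_, _), (_, _)));
  rewrite /= /GRing.scale /= /GRing.regular => *; ring.

Section ConcreteOctonions.
Local Open Scope ring_scope.
Variable K : fieldType.
Local Notation O := (octonion K).
Local Notation "x ** y" := (oct_mul x y) (at level 40, left associativity).
Implicit Types (x y z : O) (a b : K).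

Definition oct_dot : O -> O -> K := @cd_dot K 3.

Lemma oct_mul1 x : oct_one K ** x = x.
Proof. by case: x => [[[? ?] [? ?]] [[? ?] [? ?]]]; oct_ring. Qed.

Lemma oct_dot11 : oct_dot (oct_one K) (oct_one K) = 1.
Proof. by rewrite /oct_dot /=; rewrite /GRing.regular; ring. Qed.

Lemma oct_conjE x : (2 * oct_dot (oct_one K) x) *: oct_one K - x = oct_conj x.
Proof.
by case: x => [[[? ?] [? ?]] [[? ?] [? ?]]]; rewrite /oct_dot /=; oct_ring.
Qed.

Lemma oct_conjM x y : oct_conj (x ** y) = oct_conj y ** oct_conj x.
Proof.
case: x y => [[[? ?] [? ?]] [[? ?] [? ?]]] [[[? ?] [? ?]] [[? ?] [? ?]]].
by oct_ring.
Qed.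

Lemma oct_mul_conjK x y : oct_conj x ** (x ** y) = oct_dot x x *: y.
Proof.
case: x y => [[[? ?] [? ?]] [[? ?] [? ?]]] [[[? ?] [? ?]] [[? ?] [? ?]]].
by rewrite /oct_dot /=; oct_ring.
Qed.

Lemma oct_dot_mull x y z : oct_dot (x ** y) z = oct_dot y (oct_conj x ** z).
Proof.
case: x y z => [[[? ?] [? ?]] [[? ?] [? ?]]] [[[? ?] [? ?]] [[? ?] [? ?]]].
case=> [[[? ?] [? ?]] [[? ?] [? ?]]].
by rewrite /oct_dot /=; oct_ring.
Qed.

Lemma oct_polarE x y : oct_polar x y = 2 * oct_dot x y.
Proof.
rewrite /oct_polar /oct_norm !cd_normE /oct_dot cd_dotDl.
rewrite !(cd_dotC _ (x + y)) !cd_dotDl (cd_dotC y x).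
by ring.
Qed.

Hypothesis K2 : 2 != 0 :> K.

Lemma oct_mem_im x : (x \in imO K) = (oct_dot (oct_one K) x == 0).
Proof. by rewrite mem_imO oct_polarE mulf_eq0 (negPf K2). Qed.

Definition oct_alg : compAlg K.
Proof.
apply: (@CompAlg K O (oct_one K) (@oct_mul K) oct_dot (imO K)).
- exact: cd_mulDl.
- exact: cd_mulDr.
- exact: cd_mulZl.
- exact: cd_mulZr.
- exact: oct_mul1.
- exact: cd_dotC.
- exact: cd_dotDl.
- exact: cd_dotZl.
- exact: cd_dot_eq0.
- exact: oct_dot11.
- exact: oct_mem_im.
- move=> x y; apply: (etrans (oct_conjE (x ** y))).
  apply: (etrans (oct_conjM x y)).
  exact: (f_equal2 _ (esym (oct_conjE y)) (esym (oct_conjE x))).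
- move=> x y; apply: (etrans _ (oct_mul_conjK x y)).
  exact: (f_equal (fun t => t ** (x ** y)) (oct_conjE x)).
- move=> x y z; apply: (etrans (oct_dot_mull x y z)).
  exact: (f_equal (fun t => oct_dot y (t ** z)) (esym (oct_conjE x))).
- exact: dim_octonion.
Defined.

End ConcreteOctonions.

(** * Identities in a composition algebra, and the doubling process *)

(** Reduces an identity modulo a hypothesis to an identity in every
    commutative ring, the multiple of the hypothesis being given by hand. *)
Lemma lincomb1 (R : comNzRingType) (c a b x y : R) :
  x = y -> (a - b = c * (x - y))%R -> a = b.
Proof. by move=> ->; rewrite subrr mulr0 => /subr0_eq. Qed.

Lemma lincomb2 (R : comNzRingType) (c d a b x y z t : R) :
  x = y -> z = t -> (a - b = c * (x - y) + d * (z - t))%R -> a = b.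
Proof. by move=> -> ->; rewrite !subrr !mulr0 addr0 => /subr0_eq. Qed.

Section Identities.
Local Open Scope ring_scope.
Variables (K : fieldType) (C : compAlg K).
Local Notation "x ** y" := (omul x y) (at level 40, left associativity).
Local Notation uno := (@oone K C).
Implicit Types (x y z c : C) (a b : K).

Lemma dotDr x y z : dot x (y + z) = dot x y + dot x z.
Proof. by rewrite dotC dotDl !(dotC x). Qed.
Lemma dotZr a x y : dot x (a *: y) = a * dot x y.
Proof. by rewrite dotC dotZl dotC. Qed.
Lemma dotNl x y : dot (- x) y = - dot x y.
Proof. by rewrite -scaleN1r dotZl mulN1r. Qed.
Lemma dotNr x y : dot x (- y) = - dot x y.
Proof. by rewrite dotC dotNl dotC. Qed.
Lemma dot0l x : dot 0 x = 0. Proof. by rewrite -(scale0r x) dotZl mul0r. Qed.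
Lemma dot0r x : dot x 0 = 0. Proof. by rewrite dotC dot0l. Qed.

Definition dotE := (dotDl, dotDr, dotZl, dotZr, dotNl, dotNr, dot0l, dot0r).

Lemma dot_inj x y : (forall w, dot x w = dot y w) -> x = y.
Proof.
by move=> xy; apply/subr0_eq/dot_eq0 => w; rewrite dotDl dotNl xy subrr.
Qed.

Lemma dot_neq0 x : x != 0 -> exists y, dot x y != 0.
Proof.
move=> x0; apply: contrapT => h; case/negP: x0; apply/eqP/dot_eq0 => y.
by apply: contrapT => /eqP xy; apply: h; exists y.
Qed.

Lemma omulNl x y : (- x) ** y = - (x ** y).
Proof. by rewrite -scaleN1r omulZl scaleN1r. Qed.
Lemma omulNr x y : x ** (- y) = - (x ** y).
Proof. by rewrite -scaleN1r omulZr scaleN1r. Qed.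
Lemma omul0l x : 0 ** x = 0.
Proof. by rewrite -[in LHS](scale0r x) omulZl scale0r. Qed.
Lemma omul0r x : x ** 0 = 0.
Proof. by rewrite -[in LHS](scale0r x) omulZr scale0r. Qed.

(** Locked, so that conjugates are not opened into sums when products of sums
    are expanded. *)
Definition oconj x : C := locked ((2 * dot uno x) *: uno - x).

Lemma oconjE x : oconj x = (2 * dot uno x) *: uno - x.
Proof. by rewrite /oconj -lock. Qed.

Lemma oconjD x y : oconj (x + y) = oconj x + oconj y.
Proof. by rewrite !oconjE dotDr mulrDr scalerDl opprD addrACA. Qed.
Lemma oconjZ a x : oconj (a *: x) = a *: oconj x.
Proof. by rewrite !oconjE dotZr scalerBr scalerA mulrCA. Qed.
Lemma oconjN x : oconj (- x) = - oconj x.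
Proof. by rewrite -scaleN1r oconjZ scaleN1r. Qed.

Lemma oconj1 : oconj uno = uno.
Proof. by rewrite !oconjE dot11 mulr1 scalerDl scale1r addrK. Qed.

Lemma oconjK : involutive oconj.
Proof.
move=> x; rewrite (oconjE x) oconjD oconjN oconjZ oconj1.
by rewrite oconjE opprB addrCA subrr addr0.
Qed.

Lemma oconjM x y : oconj (x ** y) = oconj y ** oconj x.
Proof. by rewrite !oconjE; exact: omul_conj_axiom. Qed.

Lemma omul1r x : x ** uno = x.
Proof. by rewrite -[LHS]oconjK oconjM oconj1 omul1l oconjK. Qed.

Lemma oconj_omulK x y : oconj x ** (x ** y) = dot x x *: y.
Proof. by rewrite oconjE; exact: omul_conjK_axiom. Qed.

Lemma dot_mull x y z : dot (x ** y) z = dot y (oconj x ** z).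
Proof. by rewrite oconjE; exact: dot_mull_axiom. Qed.

Lemma dot_oconjl x y : dot (oconj x) y = dot x (oconj y).
Proof. by rewrite !oconjE !dotE (dotC uno y) (dotC x uno); ring. Qed.

Lemma dot_oconj x y : dot (oconj x) (oconj y) = dot x y.
Proof. by rewrite dot_oconjl oconjK. Qed.

Lemma dot_mulr x y z : dot (x ** y) z = dot x (z ** oconj y).
Proof.
by rewrite -dot_oconj oconjM dot_mull oconjK -dot_oconj oconjM !oconjK.
Qed.

Lemma omul_oconj x : x ** oconj x = dot x x *: uno.
Proof. by rewrite -{1}(oconjK x) -{2}(omul1r (oconj x)) oconj_omulK dot_oconj. Qed.

Lemma omul_sqr x : x ** x = (2 * dot uno x) *: x - dot x x *: uno.
Proof.
by rewrite -omul_oconj !oconjE omulDr omulNr omulZr omul1r opprB addrC subrK.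
Qed.

Lemma omulK_oconj x y : (y ** x) ** oconj x = dot x x *: y.
Proof.
apply: (can_inj oconjK); rewrite oconjM oconjK oconjM oconjZ.
by rewrite -{1}(oconjK x) oconj_omulK dot_oconj.
Qed.

Lemma oconj_omul_polar x y z :
  oconj x ** (y ** z) + oconj y ** (x ** z) = (2 * dot x y) *: z.
Proof.
have := oconj_omulK (x + y) z.
rewrite oconjD !omulDl !omulDr !oconj_omulK dotDl !dotDr (dotC y x) !scalerDl.
rewrite !addrA => /addIr; rewrite -!addrA => /addrI ->.
by rewrite -scalerDl mulrDl mul1r.
Qed.

Lemma omul_polar_oconj x y z :
  (x ** y) ** oconj z + (x ** z) ** oconj y = (2 * dot y z) *: x.
Proof.
apply: (can_inj oconjK); rewrite oconjD oconjZ !oconjM !oconjK.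
by rewrite -(dot_oconj y z) -(oconj_omul_polar _ _ (oconj x)) !oconjK addrC.
Qed.

Section Perpendicular.
Variable c : C.
Hypothesis c_im : dot uno c = 0.

Lemma oconj_im : oconj c = - c.
Proof. by rewrite !oconjE c_im mulr0 scale0r add0r. Qed.

Lemma dot_oconj_im x : dot x c = 0 -> dot (oconj x) c = 0.
Proof. by move=> xc; rewrite dot_oconjl oconj_im dotNr xc oppr0. Qed.

Lemma perp_left x z : dot x c = 0 -> x ** (c ** z) = c ** (oconj x ** z).
Proof.
move=> xc; have := oconj_omul_polar (oconj x) c z.
by rewrite oconjK dot_oconj_im // mulr0 scale0r oconj_im omulNl => /subr0_eq.
Qed.

Lemma perp_swap x : dot x c = 0 -> x ** c = c ** oconj x.
Proof. by move=> xc; have := perp_left uno xc; rewrite !omul1r. Qed.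

(** The three rules [perp_mull], [perp_mulr] and [perp_mulrr] are the
    multiplication table of a Cayley-Dickson double: they determine all products
    in [A + A ** c] when [A] is a subalgebra perpendicular to [c]. *)
Lemma perp_mull x y : dot x c = 0 -> dot y c = 0 -> dot (y ** x) c = 0 ->
  x ** (y ** c) = (y ** x) ** c.
Proof.
by move=> xc yc yxc; rewrite (perp_swap yc) perp_left // -oconjM -perp_swap.
Qed.

Lemma perp_im x : dot x c = 0 -> oconj (x ** c) = - (x ** c).
Proof.
move=> xc; rewrite oconjE dotC dot_mulr dotC oconj_im omul1l dotNl dotC xc.
by rewrite oppr0 mulr0 scale0r add0r.
Qed.

Lemma perp_mulr x y : dot x c = 0 -> dot y c = 0 -> dot (x ** oconj y) c = 0 ->
  (x ** c) ** y = (x ** oconj y) ** c.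
Proof.
move=> xc yc xyc; apply: (can_inj oconjK); rewrite oconjM !perp_im //.
by rewrite omulNr perp_mull // dot_oconj_im.
Qed.

Lemma perp_mulrr x y : dot c c = 1 ->
    dot x c = 0 -> dot y c = 0 -> dot (y ** x) c = 0 ->
  (x ** c) ** (y ** c) = - (oconj y ** x).
Proof.
move=> cc xc yc yxc; have := omul_polar_oconj x c (oconj (y ** c)).
rewrite oconjK perp_im // oconj_im !omulNr omulNl opprK (@perp_mull x y) // dotNr.
rewrite dotC dot_mulr omul_oconj cc scale1r.
have -> : ((y ** x) ** c) ** c = - (y ** x).
  have := omulK_oconj c (y ** x); rewrite cc scale1r oconj_im omulNr.
  by move/(congr1 -%R); rewrite opprK.
move/eqP; rewrite subr_eq => /eqP ->.
by rewrite !oconjE omulDl omulNl omulZl omul1l opprB dotC mulrN scaleNr addrC.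
Qed.

End Perpendicular.

Definition cd_hom n (h : cd K n -> C) : Prop :=
  [/\ forall a (s t : cd K n), h (a *: s + t) = a *: h s + h t,
      h (cd_one K n) = uno,
      forall s t : cd K n, h (cd_mul s t) = h s ** h t
    & forall s : cd K n, h (cd_conj s) = oconj (h s)].

Definition cd_extend n (h : cd K n -> C) c : cd K n.+1 -> C :=
  fun p => h p.1 + h p.2 ** c.

(** A unit vector perpendicular to a copy of [cd K n] behaves as the new unit
    of the Cayley-Dickson double, by [perp_mull], [perp_mulr] and
    [perp_mulrr]. *)
Lemma cd_extend_hom n (h : cd K n -> C) c : cd_hom h ->
  (forall s : cd K n, dot (h s) c = 0) -> dot c c = 1 -> cd_hom (cd_extend h c).
Proof.
move=> [hlin h1 hM hC] hc cc.
have hD (x y : cd K n) : h (x + y) = h x + h y by rewrite -[x]scale1r hlin !scale1r.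
have h0 : h 0 = 0 by apply: (addrI (h 0)); rewrite -hD !addr0.
have hN (x : cd K n) : h (- x) = - h x.
  by rewrite -[- x]addr0 -scaleN1r hlin h0 scaleN1r addr0.
have c1 : dot uno c = 0 by rewrite -h1.
split=> [a [x1 x2] [y1 y2]||[x1 x2] [y1 y2]|[x1 x2]]; rewrite /cd_extend /=.
- by rewrite !hlin omulDl omulZl scalerDr addrACA.
- by rewrite h1 h0 omul0l addr0.
- rewrite !hD hN !hM !hC !omulDl !omulDr (perp_mull c1) ?hc // -?hM ?hc //.
  rewrite (perp_mulr c1) ?hc // -?hC -?hM ?hc //.
  rewrite (perp_mulrr c1 cc) ?hc // -?hC -?hM ?hc //.
  by rewrite -!addrA; congr (_ + _); rewrite [RHS]addrA [RHS]addrC.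
- by rewrite hC hN omulNl oconjD (perp_im c1).
Qed.

Lemma lfun_of_linear (U V : vectType K) (f : U -> V) :
  (forall a (x y : U), f (a *: x + y) = a *: f x + f y) ->
  exists g : 'Hom(U, V), g =1 f.
Proof.
move=> flin; pose F := HB.pack_for {linear U -> V} f
  (GRing.isLinear.Build _ _ _ _ _ flin).
by exists (linfun F) => x; rewrite lfunE.
Qed.

(** The data from which iterated doubling rebuilds the algebra: each entry is
    an imaginary unit vector perpendicular to the subalgebra generated by the
    previous entries. *)
Definition basic_triple x y z : Prop :=
  [/\ dot uno x = 0, dot uno y = 0 & dot uno z = 0] /\
  [/\ dot x x = 1, dot y y = 1 & dot z z = 1] /\
  [/\ dot x y = 0, dot x z = 0, dot y z = 0 & dot (x ** y) z = 0].

(** Doubling [K] with [x], then [y], then [z] embeds the standard octonions. *)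
Lemma basic_triple_hom x y z : basic_triple x y z ->
  exists2 h : 'Hom(octonion K, C), cd_hom (n := 3) h &
    forall a0 a1 a2 a3 a4 a5 a6 a7,
      h (((a0, a1), (a2, a3)), ((a4, a5), (a6, a7))) =
      a0 *: uno + a1 *: x + (a2 *: y + a3 *: (x ** y)) +
      (a4 *: z + a5 *: (x ** z) + (a6 *: (y ** z) + a7 *: ((x ** y) ** z))).
Proof.
move=> [[x1 y1 z1] [[xx yy zz] [xy xz yz xyz]]].
pose h0 (a : cd K 0) : C := a *: uno.
have h0P : cd_hom h0.
  split=> [a s t||s t|s]; rewrite /h0 /=.
  - by rewrite scalerDl scalerA.
  - by rewrite scale1r.
  - by rewrite omulZl omul1l scalerA.
  - by rewrite oconjZ oconj1.
have h1P : cd_hom (cd_extend h0 x).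
  by apply: cd_extend_hom => // s; rewrite /h0 dotZl x1 mulr0.
have h2P : cd_hom (cd_extend (cd_extend h0 x) y).
  apply: cd_extend_hom => // -[s t]; rewrite /cd_extend /h0 /=.
  by rewrite omulZl omul1l dotDl !dotZl y1 xy !mulr0 addr0.
have h3P : cd_hom (cd_extend (cd_extend (cd_extend h0 x) y) z).
  apply: cd_extend_hom => // -[[s t] [u v]]; rewrite /cd_extend /h0 /=.
  rewrite omulDl !omulZl !omul1l !dotDl !dotZl z1 xz yz xyz.
  by rewrite !mulr0 !addr0.
have [hlin h1 hM hC] := h3P.
have [h hE] := lfun_of_linear hlin.
exists h; last first.
  move=> a0 a1 a2 a3 a4 a5 a6 a7; rewrite hE /cd_extend /h0 /=.
  by rewrite !omulDl !omulZl !omul1l.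
by split=> [a u v||u v|u]; rewrite ?linearP // !hE.
Qed.

End Identities.

(* Proves a linear identity between vectors: nondegeneracy of the form turns it
   into an identity between scalars.                                          *)
Ltac vec_ring := apply: dot_inj => ?;
  rewrite ?(dotDl, dotZl, dotNl, dot0l); ring.

(** * Automorphisms and basic triples *)

Section Automorphisms.
Local Open Scope ring_scope.
Variables (K : numClosedFieldType) (C : compAlg K).
Local Notation "x ** y" := (omul x y) (at level 40, left associativity).
Local Notation uno := (@oone K C).
Implicit Types (x y z c : C) (a b : K).

Lemma two_neq0 : 2 != 0 :> K. Proof. by rewrite pnatr_eq0. Qed.

Definition octs : compAlg K := oct_alg two_neq0.

(** The form is determined by the product and the conjugation, because of the
    identity [conj u * v + conj v * u = 2 (u, v)]. *)
Lemma cd_hom_dot (h : octonion K -> C) u v : cd_hom (n := 3) h ->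
  dot (h u) (h v) = oct_dot u v.
Proof.
move=> [hlin h1 hM hC].
have hD s t : h (s + t) = h s + h t.
  by rewrite -[s in LHS]scale1r hlin scale1r.
have h0 : h 0 = 0 by apply: (addrI (h 0)); rewrite -hD !addr0.
have hZ a s : h (a *: s) = a *: h s by rewrite -[_ *: s]addr0 hlin h0 addr0.
have cE s : @oconj _ octs s = oct_conj s by rewrite oconjE; exact: oct_conjE.
have := @oconj_omul_polar _ octs u v (oct_one K).
rewrite !cE => /(congr1 h); rewrite hD hZ !hM !hC h1 !omul1r.
have := oconj_omul_polar (h u) (h v) uno; rewrite !omul1r => ->.
move=> e; apply: (mulfI two_neq0).
have := congr1 (dot uno) e; rewrite !dotZr dot11 !mulr1; exact.
Qed.

Lemma cd_hom_lker (h : 'Hom(octonion K, C)) : cd_hom (n := 3) h -> lker h == 0%VS.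
Proof.
move=> hP; rewrite -subv0; apply/subvP => u; rewrite memv_ker memv0.
move/eqP => hu; apply/eqP; apply: (@dot_eq0 _ octs) => v.
by rewrite -[LHS](cd_hom_dot _ _ hP) hu dot0l.
Qed.

Lemma cd_hom_limg (h : 'Hom(octonion K, C)) : cd_hom (n := 3) h -> limg h = fullv.
Proof.
move=> hP; apply/eqP; rewrite eqEdim subvf dim_alg limg_dim_eq ?dim_octonion //.
by rewrite (eqP (cd_hom_lker hP)) capv0.
Qed.

Definition alg_aut : set 'End(C) :=
  [set g | [/\ lker g == 0%VS, g uno = uno & forall x y, g (x ** y) = g x ** g y]].

(** Since a basic triple generates a copy of the whole algebra, automorphisms
    act transitively on basic triples. *)
Lemma basic_triple_trans x y z x' y' z' :
  basic_triple x y z -> basic_triple x' y' z' ->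
  exists2 g, alg_aut g & [/\ g x = x', g y = y' & g z = z'].
Proof.
move=> /basic_triple_hom[h hP hE] /basic_triple_hom[h' hP' hE'].
have k0 := cd_hom_lker hP; have k0' := cd_hom_lker hP'.
have hV u : exists v, u = h v.
  have : u \in limg h by rewrite cd_hom_limg ?memvf.
  by case/memv_imgP => v _ ->; exists v.
pose g := (h' \o h^-1)%VF.
have gE u : g (h u) = h' u by rewrite comp_lfunE lker0_lfunK.
exists g.
  move: (hP) (hP') => [hlin h1 hM hC] [hlin' h1' hM' hC']; split.
  - rewrite -subv0; apply/subvP => v; rewrite memv_ker memv0.
    have [u ->] := hV v; rewrite gE => /eqP e.
    have : u \in lker h' by rewrite memv_ker e.
    by rewrite (eqP k0') memv0 => /eqP ->; rewrite linear0.
  - by rewrite -h1 gE h1'.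
  - move=> u v; have [{}u ->] := hV u; have [{}v ->] := hV v.
    by rewrite -hM !gE hM'.
have z3 : forall w : C, 0 *: w = 0 by move=> w; exact: scale0r.
have o3 : forall w : C, 1 *: w = w by move=> w; exact: scale1r.
have ex : h (((0, 1), (0, 0)), ((0, 0), (0, 0))) = x.
  by rewrite hE !z3 o3 !addr0 add0r.
have ey : h (((0, 0), (1, 0)), ((0, 0), (0, 0))) = y.
  by rewrite hE !z3 o3 !addr0 !add0r.
have ez : h (((0, 0), (0, 0)), ((1, 0), (0, 0))) = z.
  by rewrite hE !z3 o3 !addr0 !add0r.
split; rewrite -?ex -?ey -?ez gE hE'.
- by rewrite !z3 o3 !addr0 add0r.
- by rewrite !z3 o3 !addr0 !add0r.
- by rewrite !z3 o3 !addr0 !add0r.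
Qed.

Section Aut.
Variable g : 'End(C).
Hypothesis gP : alg_aut g.

Let g1 : g uno = uno. Proof. by case: gP. Qed.
Let gM x y : g (x ** y) = g x ** g y. Proof. by case: gP. Qed.

Lemma aut_inj : injective g.
Proof. by case: gP => /lker0P. Qed.

(** An automorphism preserves the quadratic equation of each element, hence its
    trace and norm. *)
Lemma aut_trace_norm x : dot uno (g x) = dot uno x /\ dot (g x) (g x) = dot x x.
Proof.
have e : (2 * (dot uno x - dot uno (g x))) *: g x =
         (dot x x - dot (g x) (g x)) *: uno.
  have := congr1 g (omul_sqr x); rewrite gM omul_sqr linearB !linearZ /= g1.
  move=> e; apply: dot_inj => w; have := congr1 (dot^~ w) e.
  rewrite !(dotDl, dotZl, dotNl) => {}e.
  by apply: (lincomb1 (c := -1)) e _; ring.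
have [t|t] := eqVneq (dot uno x) (dot uno (g x)).
  split=> //; move/eqP: e; rewrite t subrr mulr0 scale0r eq_sym scaler_eq0.
  case/orP=> [|/eqP u0]; first by rewrite subr_eq0 => /eqP.
  by have := dot11 C; rewrite u0 dot0l => /eqP; rewrite eq_sym oner_eq0.
have ne : 2 * (dot uno x - dot uno (g x)) != 0.
  by rewrite mulf_neq0 ?two_neq0 // subr_eq0.
have gx : g x = ((2 * (dot uno x - dot uno (g x)))^-1 *
                 (dot x x - dot (g x) (g x))) *: g uno.
  by rewrite g1 -scalerA -e scalerA mulVf // scale1r.
move: gx; set l := _ * _; rewrite -linearZ => /aut_inj ->.
by rewrite linearZ /= g1.
Qed.

Lemma aut_dot x y : dot (g x) (g y) = dot x y.
Proof.
apply: (mulfI two_neq0).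
have [_] := aut_trace_norm (x + y); rewrite linearD /= !dotDl !dotDr.
rewrite (aut_trace_norm x).2 (aut_trace_norm y).2 (dotC (g y)) (dotC y x) => e.
by apply: (lincomb1 (c := 1)) e _; ring.
Qed.

Lemma aut_im x : (g x \in im C) = (x \in im C).
Proof. by rewrite !mem_im (aut_trace_norm x).1. Qed.

Lemma aut_basic x y z : basic_triple x y z -> basic_triple (g x) (g y) (g z).
Proof.
move=> h; have u v : dot uno (g v) = dot uno v by case: (aut_trace_norm v).
by rewrite /basic_triple -gM !u !aut_dot.
Qed.

End Aut.

Lemma alg_aut_group : linear_group alg_aut.
Proof.
split=> [g []//||f g [f0 f1 fM] [g0 g1 gM]|g gP].
- split; [|by rewrite lfunE|by move=> x y; rewrite !lfunE].
  by apply/lker0P => x y; rewrite !id_lfunE.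
- split=> [||x y]; last by rewrite !comp_lfunE gM fM.
    apply/lker0P => x y; rewrite !comp_lfunE => /(lker0P f0).
    exact: (lker0P g0).
  by rewrite comp_lfunE g1.
- have [g0 g1 gM] := gP; have gK := lker0_lfunVK g0.
  split=> [||x y]; last by apply: (lker0P g0); rewrite gM !gK.
    by apply/lker0P => x y /(congr1 g); rewrite !gK.
  by apply: (lker0P g0); rewrite gK g1.
Qed.

(** The perpendicular projection of a vector outside the span is nonzero, and the
    form is nondegenerate on the range of the projection, which thus contains a
    vector that is not isotropic. *)
Lemma ex_perp m (f : 'I_m -> C) : (m < 8)%N ->
  (forall i j, dot (f i) (f j) = (i == j)%:R) ->
  exists2 c, dot c c = 1 & forall i, dot (f i) c = 0.
Proof.
move=> m8 fo; pose P v : C := v - \sum_i dot (f i) v *: f i.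
have dot_sum w (F : 'I_m -> C) : dot w (\sum_i F i) = \sum_i dot w (F i).
  by apply: (big_morph (dot w)) => [u v|]; rewrite ?dotDr ?dot0r.
have Pp v i : dot (f i) (P v) = 0.
  rewrite dotDr dotNr dot_sum (bigD1 i) //= big1 => [|j ji].
    by rewrite dotZr fo eqxx mulr1 addr0 subrr.
  by rewrite dotZr fo eq_sym (negPf ji) mulr0.
suff [c cp cc] : exists2 c, forall i, dot (f i) c = 0 & dot c c != 0.
  exists ((sqrtC (dot c c))^-1 *: c); last by move=> i; rewrite dotZr cp mulr0.
  rewrite dotZl dotZr mulrA -invfM -expr2 sqrtCK mulVf //.
have [v vN] : exists v, v \notin (\sum_i <[f i]>)%VS.
  apply: contrapT => h; have := dim_alg C.
  have -> : {:C}%VS = (\sum_i <[f i]>)%VS.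
    apply/eqP; rewrite eqEsubv subvf andbT; apply/subvP => v _.
    by apply: contrapT => /negP vN; apply: h; exists v.
  apply/eqP; rewrite neq_ltn; apply/orP; left; apply: leq_ltn_trans m8.
  apply: leq_trans (dimv_leq_sum _ _ _) _.
  rewrite -[m in (_ <= m)%N]card_ord -sum1_card; apply: leq_sum => i _.
  by rewrite dim_vline; case: (_ != _).
have Pv : P v != 0.
  apply: contra vN; rewrite subr_eq0 => /eqP ->.
  by apply: memv_sumr => i _; rewrite memvZ ?memv_line.
have [u vu] := dot_neq0 Pv.
have vPu : dot (P v) (P u) = dot (P v) u.
  rewrite dotDr dotNr dot_sum big1 ?oppr0 ?addr0 // => i _.
  by rewrite dotZr (dotC _ (f i)) Pp mulr0.
clearbody P; have [|q1] := eqVneq (dot (P v) (P v)) 0; last by exists (P v).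
have [|q2] := eqVneq (dot (P u) (P u)) 0; last by exists (P u).
move=> q2 q1; exists (P v + P u); first by move=> i; rewrite dotDr !Pp addr0.
rewrite !dotDl !dotDr q1 q2 (dotC (P u)) vPu add0r addr0 -mulr2n -mulr_natr.
by rewrite mulf_neq0 ?two_neq0.
Qed.

Lemma ex_perp4 x y :
    [/\ dot uno x = 0, dot uno y = 0 & dot x y = 0] -> dot x x = 1 -> dot y y = 1 ->
  exists z, [/\ dot z z = 1, dot uno z = 0, dot x z = 0, dot y z = 0
              & dot (x ** y) z = 0].
Proof.
move=> [x1 y1 xy] xx yy.
have xC : oconj x = - x by rewrite oconj_im.
have yC : oconj y = - y by rewrite oconj_im.
have k1 : dot uno (x ** y) = 0 by rewrite dotC dot_mulr omul1l yC dotNr xy oppr0.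
have kx : dot x (x ** y) = 0.
  by rewrite dotC dot_mull xC omulNl omul_sqr x1 xx mulr0 scale0r add0r opprK
     dotZr (dotC y) y1 mulr0.
have ky : dot y (x ** y) = 0.
  by rewrite dotC dot_mulr omul_oconj yy scale1r dotC.
have kk : dot (x ** y) (x ** y) = 1.
  by rewrite dot_mull oconj_omulK xx scale1r.
pose f (i : 'I_4) : C := nth 0 [:: uno; x; y; x ** y] i.
have [|i j|z zz zp] := @ex_perp 4 f; first by [].
  case: i j => [[|[|[|[|//]]]] ?] [[|[|[|[|//]]]] ?]; rewrite /f /=;
    by rewrite ?dot11 ?xx ?yy ?kk // dotC ?x1 ?y1 ?xy ?k1 ?kx ?ky.
by exists z; split=> //; [exact: zp 0|exact: zp 1|exact: zp 2%:R|exact: zp 3%:R].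
Qed.

Lemma basic_triple_of_pair x y :
    [/\ dot uno x = 0, dot uno y = 0 & dot x y = 0] -> dot x x = 1 -> dot y y = 1 ->
  exists z, basic_triple x y z.
Proof.
move=> h xx yy; have [z [zz z1 xz yz kz]] := ex_perp4 h xx yy.
by case: h => x1 y1 xy; exists z.
Qed.

End Automorphisms.

(** * Null coordinates *)

Section NullBasis.
Local Open Scope ring_scope.
Variables (K : numClosedFieldType) (C : compAlg K).
Local Notation "x ** y" := (omul x y) (at level 40, left associativity).
Local Notation uno := (@oone K C).
Implicit Types (u v w : C) (a b : K).

Variables x y z : C.

(** Coordinates with respect to [1], three isotropic vectors, [x ** z], and
    the three isotropic vectors dual to the former. The six isotropic vectors
    are weight vectors of degrees 3, 2, 1, -1, -2, -3 for a grading of the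
    algebra in which [1] and [x ** z] have degree zero, so that their spans in
    decreasing order form the flag of a Borel subgroup. *)
Definition nb (a0 a1 a2 a3 a4 a5 a6 a7 : K) : C :=
  a0 *: uno + (a1 + a7) *: x + ((a2 + a6) *: y + (a3 + a5) *: (x ** y)) +
  (('i * (a7 - a1)) *: z + a4 *: (x ** z) +
   (('i * (a3 - a5)) *: (y ** z) + ('i * (a6 - a2)) *: ((x ** y) ** z))).

Lemma nbD a0 a1 a2 a3 a4 a5 a6 a7 b0 b1 b2 b3 b4 b5 b6 b7 :
  nb a0 a1 a2 a3 a4 a5 a6 a7 + nb b0 b1 b2 b3 b4 b5 b6 b7 =
  nb (a0 + b0) (a1 + b1) (a2 + b2) (a3 + b3) (a4 + b4) (a5 + b5) (a6 + b6)
     (a7 + b7).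
Proof. by rewrite /nb; vec_ring. Qed.

Lemma nbZ a a0 a1 a2 a3 a4 a5 a6 a7 : a *: nb a0 a1 a2 a3 a4 a5 a6 a7 =
  nb (a * a0) (a * a1) (a * a2) (a * a3) (a * a4) (a * a5) (a * a6) (a * a7).
Proof. by rewrite /nb; vec_ring. Qed.

Lemma nb1 : nb 1 0 0 0 0 0 0 0 = uno.
Proof. by rewrite /nb; vec_ring. Qed.

Hypothesis bt : basic_triple x y z.

Let ii : 'i * 'i = -1 :> K. Proof. by rewrite -expr2 sqrCi. Qed.

Lemma nb_surj v : exists a0 a1 a2 a3 a4 a5 a6 a7, v = nb a0 a1 a2 a3 a4 a5 a6 a7.
Proof.
have [h hP hE] := basic_triple_hom bt.
have : v \in limg h by rewrite cd_hom_limg ?memvf.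
case/memv_imgP => -[[[x0 x1] [x2 x3]] [[x4 x5] [x6 x7]]] _ ->.
exists x0, ((x1 + 'i * x4) / 2), ((x2 + 'i * x7) / 2), ((x3 - 'i * x6) / 2).
exists x5, ((x3 + 'i * x6) / 2), ((x2 - 'i * x7) / 2), ((x1 - 'i * x4) / 2).
rewrite hE /nb; have two := two_neq0 K.
have h1 (s t : K) : (s + t) / 2 + (s - t) / 2 = s by field.
have h2 (s t : K) : (s - t) / 2 + (s + t) / 2 = s by field.
have h3 (s t : K) : 'i * ((s - 'i * t) / 2 - (s + 'i * t) / 2) = t.
  transitivity (- ('i * 'i) * t); last by rewrite ii opprK mul1r.
  by field.
by rewrite !h1 !h2 !h3.
Qed.

(** The table is checked in the explicit octonions, to which the triple is
    carried by [basic_triple_hom]. *)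
Lemma nb_mul a0 a1 a2 a3 a4 a5 a6 a7 b0 b1 b2 b3 b4 b5 b6 b7 :
  nb a0 a1 a2 a3 a4 a5 a6 a7 ** nb b0 b1 b2 b3 b4 b5 b6 b7 = nb
   (a0 * b0 - 2 * a1 * b7 - 2 * a2 * b6 - 2 * a3 * b5 - a4 * b4 - 2 * a5 * b3
    - 2 * a6 * b2 - 2 * a7 * b1)
   (a0 * b1 + a1 * b0 - 'i * a1 * b4 + 2 * a2 * b3 - 2 * a3 * b2 + 'i * a4 * b1)
   (a0 * b2 - 2 * a1 * b5 + a2 * b0 + 'i * a2 * b4 - 'i * a4 * b2 + 2 * a5 * b1)
   (a0 * b3 + 2 * a1 * b6 + a3 * b0 + 'i * a3 * b4 - 'i * a4 * b3 - 2 * a6 * b1)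
   (a0 * b4 + 2 * 'i * a1 * b7 - 2 * 'i * a2 * b6 - 2 * 'i * a3 * b5 + a4 * b0
    + 2 * 'i * a5 * b3 + 2 * 'i * a6 * b2 - 2 * 'i * a7 * b1)
   (a0 * b5 - 2 * a2 * b7 + 'i * a4 * b5 + a5 * b0 - 'i * a5 * b4 + 2 * a7 * b2)
   (a0 * b6 + 2 * a3 * b7 + 'i * a4 * b6 + a6 * b0 - 'i * a6 * b4 - 2 * a7 * b3)
   (a0 * b7 - 'i * a4 * b7 - 2 * a5 * b6 + 2 * a6 * b5 + a7 * b0 + 'i * a7 * b4).
Proof.
have [h hP hE] := basic_triple_hom bt; have [_ _ hM _] := hP.
rewrite /nb -!hE -hM; congr (h _).
rewrite /cd_mul /=; move: ii; rewrite /GRing.regular => iE.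
by congr ((_, _), (_, _), ((_, _), (_, _))) => /=; ring: iE.
Qed.

Lemma nb_dot a0 a1 a2 a3 a4 a5 a6 a7 b0 b1 b2 b3 b4 b5 b6 b7 :
  dot (nb a0 a1 a2 a3 a4 a5 a6 a7) (nb b0 b1 b2 b3 b4 b5 b6 b7) =
  a0 * b0 + a4 * b4 + 2 * (a1 * b7 + a7 * b1 + a2 * b6 + a6 * b2 + a3 * b5 +
  a5 * b3).
Proof.
have [h hP hE] := basic_triple_hom bt.
rewrite /nb -!hE (cd_hom_dot _ _ hP) /oct_dot /=.
move: ii; rewrite /GRing.regular => iE.
by ring: iE.
Qed.

Lemma nb_inj a0 a1 a2 a3 a4 a5 a6 a7 b0 b1 b2 b3 b4 b5 b6 b7 :
    nb a0 a1 a2 a3 a4 a5 a6 a7 = nb b0 b1 b2 b3 b4 b5 b6 b7 ->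
  [/\ a0 = b0, a1 = b1, a2 = b2 & a3 = b3] /\
  [/\ a4 = b4, a5 = b5, a6 = b6 & a7 = b7].
Proof.
move=> e; have d c0 c1 c2 c3 c4 c5 c6 c7 :=
  congr1 (dot^~ (nb c0 c1 c2 c3 c4 c5 c6 c7)) e.
have two := two_neq0 K.
split; split; [have := d 1 0 0 0 0 0 0 0 | have := d 0 0 0 0 0 0 0 1
 | have := d 0 0 0 0 0 0 1 0 | have := d 0 0 0 0 0 1 0 0
 | have := d 0 0 0 0 1 0 0 0 | have := d 0 0 0 1 0 0 0 0
 | have := d 0 0 1 0 0 0 0 0 | have := d 0 1 0 0 0 0 0 0];
 rewrite !nb_dot !(mulr0, mulr1, addr0, add0r) //; exact: mulfI.
Qed.

Lemma nb_im a0 a1 a2 a3 a4 a5 a6 a7 :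
  (nb a0 a1 a2 a3 a4 a5 a6 a7 \in im C) = (a0 == 0).
Proof.
by rewrite mem_im -nb1 nb_dot mul1r !mul0r !addr0 mulr0 addr0.
Qed.

Lemma nb_im_surj v : v \in im C ->
  exists a1 a2 a3 a4 a5 a6 a7, v = nb 0 a1 a2 a3 a4 a5 a6 a7.
Proof.
have [a0 [a1 [a2 [a3 [a4 [a5 [a6 [a7 ->]]]]]]]] := nb_surj v.
by rewrite nb_im => /eqP ->; exists a1, a2, a3, a4, a5, a6, a7.
Qed.

End NullBasis.

(** * The cross product and four-dimensional subalgebras *)

Section Span3.
Local Open Scope ring_scope.
Variables (K : fieldType) (V : vectType K).
Implicit Types (U W : {vspace V}) (a b c v : V).

Lemma memv_span3 v a b c : reflect
  (exists p q r, v = p *: a + q *: b + r *: c) (v \in <<[:: a; b; c]>>%VS).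
Proof.
rewrite !span_cons span_nil addv0; apply: (iffP memv_addP).
  case=> _ /vlineP[p ->] [_ /memv_addP[_ /vlineP[q ->] [_ /vlineP[r ->] ->]] ->].
  by exists p, q, r; rewrite addrA.
case=> p [q [r ->]]; exists (p *: a); rewrite ?memvZ ?memv_line //.
exists (q *: b + r *: c); last by rewrite addrA.
by rewrite memv_add ?memvZ ?memv_line.
Qed.

Lemma free3P a b c :
  (forall p q r, p *: a + q *: b + r *: c = 0 -> [/\ p = 0, q = 0 & r = 0]) ->
  free [:: a; b; c].
Proof.
move=> h; apply/freeP => k; rewrite !big_ord_recl big_ord0 /= addr0 addrA.
case/h => k0 k1 k2 i; case: i => [[|[|[|//]]] ?].
- by rewrite -[RHS]k0; congr k; apply: val_inj.
- by rewrite -[RHS]k1; congr k; apply: val_inj.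
- by rewrite -[RHS]k2; congr k; apply: val_inj.
Qed.

Lemma free3E a b c p q r : free [:: a; b; c] ->
  p *: a + q *: b + r *: c = 0 -> [/\ p = 0, q = 0 & r = 0].
Proof.
move/freeP => fr h; pose k (i : 'I_3) := nth 0 [:: p; q; r] i.
have k0 : forall i, k i = 0.
  by apply: fr; rewrite !big_ord_recl big_ord0 /k /= addr0 addrA.
by split; [exact: (k0 (@Ordinal 3 0 isT)) | exact: (k0 (@Ordinal 3 1 isT))
  | exact: (k0 (@Ordinal 3 2 isT))].
Qed.

Lemma span3_eq U a b c : \dim U = 3 -> free [:: a; b; c] ->
  a \in U -> b \in U -> c \in U -> U = <<[:: a; b; c]>>%VS.
Proof.
move=> dU f aU bU cU; apply/esym/eqP; rewrite eqEdim dU (eqnP f) leqnn andbT.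
by apply/span_subvP => v; rewrite !inE => /or3P[] /eqP ->.
Qed.

Lemma span3_sub U a b c : \dim U = 3 -> (U <= <<[:: a; b; c]>>)%VS ->
  U = <<[:: a; b; c]>>%VS.
Proof. by move=> dU s; apply/eqP; rewrite eqEdim s dU dim_span. Qed.

Lemma dim3_extend U a : \dim U = 3 -> a \in U -> a != 0 ->
  exists b c, [/\ b \in U, c \in U & free [:: a; b; c]].
Proof.
move=> dU aU a0.
have [b bU bN] : exists2 b, b \in U & b \notin <[a]>%VS.
  by apply/subvPn; apply/negP => /dimvS; rewrite dU dim_vline a0.
have [c cU cN] : exists2 c, c \in U & c \notin <<[:: b; a]>>%VS.
  by apply/subvPn; apply/negP => /dimvS; rewrite dU leqNgt ltnS dim_span.
exists b, c; split=> //; rewrite (perm_free (_ : perm_eq _ [:: c; b; a])).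
  by rewrite !free_cons cN span_seq1 bN span_nil memv0 a0 nil_free.
by rewrite -[[:: a; b; c]]revK perm_rev.
Qed.

Lemma vspace_neq0 U : \dim U != 0%N -> exists2 u, u \in U & u != 0.
Proof.
move=> dU; exists (vpick U); first exact: memv_pick.
by rewrite vpick0 -dimv_eq0.
Qed.

End Span3.

Section Cross.
Local Open Scope ring_scope.
Variables (K : numClosedFieldType) (C : compAlg K).
Local Notation "x ** y" := (omul x y) (at level 40, left associativity).
Local Notation uno := (@oone K C).
Implicit Types (x y z u v w e : C) (a b p q r : K).

(** Locked for the same reason as [oconj]. *)
Definition cross u v : C := locked (u ** v - dot uno (u ** v) *: uno).

Lemma cross_def u v : cross u v = u ** v - dot uno (u ** v) *: uno.
Proof. by rewrite /cross -lock. Qed.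

Lemma crossDl u v w : cross (u + v) w = cross u w + cross v w.
Proof. by rewrite !cross_def !omulDl dotDr scalerDl opprD addrACA. Qed.
Lemma crossDr u v w : cross u (v + w) = cross u v + cross u w.
Proof. by rewrite !cross_def !omulDr dotDr scalerDl opprD addrACA. Qed.
Lemma crossZl a u v : cross (a *: u) v = a *: cross u v.
Proof. by rewrite !cross_def omulZl dotZr scalerBr scalerA. Qed.
Lemma crossZr a u v : cross u (a *: v) = a *: cross u v.
Proof. by rewrite !cross_def omulZr dotZr scalerBr scalerA. Qed.

Lemma cross_im u v : cross u v \in im C.
Proof. by rewrite mem_im cross_def dotDr dotNr dotZr dot11 mulr1 subrr. Qed.

Lemma imP u : u \in im C -> dot uno u = 0.
Proof. by rewrite mem_im => /eqP. Qed.

Lemma one_notin_im : uno \notin im C.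
Proof. by rewrite mem_im dot11 oner_eq0. Qed.

Section Imaginary.
Variable u : C.
Hypothesis u1 : dot uno u = 0.

Lemma dot1_mul v : dot uno (u ** v) = - dot u v.
Proof. by rewrite dotC dot_mull oconj_im // omul1r dotNr dotC. Qed.

Lemma crossE v : cross u v = u ** v + dot u v *: uno.
Proof. by rewrite cross_def dot1_mul scaleNr opprK. Qed.

Lemma sqr_im : u ** u = - (dot u u) *: uno.
Proof. by rewrite omul_sqr u1 mulr0 scale0r add0r scaleNr. Qed.

Lemma cross_self : cross u u = 0.
Proof. by rewrite crossE sqr_im scaleNr addNr. Qed.

Lemma mul_mul_im v : u ** (u ** v) = - (dot u u) *: v.
Proof. by rewrite -[LHS]opprK -omulNl -oconj_im // oconj_omulK scaleNr. Qed.

Lemma dot_mulC v w : dot (u ** v) w = - dot v (u ** w).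
Proof. by rewrite dot_mull oconj_im // omulNl dotNr. Qed.

Lemma dot_mul_self v : dot u (u ** v) = dot u u * dot uno v.
Proof. by rewrite dotC dot_mulC sqr_im dotZr mulNr opprK dotC. Qed.

End Imaginary.

Lemma mul_anti u v : dot uno u = 0 -> dot uno v = 0 ->
  v ** u = - (u ** v) - (2 * dot u v) *: uno.
Proof.
move=> u1 v1.
have := oconj_omul_polar u v uno; rewrite !omul1r !oconj_im // !omulNl => <-.
by vec_ring.
Qed.

Lemma cross_anti u v : dot uno u = 0 -> dot uno v = 0 -> cross v u = - cross u v.
Proof.
move=> u1 v1; rewrite !crossE // (mul_anti u1 v1) (dotC v).
by vec_ring.
Qed.

Lemma dot_cross u v : dot uno u = 0 -> dot uno v = 0 -> dot u (cross u v) = 0.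
Proof.
by move=> u1 v1; rewrite crossE // dotDr dot_mul_self // dotZr (dotC u uno) u1 v1
  !mulr0 addr0.
Qed.

Lemma cross_cross u v : dot uno u = 0 -> dot uno v = 0 ->
  cross u (cross u v) = dot u v *: u - dot u u *: v.
Proof.
move=> u1 v1; rewrite crossE // dot_cross // scale0r addr0 crossE // omulDr.
by rewrite omulZr omul1r mul_mul_im // scaleNr addrC.
Qed.

Lemma norm_cross u v : dot uno u = 0 -> dot uno v = 0 ->
  dot (cross u v) (cross u v) = dot u u * dot v v - dot u v ^+ 2.
Proof.
move=> u1 v1; rewrite !crossE // !dotDl !dotDr !dotZl !dotZr dot11.
rewrite (dotC _ uno) dot1_mul // dot_mulC // mul_mul_im // dotZr.
by ring.
Qed.

(** Two elements generate an associative subalgebra, of dimension at most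
    four: iterated cross products of [u] and [v] are reduced by [cross_cross]. *)
Lemma cross_closed_span u v s t : dot uno u = 0 -> dot uno v = 0 ->
  s \in <<[:: u; v; cross u v]>>%VS -> t \in <<[:: u; v; cross u v]>>%VS ->
  cross s t \in <<[:: u; v; cross u v]>>%VS.
Proof.
move=> u1 v1 /memv_span3[a [b [c ->]]] /memv_span3[a' [b' [c' ->]]].
have w1 : dot uno (cross u v) = 0 by apply: imP; exact: cross_im.
apply/memv_span3; rewrite !(crossDl, crossZl) !(crossDr, crossZr) !cross_self //.
rewrite (cross_anti u1 v1) (cross_anti u1 w1) (cross_anti v1 w1).
have -> : cross v (cross u v) = - (dot u v *: v - dot v v *: u).
  rewrite -(opprK (cross u v)) -cross_anti // -[- cross v u]scaleN1r crossZr.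
  by rewrite cross_cross // scaleN1r (dotC v u).
rewrite cross_cross //; exists ((a * c' - a' * c) * dot u v + (b * c' - b' * c) * dot v v).
exists (- (a * c' - a' * c) * dot u u - (b * c' - b' * c) * dot u v).
exists (a * b' - a' * b); by vec_ring.
Qed.

(** Imaginary parts of four-dimensional subalgebras, described without the
    subalgebra. *)
Definition cross_closed (U : {vspace C}) :=
  forall u v, u \in U -> v \in U -> cross u v \in U.

Definition subalg_variety : set (grassmannian 3 (im C)) :=
  [set U | exists A : {vspace C},
     [/\ uno \in A /\ forall x y, x \in A -> y \in A -> x ** y \in A,
         \dim A = 4 & val U = (A :&: im C)%VS]].

(** [u ** v] and [cross u v] differ by a multiple of the unit, so that adding
    the unit to a space closed under [cross] makes it closed under the
    product. *)
Lemma subalg_varietyP (U : grassmannian 3 (im C)) :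
  subalg_variety U <-> cross_closed (val U).
Proof.
have /andP[Uim /eqP dU] := valP U; split.
  case=> A [[A1 AM] _ ->] u v; rewrite !memv_cap => /andP[uA _] /andP[vA _].
  by rewrite cross_im andbT cross_def rpredB ?AM // memvZ.
move=> cU; exists (<[uno]> + val U)%VS.
have imU u : u \in val U -> dot uno u = 0 by move/(subvP Uim)/imP.
have u0 : uno != 0 by apply: contraNneq one_notin_im => ->; exact: mem0v.
have cap0 : (<[uno]> :&: val U)%VS = 0%VS.
  apply/eqP; rewrite -subv0; apply/subvP => v; rewrite memv_cap.
  case/andP => /vlineP[k ->] /imU; rewrite dotZr dot11 mulr1 => ->.
  by rewrite scale0r mem0v.
split.
- split; first by apply: (subvP (addvSl _ _)); rewrite memv_line.
  move=> x y /memv_addP[? /vlineP[a ->] [u uU ->{x}]].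
  case/memv_addP=> ? /vlineP[b ->] [v vU ->{y}].
  have -> : (a *: uno + u) ** (b *: uno + v) =
      (a * b - dot u v) *: uno + (a *: v + b *: u + cross u v).
    rewrite crossE ?imU // !omulDl !omulDr !omulZl !omulZr !omul1l omul1r.
    by vec_ring.
  apply: memv_add; first by rewrite memvZ ?memv_line.
  by rewrite !rpredD ?memvZ // cU.
- by rewrite dimv_disjoint_sum // dim_vline u0 dU.
- apply/vspaceP => v; rewrite memv_cap; apply/idP/andP => [vU|[]].
    split; last exact: (subvP Uim).
    by apply: (subvP (addvSr _ _)).
  case/memv_addP=> _ /vlineP[a ->] [u uU ->] /imP.
  by rewrite dotDr dotZr dot11 mulr1 imU // addr0 => ->; rewrite scale0r add0r.
Qed.

Lemma grass_of_span3 (a b c : C) : free [:: a; b; c] ->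
  a \in im C -> b \in im C -> c \in im C ->
  exists U : grassmannian 3 (im C), val U = <<[:: a; b; c]>>%VS.
Proof.
move=> f aI bI cI.
have h : (<<[:: a; b; c]>> <= im C)%VS && (\dim <<[:: a; b; c]>> == 3).
  rewrite (eqnP f) eqxx andbT; apply/span_subvP => v.
  by rewrite !inE => /or3P[] /eqP ->.
by exists (exist _ <<[:: a; b; c]>>%VS h).
Qed.

(** The source of points of the variety: curves and charts are families of
    pairs of generators. *)
Lemma ex_two_gen u v : dot uno u = 0 -> dot uno v = 0 ->
    free [:: u; v; cross u v] ->
  exists2 U, subalg_variety U & val U = <<[:: u; v; cross u v]>>%VS.
Proof.
move=> u1 v1 f.
have uI : u \in im C by rewrite mem_im u1.
have vI : v \in im C by rewrite mem_im v1.
have [U eU] := grass_of_span3 f uI vI (cross_im u v).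
by exists U => //; apply/subalg_varietyP => s t; rewrite eU; exact: cross_closed_span.
Qed.

End Cross.

(** * The three types of four-dimensional subalgebras *)

Section Classification.
Local Open Scope ring_scope.
Variables (K : numClosedFieldType) (C : compAlg K).
Local Notation "x ** y" := (omul x y) (at level 40, left associativity).
Local Notation uno := (@oone K C).
Implicit Types (x y z u v w e s : C) (a b p q r l : K).

Let two : 2 != 0 :> K := two_neq0 K.

Lemma sqr_i : 'i * 'i = -1 :> K. Proof. by rewrite -expr2 sqrCi. Qed.

Definition nondeg_space x y (z : C) : {vspace C} := <<[:: x; y; x ** y]>>%VS.

(** The radical of the norm is spanned by the last two vectors, which are
    eigenvectors of left multiplication by [x] for opposite eigenvalues. *)
Definition cone_space x y z : {vspace C} :=
  <<[:: x; (y - 'i *: (x ** y))%R; (z + 'i *: (x ** z))%R]>>%VS.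

(** The imaginary annihilator of the null vector that is its last generator. *)
Definition null_space x y z : {vspace C} :=
  <<[:: nb x y z 0 0 0 0 0 1 0 0; nb x y z 0 0 0 0 0 0 1 0;
        nb x y z 0 0 0 0 0 0 0 1]>>%VS.

(** Left multiplication by an imaginary unit [e] splits the perpendicular of
    [<1, e>] into two isotropic eigenspaces; the form puts them in duality, here
    realized by projecting an arbitrary vector [w]. *)
Lemma eigen_dual e l w : dot uno e = 0 -> dot e e = 1 -> l * l = -1 ->
  exists s, [/\ dot uno s = 0, dot e s = 0, e ** s = (- l) *: s &
    forall y, e ** y = l *: y -> dot uno y = 0 -> dot e y = 0 ->
      dot y s = dot y w].
Proof.
move=> e1 ee ll; pose w' := w - dot uno w *: uno - dot e w *: e.
have w'1 : dot uno w' = 0.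
  by rewrite /w' !(dotDr, dotNr, dotZr) dot11 e1; ring.
have w'e : dot e w' = 0.
  by rewrite /w' !(dotDr, dotNr, dotZr) ee (dotC e uno) e1; ring.
have dw y : dot uno y = 0 -> dot e y = 0 -> dot y w' = dot y w.
  move=> y1 ye; rewrite /w' !(dotDr, dotNr, dotZr) (dotC y uno) (dotC y e).
  by rewrite y1 ye; ring.
have ew1 : dot uno (e ** w') = 0 by rewrite dot1_mul // w'e oppr0.
have ewe : dot e (e ** w') = 0 by rewrite dot_mul_self // w'1 mulr0.
have eew : e ** (e ** w') = - w' by rewrite mul_mul_im // ee scaleN1r.
clearbody w'.
exists (2^-1 *: (w' + l *: (e ** w'))); split.
- by rewrite !(dotZr, dotDr) w'1 ew1 !(mulr0, addr0).
- by rewrite !(dotZr, dotDr) w'e ewe !(mulr0, addr0).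
- rewrite omulZr omulDr omulZr eew; apply: dot_inj => t.
  rewrite !(dotZl, dotDl, dotNl).
  by apply: (lincomb1 (c := 2^-1 * dot (e ** w') t)) ll _; ring.
- move=> y ey y1 ye; rewrite dotZr dotDr dotZr (dotC y (e ** w')) dot_mulC //.
  rewrite ey dotZr (dotC w') dw //; apply: (mulfI two).
  rewrite mulrA divff // mul1r.
  by apply: (lincomb1 (c := - dot y w)) ll _; ring.
Qed.

Lemma eigen_isotropic e l u v : dot uno e = 0 -> dot e e = 1 -> l * l = -1 ->
  e ** u = l *: u -> e ** v = l *: v -> dot u v = 0.
Proof.
move=> e1 ee ll eu ev; have := dot_mulC e1 u (l *: v).
rewrite eu -ev mul_mul_im // ee scaleN1r ev dotNr dotZl dotZr opprK => h.
apply: (mulfI two); rewrite mulr0.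
by apply: (lincomb2 (c := -1) (d := dot u v)) h ll _; ring.
Qed.

(** The product of two eigenvectors [u], [v] lies in the opposite eigenspace, hence
    vanishes if it is a combination of [e], [u], [v]. But then, for an eigenvector
    [s] of the opposite eigenspace that is perpendicular to [v] but not to [u], also
    [s ** v] vanishes, and polarizing the norm at [u] and [s] gives [v = 0]. *)
Lemma eigen_plane e l u v : dot uno e = 0 -> dot e e = 1 -> l * l = -1 ->
    dot uno u = 0 -> dot uno v = 0 -> dot e u = 0 -> dot e v = 0 ->
    e ** u = l *: u -> e ** v = l *: v ->
    cross u v \in <<[:: e; u; v]>>%VS -> ~~ free [:: e; u; v].
Proof.
move=> e1 ee ll u1 v1 eu0 ev0 eu ev; apply: contraPN => fr uvU.
have l0 : l != 0.
  by apply: contra_eq_neq ll => ->; rewrite mul0r eq_sym oppr_eq0 oner_eq0.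
have uv : dot u v = 0 := eigen_isotropic e1 ee ll eu ev.
move: uvU; rewrite crossE // uv scale0r addr0 => /memv_span3[a [b [c uvE]]].
have euv : e ** (u ** v) = (- l) *: (u ** v).
  have := oconj_omul_polar e u v; rewrite !oconj_im // !omulNl ev omulZr eu0.
  rewrite mulr0 scale0r => /eqP; rewrite addr_eq0 => /eqP /(congr1 -%R).
  by rewrite !opprK scaleNr => ->.
have a0 : a = 0.
  have : dot e (u ** v) = 0.
    rewrite dotC (dot_mulC u1) (mul_anti e1 u1) eu eu0.
    by rewrite !(dotDr, dotNr, dotZr) (dotC v u) uv (dotC v uno) v1; ring.
  by rewrite uvE !(dotDr, dotZr) ee eu0 ev0 mulr1 !mulr0 !addr0.
have uv0 : u ** v = 0.
  have : e ** (u ** v) = l *: (u ** v).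
    rewrite uvE a0 scale0r add0r omulDr !omulZr eu ev.
    by rewrite scalerDr !scalerA !(mulrC l).
  rewrite euv => /eqP; rewrite scaleNr eq_sym -addr_eq0 -scalerDl scaler_eq0.
  by rewrite -mulr2n mulrn_eq0 /= (negPf l0) => /eqP.
have frv : free [:: u; v] by move: fr; rewrite free_cons => /andP[].
have v0 : v != 0 by apply: (free_not0 frv); rewrite !inE eqxx orbT.
have [w0 vw0] := dot_neq0 v0.
pose c0 := dot u w0 / dot v w0.
have uv_neq0 : u - c0 *: v != 0.
  move: frv; rewrite free_cons span_seq1 => /andP[+ _]; apply: contraNneq.
  by move/subr0_eq ->; rewrite memvZ ?memv_line.
have [t ut] := dot_neq0 uv_neq0.
have [s [s1 es0 es sdual]] :=
  eigen_dual (t - (dot v t / dot v w0) *: w0) e1 ee ll.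
have vs : dot v s = 0.
  by rewrite sdual // dotDr dotNr dotZr divfK // subrr.
have us : dot u s != 0.
  rewrite sdual //; move: ut; rewrite !(dotDr, dotNr, dotZr, dotDl, dotNl, dotZl).
  rewrite (_ : c0 * dot v t = dot v t / dot v w0 * dot u w0) // /c0.
  by move: (dot v w0)^-1 => i; ring.
have sv0 : s ** v = 0.
  have h1 := oconj_omul_polar e s v; have h2 := oconj_omul_polar e v s.
  move: h1 h2; rewrite !oconj_im // !omulNl ev es !omulZr es0 ev0 mulr0 !scale0r.
  have -> : v ** s = - (s ** v).
    by rewrite mul_anti // (dotC s) vs mulr0 scale0r subr0.
  rewrite omulNr => h1 h2; apply/eqP; have : (2 * l) *: (s ** v) == 0.
    apply/eqP/dot_inj => t'; move/(congr1 (dot^~ t')): h2.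
    move/(congr1 (dot^~ t')): h1; rewrite !(dotDl, dotNl, dotZl, dot0l).
    by move=> h1 h2; apply: (lincomb2 (c := -1) (d := -1)) h1 h2 _; ring.
  by rewrite scaler_eq0 mulf_eq0 (negPf two) (negPf l0).
have := oconj_omul_polar u s v.
rewrite sv0 uv0 !omul0r addr0 => /esym/eqP.
by rewrite scaler_eq0 mulf_eq0 (negPf two) (negPf us) (negPf v0).
Qed.

(** Each of [y], [z] is isotropic, and is completed to a unit vector by adding a dual
    eigenvector for the opposite eigenvalue, given by [eigen_dual]. *)
Lemma eigen_pair_triple e y z : dot uno e = 0 -> dot e e = 1 ->
    dot uno y = 0 -> dot uno z = 0 -> dot e y = 0 -> dot e z = 0 ->
    e ** y = 'i *: y -> e ** z = - 'i *: z -> y != 0 -> z != 0 -> dot y z = 0 ->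
  exists y' z', [/\ basic_triple e y' z', y' - 'i *: (e ** y') = 2 *: y
                  & z' + 'i *: (e ** z') = 2 *: z].
Proof.
move=> e1 ee y1 z1 ey0 ez0 ey ez y0 z0 yz.
have ll := sqr_i; have ll' : - 'i * - 'i = -1 :> K by rewrite mulrNN.
have [w yw] := dot_neq0 y0.
have [s [s1 es0 es sdual]] := eigen_dual ((2 * dot y w)^-1 *: w) e1 ee ll.
have ys : dot y s = 2^-1.
  by rewrite sdual // dotZr invfM mulfVK.
have [t zt] := dot_neq0 z0.
pose t' := t - (2 * dot s t) *: y.
have zt' : dot z t' = dot z t.
  by rewrite dotDr dotNr dotZr (dotC z y) yz mulr0 subr0.
have st' : dot s t' = 0.
  by rewrite dotDr dotNr dotZr (dotC s y) ys; field.
have [r [r1 er0 er rdual]] := eigen_dual ((2 * dot z t)^-1 *: t') e1 ee ll'.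
have zr : dot z r = 2^-1.
  by rewrite rdual // dotZr zt' invfM mulfVK.
have sr : dot s r = 0 by rewrite rdual // dotZr st' mulr0.
rewrite opprK in er.
have yy : dot y y = 0 := eigen_isotropic e1 ee ll ey ey.
have yr : dot y r = 0 := eigen_isotropic e1 ee ll ey er.
have rr : dot r r = 0 := eigen_isotropic e1 ee ll er er.
have zz : dot z z = 0 := eigen_isotropic e1 ee ll' ez ez.
have ss : dot s s = 0 := eigen_isotropic e1 ee ll' es es.
have zs : dot z s = 0 := eigen_isotropic e1 ee ll' ez es.
have h2 : 2^-1 + 2^-1 = 1 :> K by field.
exists (y + s), (z + r); split.
- split; [|split]; split=> //; rewrite ?omulDr ?ey ?es !(dotDl, dotDr, dotZl).
  + by rewrite y1 s1 addr0.
  + by rewrite z1 r1 addr0.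
  + by rewrite yy ss (dotC s y) ys add0r addr0.
  + by rewrite zz rr (dotC r z) zr add0r addr0.
  + by rewrite ey0 es0 addr0.
  + by rewrite ez0 er0 addr0.
  + by rewrite yz yr (dotC s z) zs sr !addr0.
  + by rewrite yz yr (dotC s z) zs sr; ring.
- rewrite omulDr ey es; apply: dot_inj => v.
  rewrite !(dotDl, dotNl, dotZl).
  by apply: (lincomb1 (c := - dot y v + dot s v)) ll _; ring.
- rewrite omulDr ez er; apply: dot_inj => v.
  rewrite !(dotDl, dotNl, dotZl).
  by apply: (lincomb1 (c := - dot z v + dot r v)) ll _; ring.
Qed.

(** A null vector is one half of a hyperbolic pair [n], [w], whose sum and
    difference give the first and the third entry of the triple. *)
Lemma null_triple (n : C) : n != 0 -> dot uno n = 0 -> dot n n = 0 ->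
  exists x y z, basic_triple x y z /\ n = nb x y z 0 0 0 0 0 0 0 1.
Proof.
move=> n0 n1 nn; have [w0 nw0] := dot_neq0 n0.
pose w1 := w0 - dot uno w0 *: uno.
have w11 : dot uno w1 = 0 by rewrite !(dotDr, dotNr, dotZr) dot11; ring.
have nw1 : dot n w1 != 0.
  by rewrite !(dotDr, dotNr, dotZr) (dotC n uno) n1 mulr0 subr0.
clearbody w1; pose w2 := w1 - (dot w1 w1 / (2 * dot n w1)) *: n.
have w21 : dot uno w2 = 0 by rewrite !(dotDr, dotNr, dotZr) w11 n1; ring.
have nw2 : dot n w2 = dot n w1 by rewrite !(dotDr, dotNr, dotZr) nn; ring.
have ww2 : dot w2 w2 = 0.
  rewrite !(dotDl, dotNl, dotZl, dotDr, dotNr, dotZr) nn (dotC w1 n).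
  by field.
clearbody w2; pose w := (2 / dot n w1) *: w2.
have ww : dot w w = 0 by rewrite dotZl dotZr ww2 !mulr0.
have nw : dot n w = 2 by rewrite dotZr nw2 divfK.
have w1' : dot uno w = 0 by rewrite dotZr w21 mulr0.
clearbody w.
pose x := 2^-1 *: (n + w); pose z := (- 'i / 2) *: (n - w).
have x1 : dot uno x = 0 by rewrite dotZr dotDr n1 w1' addr0 mulr0.
have z1 : dot uno z = 0 by rewrite dotZr dotDr dotNr n1 w1' subr0 mulr0.
have xx : dot x x = 1.
  by rewrite !(dotZl, dotZr, dotDl, dotDr) nn ww (dotC w) nw; field.
have zz : dot z z = 1.
  rewrite !(dotZl, dotZr, dotDl, dotDr, dotNl, dotNr) nn ww (dotC w) nw.
  transitivity (- ('i * 'i) : K); last by rewrite sqr_i opprK.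
  by field.
have xz : dot x z = 0.
  by rewrite !(dotZl, dotZr, dotDl, dotDr, dotNr) nn ww (dotC w) nw; ring.
have nE : n = x + 'i *: z.
  rewrite /x /z; apply: dot_inj => v; rewrite !(dotZl, dotDl, dotNl).
  apply: (mulfI two); have i2 : 2 * 2^-1 = 1 :> K by rewrite divff.
  apply: (lincomb2 (c := 2^-1 * 2 * (dot n v - dot w v)) (d := - 2 * dot n v)) sqr_i i2 _.
  by field.
have [y [yy y1 xy zy xzy]] := ex_perp4 (And3 x1 z1 xz) xx zz.
exists x, y, z; split.
  split; [|split]; split=> //; first by rewrite dotC.
  by rewrite dot_mulC // dotC xzy oppr0.
by rewrite /nb nE; vec_ring.
Qed.

(** The annihilator of a null vector among the imaginary elements is
    three-dimensional, by the multiplication table of the null basis. *)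
Lemma null_spaceP x y z (U : {vspace C}) : basic_triple x y z ->
    (U <= im C)%VS -> \dim U = 3 ->
    (forall v, v \in U -> nb x y z 0 0 0 0 0 0 0 1 ** v = 0) ->
  U = null_space x y z.
Proof.
move=> bt Uim dU ann; apply: span3_sub => //; apply/subvP => v vU.
have [a1 [a2 [a3 [a4 [a5 [a6 [a7 vE]]]]]]] := nb_im_surj bt (subvP Uim v vU).
have := ann v vU; rewrite vE nb_mul // -[X in _ = X -> _](scale0r uno).
rewrite -(nb1 x y z) nbZ => /(nb_inj bt)[[h0 h1 h2 h3] [h4 h5 h6 h7]].
have a10 : a1 = 0.
  by apply: (mulfI two); apply: (lincomb1 (c := -1)) h0 _; ring.
have a20 : a2 = 0.
  by apply: (mulfI two); apply: (lincomb1 (c := 1)) h5 _; ring.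
have a30 : a3 = 0.
  by apply: (mulfI two); apply: (lincomb1 (c := -1)) h6 _; ring.
have a40 : a4 = 0.
  apply: (lincomb2 (c := - 'i) (d := a4)) h7 sqr_i _; ring.
apply/memv_span3; exists a5, a6, a7; rewrite a10 a20 a30 a40 !nbZ !nbD.
by congr nb; ring.
Qed.

Lemma basic_pair_table x y : dot uno x = 0 -> dot uno y = 0 -> dot x y = 0 ->
    dot x x = 1 -> dot y y = 1 ->
  [/\ dot uno (x ** y) = 0, dot x (x ** y) = 0, dot y (x ** y) = 0
    & dot (x ** y) (x ** y) = 1].
Proof.
move=> x1 y1 xy xx yy; split.
- by rewrite dot1_mul // xy oppr0.
- by rewrite dot_mul_self // y1 mulr0.
- apply: (mulfI two); rewrite mulr0 mulr_natl mulr2n -{1}(opprK (dot y _)).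
  by rewrite -dot_mulC // dotC addNr.
- by rewrite dot_mulC // mul_mul_im // dotZr xx yy mulr1 opprK.
Qed.

Lemma basic_pair_free x y : dot uno x = 0 -> dot uno y = 0 -> dot x y = 0 ->
  dot x x = 1 -> dot y y = 1 -> free [:: x; y; x ** y].
Proof.
move=> x1 y1 xy xx yy; have [k1 kx ky kk] := basic_pair_table x1 y1 xy xx yy.
apply: free3P => p q r e; have d u := congr1 (dot u) e.
have := d x; have := d y; have := d (x ** y).
rewrite !(dotDr, dotZr) !dot0r xx yy kk xy kx ky (dotC y x) xy.
rewrite (dotC _ x) kx (dotC _ y) ky !mulr0 !mulr1 !addr0 !add0r.
by move=> -> -> ->.
Qed.

Lemma eigen_free e y z : dot uno e = 0 -> dot e e = 1 -> dot e y = 0 ->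
    dot e z = 0 -> e ** y = 'i *: y -> e ** z = - 'i *: z -> y != 0 -> z != 0 ->
  free [:: e; y; z].
Proof.
move=> e1 ee ey0 ez0 ey ez y0 z0; apply: free3P => p q r h.
have p0 : p = 0.
  have := congr1 (dot e) h.
  by rewrite !(dotDr, dotZr) ee ey0 ez0 dot0r mulr1 !mulr0 !addr0.
move: h; rewrite p0 scale0r add0r => h.
have h' : q *: y - r *: z = 0.
  have := congr1 (fun u => - 'i *: (e ** u)) h.
  rewrite omulDr !omulZr ey ez omul0r scaler0 => <-.
  apply: dot_inj => u; rewrite !(dotDl, dotNl, dotZl).
  by apply: (lincomb1 (c := q * dot y u - r * dot z u)) sqr_i _; ring.
have qy : q *: y = 0.
  apply: (scalerI two); rewrite scaler0 -[RHS]addr0 -{1}h -h'; vec_ring.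
split=> //; first by move/eqP: qy; rewrite scaler_eq0 (negPf y0) orbF => /eqP.
by move/eqP: h; rewrite qy add0r scaler_eq0 (negPf z0) orbF => /eqP.
Qed.

(** If the two eigenvectors are perpendicular the norm degenerates on the
    space, and the triple is that of [eigen_pair_triple]. Otherwise some
    combination of them has norm one and generates with [e] a quaternion
    algebra. *)
Lemma eigen_classification (U : {vspace C}) e y z :
    (U <= im C)%VS -> \dim U = 3 -> cross_closed U ->
    e \in U -> y \in U -> z \in U -> dot e e = 1 -> dot e y = 0 -> dot e z = 0 ->
    e ** y = 'i *: y -> e ** z = - 'i *: z -> y != 0 -> z != 0 ->
  exists x y z, basic_triple x y z /\
    (U = nondeg_space x y z \/ U = cone_space x y z).
Proof.
move=> Uim dU cU eU yU zU ee ey0 ez0 ey ez y0 z0.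
have imU u : u \in U -> dot uno u = 0 by move/(subvP Uim)/imP.
have [e1 y1 z1] : [/\ dot uno e = 0, dot uno y = 0 & dot uno z = 0].
  by split; exact: imU.
have ll' : - 'i * - 'i = -1 :> K by rewrite mulrNN sqr_i.
have [yz|yz] := eqVneq (dot y z) 0.
  have [y' [z' [bt yE zE]]] :=
    eigen_pair_triple e1 ee y1 z1 ey0 ez0 ey ez y0 z0 yz.
  exists e, y', z'; split=> //; right; rewrite /cone_space yE zE.
  apply: span3_eq; rewrite ?memvZ //.
  apply: eigen_free; rewrite ?dotZr ?ey0 ?ez0 ?mulr0 ?omulZr ?ey ?ez //.
  - by rewrite !scalerA mulrC.
  - by rewrite !scalerA mulrC.
  - by rewrite scaler_eq0 negb_or two.
  - by rewrite scaler_eq0 negb_or two.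
pose y' := y + (2 * dot y z)^-1 *: z.
have y'U : y' \in U by rewrite rpredD ?memvZ.
have yy : dot y y = 0 := eigen_isotropic e1 ee sqr_i ey ey.
have zz : dot z z = 0 := eigen_isotropic e1 ee ll' ez ez.
have yy' : dot y' y' = 1.
  rewrite !(dotDl, dotDr, dotZl, dotZr) yy zz (dotC z); by field.
have ey' : dot e y' = 0 by rewrite dotDr dotZr ey0 ez0 mulr0 addr0.
have y'1 := imU _ y'U; clearbody y'.
have [w bt] := basic_triple_of_pair (And3 e1 y'1 ey') ee yy'.
exists e, y', w; split=> //; left; apply: span3_eq => //.
  exact: basic_pair_free.
by have := cU _ _ eU y'U; rewrite crossE // ey' scale0r addr0.
Qed.

(** If the norm does not vanish on the space, there is a unit vector [e] in
    it, and [v - i e v], [v + i e v] are eigenvectors of left multiplication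
    by [e]; both eigenvalues occur by [eigen_plane]. If the norm vanishes, the
    space is closed under the product and some nonzero element of it
    annihilates it: any [a] will do if all products vanish, and otherwise a
    nonzero product [a ** b] does, because it is annihilated by [a], [b] and
    itself. *)
Lemma classification (U : {vspace C}) :
    (U <= im C)%VS -> \dim U = 3 -> cross_closed U ->
  exists x y z, basic_triple x y z /\
  [\/ U = nondeg_space x y z, U = cone_space x y z | U = null_space x y z].
Proof.
move=> Uim dU cU.
have imU u : u \in U -> dot uno u = 0 by move/(subvP Uim)/imP.
have [[e0 e0U e00]|nullU] := pselect (exists2 e, e \in U & dot e e != 0).
  pose e := (sqrtC (dot e0 e0))^-1 *: e0.
  have eU : e \in U by rewrite memvZ.
  have ee : dot e e = 1.
    by rewrite dotZl dotZr mulrA -invfM -expr2 sqrtCK mulVf.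
  have e1 := imU _ eU; clearbody e.
  have e_neq0 : e != 0.
    by apply: contra_eq_neq ee => ->; rewrite dot0l eq_sym oner_eq0.
  have mulU u : u \in U -> dot e u = 0 -> e ** u \in U /\ dot e (e ** u) = 0.
    move=> uU eu; have := cU _ _ eU uU; rewrite crossE // eu scale0r addr0.
    by split=> //; rewrite dot_mul_self // imU // mulr0.
  have eeu u : e ** (e ** u) = - u by rewrite mul_mul_im // ee scaleN1r.
  have [v1 [v2 [v1U v2U ev1 ev2 fr]]] : exists v1 v2, [/\ v1 \in U, v2 \in U,
      dot e v1 = 0, dot e v2 = 0 & free [:: e; v1; v2]].
    have [v1 [v2 [v1U v2U fr]]] := dim3_extend dU eU e_neq0.
    pose P v := v - dot e v *: e.
    have PU v : v \in U -> P v \in U by move=> vU; rewrite rpredB ?memvZ.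
    have Pe v : dot e (P v) = 0 by rewrite dotDr dotNr dotZr ee mulr1 subrr.
    exists (P v1), (P v2); split; rewrite ?PU ?Pe //.
    apply: free3P => p q r h.
    have [|h1 h2 h3] := @free3E _ _ _ _ _ (p - q * dot e v1 - r * dot e v2) q r fr.
      by rewrite -h /P; vec_ring.
    by move: h1; rewrite h2 h3 !mul0r !subr0.
  pose Y v := v - 'i *: (e ** v); pose Z v := v + 'i *: (e ** v).
  have YZ v : v \in U -> dot e v = 0 -> [/\ Y v \in U, Z v \in U &
     [/\ dot e (Y v) = 0, dot e (Z v) = 0, e ** Y v = 'i *: Y v
       & e ** Z v = - 'i *: Z v]].
    move=> vU ev; have [evU eev] := mulU v vU ev; split.
    - by rewrite rpredB ?memvZ.
    - by rewrite rpredD ?memvZ.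
    split.
    - by rewrite dotDr dotNr dotZr ev eev mulr0 subrr.
    - by rewrite dotDr dotZr ev eev mulr0 addr0.
    - rewrite omulDr omulNr omulZr eeu; apply: dot_inj => u.
      rewrite !(dotZl, dotDl, dotNl).
      by apply: (lincomb1 (c := dot (e ** v) u)) sqr_i _; ring.
    - rewrite omulDr omulZr eeu; apply: dot_inj => u.
      rewrite !(dotZl, dotDl, dotNl).
      by apply: (lincomb1 (c := dot (e ** v) u)) sqr_i _; ring.
  have Y0 v : Y v = 0 -> e ** v = - 'i *: v.
    move/subr0_eq => vE; rewrite [X in _ = _ *: X]vE scalerA mulNr sqr_i opprK.
    by rewrite scale1r.
  have Z0 v : Z v = 0 -> e ** v = 'i *: v.
    move/eqP; rewrite addr_eq0 => /eqP vE; rewrite [X in _ = _ *: X]vE.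
    by rewrite scalerN scalerA sqr_i scaleN1r opprK.
  have [Y1U Z1U [eY1 eZ1 lY1 lZ1]] := YZ v1 v1U ev1.
  have [Y2U Z2U [eY2 eZ2 lY2 lZ2]] := YZ v2 v2U ev2.
  have ll' : - 'i * - 'i = -1 :> K by rewrite mulrNN sqr_i.
  have UE : U = <<[:: e; v1; v2]>>%VS by apply: span3_eq.
  have v10 : v1 != 0 by apply: (free_not0 fr); rewrite !inE eqxx orbT.
  have plane l : l * l = -1 -> e ** v1 = l *: v1 -> e ** v2 = l *: v2 -> False.
    move=> ll l1 l2; move: fr; apply/negP.
    apply: (eigen_plane e1 ee ll) l1 l2 _; rewrite ?imU // -UE.
    exact: cU.
  suff [y [z [yU zU [ey0 ez0 ey ez] [y0 z0]]]] : exists y z, [/\ y \in U, z \in U,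
      [/\ dot e y = 0, dot e z = 0, e ** y = 'i *: y & e ** z = - 'i *: z]
      & y != 0 /\ z != 0].
    have [x [y' [z' [bt h]]]] :=
      eigen_classification Uim dU cU eU yU zU ee ey0 ez0 ey ez y0 z0.
    by exists x, y', z'; split=> //; case: h => ->; [constructor 1|constructor 2].
  have [Yv1|Yv1] := eqVneq (Y v1) 0.
    have l1 := Y0 _ Yv1; have [Yv2|Yv2] := eqVneq (Y v2) 0.
      by case: (plane _ ll' l1 (Y0 _ Yv2)).
    by exists (Y v2), v1.
  have [Zv1|Zv1] := eqVneq (Z v1) 0; last by exists (Y v1), (Z v1).
  have l1 := Z0 _ Zv1; have [Zv2|Zv2] := eqVneq (Z v2) 0.
    by case: (plane _ sqr_i l1 (Z0 _ Zv2)).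
  by exists v1, (Z v2).
have {}nullU u : u \in U -> dot u u = 0.
  by move=> uU; apply: contrapT => /eqP uu; apply: nullU; exists u.
have null2 u v : u \in U -> v \in U -> dot u v = 0.
  move=> uU vU; have := nullU (u + v) (rpredD uU vU).
  rewrite !dotDl !dotDr (nullU u) // (nullU v) // (dotC v) add0r addr0.
  by move/eqP; rewrite -mulr2n mulrn_eq0 /= => /eqP.
have mulU u v : u \in U -> v \in U -> u ** v \in U.
  by move=> uU vU; have := cU u v uU vU; rewrite crossE ?imU // null2 // scale0r addr0.
suff [n nU [n0 ann]] : exists2 n, n \in U & n != 0 /\ forall v, v \in U -> n ** v = 0.
  have [x [y [z [bt nE]]]] := null_triple n0 (imU _ nU) (nullU _ nU).
  exists x, y, z; split=> //; constructor 3.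
  by apply: null_spaceP => // v vU; rewrite -nE ann.
have [|a aU a0] := @vspace_neq0 _ _ U; first by rewrite dU.
have [[b bU ab]|aann] := pselect (exists2 b, b \in U & a ** b != 0); last first.
  exists a => //; split=> // b bU.
  by apply: contrapT => /eqP ab; apply: aann; exists b.
exists (a ** b); first exact: mulU.
split=> // v vU; set n := a ** b.
have nU : n \in U by exact: mulU.
have an : a ** n = 0 by rewrite mul_mul_im ?imU // nullU // oppr0 scale0r.
have nE : n = - (b ** a).
  by rewrite (mul_anti (imU a aU) (imU b bU)) null2 // mulr0 scale0r subr0 opprK.
have bn : b ** n = 0.
  by rewrite nE omulNr mul_mul_im ?imU // nullU // oppr0 scale0r oppr0.
have anti u : u \in U -> n ** u = - (u ** n).
  by move=> uU; rewrite (mul_anti (imU u uU) (imU n nU)) null2 // mulr0 scale0r subr0.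
have fr : free [:: a; b; n].
  apply: free3P => p q r h.
  have q0 : q = 0.
    have := congr1 (omul a) h; rewrite !omulDr !omulZr an sqr_im ?imU // nullU //.
    rewrite oppr0 !(scale0r, scaler0) add0r addr0 omul0r => /eqP.
    by rewrite scaler_eq0 (negPf ab) orbF => /eqP.
  have p0 : p = 0.
    have := congr1 (omul b) h; rewrite !omulDr !omulZr bn sqr_im ?imU // nullU //.
    rewrite oppr0 !(scale0r, scaler0) !addr0 omul0r => /eqP.
    by rewrite -[b ** a]opprK -nE scaler_eq0 oppr_eq0 (negPf ab) orbF => /eqP.
  move: h; rewrite p0 q0 !scale0r !add0r => /eqP.
  by rewrite scaler_eq0 (negPf ab) orbF => /eqP.
move: vU; rewrite (span3_eq dU fr) // => /memv_span3[p [q [r ->]]].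
have na : n ** a = 0 by rewrite anti // an oppr0.
have nb0 : n ** b = 0 by rewrite anti // bn oppr0.
have nn : n ** n = 0 by rewrite (sqr_im (imU n nU)) (nullU n nU) oppr0 scale0r.
by rewrite !omulDr !omulZr na nb0 nn !scaler0 !addr0.
Qed.

End Classification.

(** * Orbits *)

Section Orbits.
Local Open Scope classical_set_scope.
Local Open Scope ring_scope.
Variables (K : numClosedFieldType) (C : compAlg K).
Local Notation "x ** y" := (omul x y) (at level 40, left associativity).
Local Notation uno := (@oone K C).
Local Notation G := (@alg_aut K C).
Implicit Types (x y z u v w e s : C) (a b p q r l : K).

Let two : 2 != 0 :> K := two_neq0 K.

Lemma nb_eq0 x y z a0 a1 a2 a3 a4 a5 a6 a7 : basic_triple x y z ->
    nb x y z a0 a1 a2 a3 a4 a5 a6 a7 = 0 ->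
  [/\ a0 = 0, a1 = 0, a2 = 0 & a3 = 0] /\ [/\ a4 = 0, a5 = 0, a6 = 0 & a7 = 0].
Proof.
move=> bt; rewrite -(scale0r uno) -(nb1 x y z) nbZ => /(nb_inj bt).
by rewrite !mulr0 mulr1.
Qed.

Definition two_generated (U : {vspace C}) := exists u v,
  [/\ dot uno u = 0, dot uno v = 0, free [:: u; v; cross u v]
    & U = <<[:: u; v; cross u v]>>%VS].

Lemma two_gen_nondeg x y z : basic_triple x y z ->
  two_generated (nondeg_space x y z).
Proof.
case=> -[x1 y1 _] [[xx yy _] [xy _ _ _]]; exists x, y.
have -> : cross x y = x ** y by rewrite crossE // xy scale0r addr0.
by split=> //; exact: basic_pair_free.
Qed.

Lemma cone_eigen x y z : basic_triple x y z ->
  let a := y - 'i *: (x ** y) in let b := z + 'i *: (x ** z) in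
  [/\ dot uno a = 0, dot uno b = 0, dot x a = 0, dot x b = 0 & dot a b = 0] /\
  [/\ x ** a = 'i *: a, x ** b = - 'i *: b & free [:: x; a; b]].
Proof.
case=> -[x1 y1 z1] [[xx yy zz] [xy xz yz kz]] a b.
have [k1 kx ky kk] := basic_pair_table x1 y1 xy xx yy.
have [l1 lx lz ll] := basic_pair_table x1 z1 xz xx zz.
have a1 : dot uno a = 0 by rewrite dotDr dotNr dotZr y1 k1 mulr0 subr0.
have b1 : dot uno b = 0 by rewrite dotDr dotZr z1 l1 mulr0 addr0.
have xa : dot x a = 0 by rewrite dotDr dotNr dotZr xy kx mulr0 subr0.
have xb : dot x b = 0 by rewrite dotDr dotZr xz lx mulr0 addr0.
have ea : x ** a = 'i *: a.
  rewrite omulDr omulNr omulZr mul_mul_im // xx; apply: dot_inj => u.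
  rewrite !(dotDl, dotNl, dotZl).
  by apply: (lincomb1 (c := dot (x ** y) u)) (sqr_i K) _; ring.
have eb : x ** b = - 'i *: b.
  rewrite omulDr omulZr mul_mul_im // xx; apply: dot_inj => u.
  rewrite !(dotDl, dotNl, dotZl).
  by apply: (lincomb1 (c := dot (x ** z) u)) (sqr_i K) _; ring.
have ab : dot a b = 0.
  have yl : dot y (x ** z) = 0 by rewrite -[LHS]opprK -dot_mulC // kz oppr0.
  have kl : dot (x ** y) (x ** z) = 0.
    by rewrite dot_mulC // mul_mul_im // dotZr yz mulr0 oppr0.
  rewrite /a /b !(dotDl, dotNl, dotZl, dotDr, dotZr) yz kz yl kl.
  by ring.
split=> //; split=> //; apply: eigen_free => //.
  have : dot y a != 0 by rewrite dotDr dotNr dotZr yy ky mulr0 subr0 oner_eq0.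
  by apply: contra_neq => ->; rewrite dot0r.
have : dot z b != 0 by rewrite dotDr dotZr zz lz mulr0 addr0 oner_eq0.
by apply: contra_neq => ->; rewrite dot0r.
Qed.

(** Left multiplication by [x] has distinct eigenvalues on the two isotropic
    vectors, so that their sum generates both. *)
Lemma two_gen_cone x y z : basic_triple x y z ->
  two_generated (cone_space x y z).
Proof.
move=> bt; have [x1 xx] : dot uno x = 0 /\ dot x x = 1 by case: bt => -[? _ _] [[? _ _] _].
have := cone_eigen bt; rewrite /cone_space /=.
set a := y - _; set b := z + _; move=> [[a1 b1 xa xb ab] [ea eb fr]].
clearbody a b; exists x, (a + b).
have -> : cross x (a + b) = 'i *: (a - b).
  rewrite crossE // omulDr ea eb dotDr xa xb; vec_ring.
have fr' : free [:: x; a + b; 'i *: (a - b)].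
  apply: free3P => p q r h.
  have [|p0 h1 h2] := @free3E _ _ _ _ _ p (q + r * 'i) (q - r * 'i) fr.
    by rewrite -h; vec_ring.
  have q0 : q = 0.
    by apply: (mulfI two); apply: (lincomb2 (c := 1) (d := 1)) h1 h2 _; ring.
  split=> //; move: h1; rewrite q0 add0r => /eqP.
  by rewrite mulf_eq0 (negPf (neq0Ci _)) orbF => /eqP.
split=> //; first by rewrite dotDr a1 b1 addr0.
apply: span3_eq => //; first by rewrite (eqnP fr).
- by apply/memv_span3; exists 1, 0, 0; vec_ring.
- by apply/memv_span3; exists 0, 1, 1; vec_ring.
- by apply/memv_span3; exists 0, 'i, (- 'i); vec_ring.
Qed.

Lemma nb0 x y z : nb x y z 0 0 0 0 0 0 0 0 = 0.
Proof. by rewrite /nb; vec_ring. Qed.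

Lemma two_gen_null x y z : basic_triple x y z ->
  two_generated (null_space x y z).
Proof.
move=> bt; pose e := nb x y z 0 0 0 0 0 1 0 0; pose f := nb x y z 0 0 0 0 0 0 1 0.
have im0 a1 a2 a3 a4 a5 a6 a7 : dot uno (nb x y z 0 a1 a2 a3 a4 a5 a6 a7) = 0.
  by apply: imP; rewrite nb_im.
have efE : cross e f = nb x y z 0 0 0 0 0 0 0 (-2).
  rewrite crossE ?im0 // nb_dot // nb_mul //.
  set d := (X in X *: _); have -> : d = 0 by rewrite /d; ring.
  by rewrite scale0r addr0; congr nb; ring.
have fr : free [:: e; f; cross e f].
  apply: free3P => p q r; rewrite efE !nbZ !nbD => /(nb_eq0 bt)[_ [_ h1 h2 h3]].
  move: h1 h2 h3; rewrite !mulr0 !mulr1 !addr0 !add0r => -> -> /eqP.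
  by rewrite mulrN oppr_eq0 mulf_eq0 (negPf two) orbF => /eqP.
exists e, f; split; rewrite ?im0 //; apply/esym/span3_sub; first by rewrite (eqnP fr).
apply/span_subvP => v; rewrite !inE efE => /or3P[] /eqP ->; apply/memv_span3.
- by exists 1, 0, 0; rewrite /e !nbZ !nbD; congr nb; ring.
- by exists 0, 1, 0; rewrite /f !nbZ !nbD; congr nb; ring.
- by exists 0, 0, (-2); rewrite !nbZ !nbD; congr nb; ring.
Qed.

Definition model_space (k : nat) :=
  match k with 0%N => nondeg_space | 1%N => cone_space | _ => null_space end.

Lemma two_gen_model k x y z : basic_triple x y z ->
  two_generated (model_space k x y z).
Proof.
by case: k => [|[|k]]; [exact: two_gen_nondeg|exact: two_gen_cone|exact: two_gen_null].
Qed.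

Lemma ex_model k x y z : basic_triple x y z ->
  exists2 U : grassmannian 3 (im C), subalg_variety U & val U = model_space k x y z.
Proof.
move=> /(two_gen_model k)[u [v [u1 v1 fr ->]]]; exact: ex_two_gen.
Qed.

Lemma subalg_model (U : grassmannian 3 (im C)) : subalg_variety U ->
  exists k x y z, [/\ (k < 3)%N, basic_triple x y z & val U = model_space k x y z].
Proof.
have /andP[Uim /eqP dU] := valP U; move=> /subalg_varietyP cU.
have [x [y [z [bt []->]]]] := classification Uim dU cU.
- by exists 0%N, x, y, z.
- by exists 1%N, x, y, z.
- by exists 2, x, y, z.
Qed.

Lemma subalg_two_gen (U : grassmannian 3 (im C)) : subalg_variety U ->
  two_generated (val U).
Proof. by move=> /subalg_model[k [x [y [z [_ bt ->]]]]]; exact: two_gen_model. Qed.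

(** The radical of the norm on the space distinguishes the three types: it is
    zero, two-dimensional, or everything. *)
Lemma model_space_inj k k' x y z x' y' z' :
    basic_triple x y z -> basic_triple x' y' z' -> (k < 3)%N -> (k' < 3)%N ->
  model_space k x y z = model_space k' x' y' z' -> k = k'.
Proof.
pose nul (U : {vspace C}) := forall u v, u \in U -> v \in U -> dot u v = 0.
pose deg (U : {vspace C}) := exists2 u, u != 0 & u \in U /\ forall v, v \in U -> dot u v = 0.
have H k0 x0 y0 z0 : basic_triple x0 y0 z0 -> (k0 < 3)%N ->
    (nul (model_space k0 x0 y0 z0) <-> k0 = 2) /\
    (deg (model_space k0 x0 y0 z0) <-> k0 <> 0%N).
  move=> bt; case: k0 => [|[|[|//]]] _ /=.
  - case: bt => -[x1 y1 _] [[xx yy _] [xy _ _ _]].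
    have [k1 kx ky kk] := basic_pair_table x1 y1 xy xx yy.
    have xU : x0 \in nondeg_space x0 y0 z0 by rewrite memv_span ?inE ?eqxx.
    have yU : y0 \in nondeg_space x0 y0 z0 by rewrite memv_span ?inE ?eqxx ?orbT.
    have kU : x0 ** y0 \in nondeg_space x0 y0 z0.
      by rewrite memv_span ?inE ?eqxx ?orbT.
    have nN : ~ nul (nondeg_space x0 y0 z0).
      by move=> h; have /eqP := h _ _ xU xU; rewrite xx oner_eq0.
    suff nD : ~ deg (nondeg_space x0 y0 z0) by [].
    case=> u u0 [/memv_span3[p [q [r uE]]] h]; case/negP: u0.
    apply/eqP; move: (h _ xU) (h _ yU) (h _ kU).
    rewrite {1 2 3}uE !(dotDl, dotZl) xx yy kk xy kx ky (dotC y0 x0) xy.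
    rewrite (dotC _ x0) kx (dotC _ y0) ky !mulr0 !mulr1 !addr0 !add0r => p0 q0 r0.
    by rewrite uE p0 q0 r0 !scale0r !addr0.
  - have [x1 xx] : dot uno x0 = 0 /\ dot x0 x0 = 1 by case: bt => -[? _ _] [[? _ _] _].
    have := cone_eigen bt; rewrite /cone_space /=.
    set a := y0 - _; set b := z0 + _; move=> [[a1 b1 xa xb ab] [ea eb fr]].
    clearbody a b; have aa := eigen_isotropic x1 xx (sqr_i K) ea ea.
    split; split=> //.
      have xU : x0 \in <<[:: x0; a; b]>>%VS by rewrite memv_span ?inE ?eqxx.
      by move=> h; have /eqP := h _ _ xU xU; rewrite xx oner_eq0.
    move=> _; exists a; first by apply: (free_not0 fr); rewrite !inE eqxx orbT.
    split=> [|v /memv_span3[p [q [r ->]]]].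
      by rewrite memv_span ?inE ?eqxx ?orbT.
    by rewrite !(dotDr, dotZr) (dotC a x0) xa aa ab; ring.
  - have nl : nul (null_space x0 y0 z0).
      move=> u v /memv_span3[p [q [r ->]]] /memv_span3[p' [q' [r' ->]]].
      by rewrite !nbZ !nbD nb_dot //; ring.
    split; split=> //; move=> _; exists (nb x0 y0 z0 0 0 0 0 0 1 0 0).
      apply/eqP => /(nb_eq0 bt)[_ [_ /eqP]]; by rewrite oner_eq0.
    have eU : nb x0 y0 z0 0 0 0 0 0 1 0 0 \in null_space x0 y0 z0.
      by rewrite memv_span ?inE ?eqxx.
    by split=> // v vU; apply: nl.
move=> bt bt' k3 k3' e.
have [h1 h2] := H k x y z bt k3; have [h1' h2'] := H k' x' y' z' bt' k3'.
move: h1 h2; rewrite e => h1 h2.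
have e2 : k = 2 <-> k' = 2 by rewrite -h1 -h1'.
have e0 : k <> 0%N <-> k' <> 0%N by rewrite -h2 -h2'.
by case: k k' k3 k3' e2 e0 {e h1 h2 h1' h2'} => [|[|[|//]]] [|[|[|//]]] _ _ //;
  intuition.
Qed.

Lemma ex_basic_triple : exists x y z : C, basic_triple x y z.
Proof.
have [x xx x1] : exists2 c : C, dot c c = 1 & forall i : 'I_1, dot uno c = 0.
  apply: (@ex_perp _ _ 1 (fun=> uno)) => // i j.
  by rewrite dot11 (ord1 i) (ord1 j) eqxx.
have x1' := x1 0; pose f (i : 'I_2) : C := if i == 0 then uno else x.
have [y yy yf] : exists2 c : C, dot c c = 1 & forall i : 'I_2, dot (f i) c = 0.
  apply: ex_perp => // i j; rewrite /f.
  case: i j => [[|[|//]] ?] [[|[|//]] ?] //=; by rewrite ?dot11 ?xx // dotC.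
have [z bt] := basic_triple_of_pair (And3 x1' (yf 0) (yf 1)) xx yy.
by exists x, y, z.
Qed.

Section Equivariance.
Variable g : 'End(C).
Hypothesis gP : alg_aut g.
Let gM x y : g (x ** y) = g x ** g y. Proof. by case: gP. Qed.

Lemma aut_nb x y z a0 a1 a2 a3 a4 a5 a6 a7 :
  g (nb x y z a0 a1 a2 a3 a4 a5 a6 a7) =
  nb (g x) (g y) (g z) a0 a1 a2 a3 a4 a5 a6 a7.
Proof. by rewrite /nb !linearD !linearZ /= !gM; case: gP => _ ->. Qed.

Lemma aut_model k x y z :
  (g @: model_space k x y z)%VS = model_space k (g x) (g y) (g z).
Proof.
case: k => [|[|k]] /=; rewrite limg_span /=.
- by rewrite gM.
- by rewrite /cone_space -!gM -!linearZ -linearB -linearD.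
- by rewrite !aut_nb.
Qed.

End Equivariance.
Lemma grass_orbitP (g : 'End(C)) (U W : grassmannian 3 (im C)) : alg_aut g ->
  val W = (g @: val U)%VS -> grass_orbit G W = grass_orbit G U.
Proof.
have [_ _ GM GV] := alg_aut_group C.
have step h (U1 U2 : grassmannian 3 (im C)) : alg_aut h ->
    val U2 = (h @: val U1)%VS -> grass_orbit G U2 `<=` grass_orbit G U1.
  move=> hP e V [f fP fV]; exists (f \o h)%VF; first exact: GM.
  by rewrite limg_comp -e.
move=> gP e; apply/seteqP; split; first exact: step e.
apply: (step _ _ _ (GV _ gP)); rewrite e -limg_comp lker0_compVf.
  by rewrite lim1g.
by case: gP.
Qed.

Lemma aut_acts : acts_on G (@subalg_variety _ C).
Proof.
move=> g U gP /subalg_model[k [x [y [z [_ bt e]]]]].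
have [W WX WE] := ex_model k (aut_basic gP bt).
by exists W => //; rewrite WE e aut_model.
Qed.

(** Automorphisms carry models to models, transitively for each type because
    they are transitive on basic triples, and preserve the type by
    [model_space_inj]. *)
Lemma card_orbits : (orbits G (@subalg_variety _ C) #= `I_3)%card.
Proof.
have [x [y [z bt]]] := ex_basic_triple.
have /choice[F FP] k : exists U : grassmannian 3 (im C),
    subalg_variety U /\ val U = model_space k x y z.
  by have [U UX UE] := ex_model k bt; exists U.
have -> : orbits G (@subalg_variety _ C) =
    (fun k => grass_orbit G (F k)) @` `I_3.
  apply/seteqP; split=> [_ [U UX <-]|_ [k _ <-]]; last first.
    by exists (F k) => //; case: (FP k).
  have [k [x' [y' [z' [k3 bt' UE]]]]] := subalg_model UX.
  exists k => //; have [g gP [gx gy gz]] := basic_triple_trans bt bt'.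
  apply/esym; apply: (grass_orbitP gP).
  by rewrite (FP k).2 aut_model // gx gy gz.
apply: inj_card_eq => k k'; rewrite !inE => k3 k3' e.
have : grass_orbit G (F k') (F k).
  rewrite -e; exists \1%VF; last by rewrite lim1g.
  by case: (alg_aut_group C).
case=> g gP; rewrite (FP k).2 (FP k').2 aut_model //.
exact: model_space_inj bt (aut_basic gP bt) k3 k3'.
Qed.

(** Each of the three models is put into the big cell by permuting the entries
    of its triple or changing their signs. *)
Lemma big_cell_cover (U : grassmannian 3 (im C)) : subalg_variety U ->
  exists x y z, basic_triple x y z /\ exists c4 c5 c6 c7 d4 d5 d6 d7,
    nb x y z 0 0 1 0 c4 c5 c6 c7 \in val U /\
    nb x y z 0 0 0 1 d4 d5 d6 d7 \in val U.
Proof.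
case/subalg_model=> -[|[|k]] [x [y [z [_ bt ->]]]] /=.
- exists x, y, z; split=> //; exists 0, 0, 1, 0, 0, 1, 0, 0.
  split; apply/memv_span3; first by exists 0, 2, 0; rewrite /nb; vec_ring.
  by exists 0, 0, 2; rewrite /nb; vec_ring.
- have [[x1 y1 z1] [[xx yy zz] [xy xz yz kz]]] := bt.
  have [k1 kx ky kk] := basic_pair_table x1 y1 xy xx yy.
  have yk : y ** (x ** y) = x.
    have := omulK_oconj y x; rewrite yy scale1r oconj_im // omulNr => yE.
    by rewrite (mul_anti k1 y1) (dotC _ y) ky mulr0 scale0r subr0 yE.
  exists y, (x ** y), z; split.
    split; first by split.
    by split; split=> //; rewrite yk.
  exists 0, 0, 0, 'i, 0, 1, 0, 0.
  split; apply/memv_span3; last by exists 2, 0, 0; rewrite /nb yk; vec_ring.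
  exists 0, 'i, (-1); rewrite /nb yk; apply: dot_inj => u.
  rewrite !(dotDl, dotNl, dotZl).
  apply: (lincomb1 (c := dot z u + dot (x ** y) u)) (sqr_i K) _; ring.
- exists x, y, (- z); split.
    case: bt => -[x1 y1 z1] [[xx yy zz] [xy xz yz kz]].
    by split; [|split]; split=> //; rewrite ?dotNl ?dotNr ?opprK // ?z1 ?xz ?yz ?kz oppr0.
  exists 0, 0, 0, 0, 0, 0, 0, 0.
  split; apply/memv_span3; rewrite /nb !omulNr.
    by exists 0, 1, 0; vec_ring.
  by exists 1, 0, 0; vec_ring.
Qed.

End Orbits.

(** * Algebras of functions *)

Section FunctionAlgebras.
Local Open Scope classical_set_scope.
Local Open Scope ring_scope.
Variables (T : Type) (K : fieldType).
Implicit Types (A : set (T -> K)) (f g : T -> K).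

(** What polynomial functions on the line, on affine space or on endomorphisms
    have in common with the regular functions on a line with points removed,
    so that each construction is shown once to depend algebraically on its
    arguments. *)
Definition fun_algebra A :=
  [/\ forall c, A (fun=> c), forall f g, A f -> A g -> A (fun t => f t + g t)
    & forall f g, A f -> A g -> A (fun t => f t * g t)].

Lemma fun_ext A f g : f =1 g -> A g -> A f.
Proof. by move=> /funext ->. Qed.

Variable A : set (T -> K).
Hypothesis AP : fun_algebra A.

Lemma fun_cst c : A (fun=> c). Proof. by case: AP. Qed.
Lemma fun_add f g : A f -> A g -> A (fun t => f t + g t).
Proof. by case: AP => _ + _; apply. Qed.
Lemma fun_mul f g : A f -> A g -> A (fun t => f t * g t).
Proof. by case: AP => _ _; apply. Qed.

Lemma fun_opp f : A f -> A (fun t => - f t).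
Proof.
move=> Af; apply: (fun_ext (fun t => esym (mulN1r (f t)))).
by apply: fun_mul => //; exact: fun_cst.
Qed.

Lemma fun_sub f g : A f -> A g -> A (fun t => f t - g t).
Proof. by move=> Af /fun_opp; exact: fun_add. Qed.

Lemma fun_sum I (r : seq I) (P : pred I) (F : I -> T -> K) :
  (forall i, P i -> A (F i)) -> A (fun t => \sum_(i <- r | P i) F i t).
Proof.
move=> AF; elim: r => [|i r IHr].
  by apply: (fun_ext (fun t => big_nil _ _ _ _)); exact: fun_cst.
apply: (fun_ext (fun t => big_cons _ _ _ _ _ _)).
case Pi: (P i) => //; apply: fun_add => //; exact: AF.
Qed.

Lemma fun_prod I (r : seq I) (P : pred I) (F : I -> T -> K) :
  (forall i, P i -> A (F i)) -> A (fun t => \prod_(i <- r | P i) F i t).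
Proof.
move=> AF; elim: r => [|i r IHr].
  by apply: (fun_ext (fun t => big_nil _ _ _ _)); exact: fun_cst.
apply: (fun_ext (fun t => big_cons _ _ _ _ _ _)).
case Pi: (P i) => //; apply: fun_mul => //; exact: AF.
Qed.

Lemma fun_det n (M : T -> 'M[K]_n) :
  (forall i j, A (fun t => M t i j)) -> A (fun t => \det (M t)).
Proof.
move=> AM; apply: fun_sum => s _; apply: fun_mul; first exact: fun_cst.
exact: fun_prod.
Qed.

(** Expressed by functionals, which avoids the choice of a basis. *)
Definition vec_fun (V : vectType K) (v : T -> V) :=
  forall phi : 'Hom(V, K^o), A (fun t => phi (v t)).

Lemma vec_fun_cst (V : vectType K) (v : V) : vec_fun (fun=> v).
Proof. by move=> phi; exact: fun_cst. Qed.

Lemma vec_fun_add (V : vectType K) (u v : T -> V) :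
  vec_fun u -> vec_fun v -> vec_fun (fun t => u t + v t).
Proof.
move=> Au Av phi; apply: (fun_ext (fun t => linearD phi _ _)).
by apply: fun_add; [exact: Au | exact: Av].
Qed.

Lemma vec_fun_scale (V : vectType K) f (v : T -> V) :
  A f -> vec_fun v -> vec_fun (fun t => f t *: v t).
Proof.
move=> Af Av phi; have phiE t : phi (f t *: v t) = f t * phi (v t) by rewrite linearZ.
apply: (fun_ext phiE).
by apply: fun_mul; [|exact: Av].
Qed.

Lemma vec_fun_opp (V : vectType K) (v : T -> V) : vec_fun v -> vec_fun (fun t => - v t).
Proof.
move=> Av phi; apply: (fun_ext (fun t => linearN phi _)).
by apply: fun_opp; exact: Av.
Qed.

Lemma vec_fun_coord (V : vectType K) (v : T -> V) n (X : n.-tuple V) i :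
  vec_fun v -> A (fun t => coord X i (v t)).
Proof.
move=> Av; apply: fun_ext (Av (linfun (coord X i : V -> K^o))).
by move=> t; rewrite lfunE.
Qed.

Lemma vec_fun_bilinear (V V1 V2 : vectType K) (b : V -> V1 -> V2) (u : T -> V) (v : T -> V1) :
  (forall a x y z, b (a *: x + y) z = a *: b x z + b y z) ->
  (forall a x y z, b z (a *: x + y) = a *: b z x + b z y) ->
  vec_fun u -> vec_fun v -> vec_fun (fun t => b (u t) (v t)).
Proof.
move=> bl br Au Av phi.
have [bl0 br0] : (forall z, b 0 z = 0) /\ (forall z, b z 0 = 0).
  split=> z.
    have := bl 1 0 0 z; rewrite !scale1r addr0 => /(congr1 (fun w => w - b 0 z)).
    by rewrite subrr addrK.
  have := br 1 0 0 z; rewrite !scale1r addr0 => /(congr1 (fun w => w - b z 0)).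
  by rewrite subrr addrK.
pose e := vbasis {:V}; pose e1 := vbasis {:V1}.
have bE x y : b x y =
    \sum_i \sum_j coord e i x * coord e1 j y *: b e`_i e1`_j.
  rewrite {1}(coord_vbasis (memvf x)) -/e.
  have suml (w : V1) (F : 'I_(\dim {:V}) -> K) :
    b (\sum_i F i *: e`_i) w = \sum_i F i *: b e`_i w.
    by apply: (big_rec2 (fun p q => b p w = q)) => // i p q _ <-; rewrite bl.
  rewrite suml; apply: eq_bigr => i _.
  rewrite {1}(coord_vbasis (memvf y)) -/e1.
  have sumr (F : 'I_(\dim {:V1}) -> K) :
    b e`_i (\sum_j F j *: e1`_j) = \sum_j F j *: b e`_i e1`_j.
    by apply: (big_rec2 (fun p q => b _ p = q)) => // j p q _ <-; rewrite br.
  by rewrite sumr scaler_sumr; apply: eq_bigr => j _; rewrite scalerA.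
have phiE t : phi (b (u t) (v t)) = \sum_i \sum_j
    coord e i (u t) * coord e1 j (v t) * phi (b e`_i e1`_j).
  rewrite bE linear_sum; apply: eq_bigr => i _; rewrite linear_sum.
  by apply: eq_bigr => j _; rewrite linearZ.
apply: (fun_ext phiE); apply: fun_sum => i _; apply: fun_sum => j _.
apply: fun_mul; last exact: fun_cst.
by apply: fun_mul; exact: vec_fun_coord.
Qed.

End FunctionAlgebras.

(** * Plücker coordinates *)

Section Plucker.
Local Open Scope ring_scope.
Variables (K : fieldType) (V : vectType K) (k : nat) (E : {vspace V}).
Local Notation n := (\dim E).
Local Notation N := #|plucker_index k E|.
Implicit Types (s t : seq V) (U : grassmannian k E).

Definition coord_mx s : 'M[K]_(k, n) :=
  \matrix_(i < k, j < n) coord (vbasis E) j s`_i.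

(** Plücker coordinates computed from any frame in place of the chosen basis
    of the space; the two differ by a common factor. *)
Definition minors s : 'I_N -> K :=
  fun a => \det (colsub (val (enum_val a)) (coord_mx s)).

Lemma plucker_minors U : plucker U = minors (vbasis (val U)).
Proof. by []. Qed.

(** A change of basis multiplies all minors by its determinant. *)
Lemma minors_change s t : size s = k -> size t = k -> free s -> free t ->
  <<s>>%VS = <<t>>%VS -> exists2 c, c != 0 & forall a, minors s a = c * minors t a.
Proof.
move=> /eqP ss /eqP st fs ft st_eq.
pose S := Tuple ss; pose T := Tuple st.
pose H : 'M[K]_k := \matrix_(i, j) coord T j S`_i.
pose G : 'M[K]_k := \matrix_(i, j) coord S j T`_i.
have ST (i : 'I_k) : S`_i = \sum_j H i j *: T`_j.
  rewrite [LHS](@coord_span _ _ _ T) /= ?st_eq; last first.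
    by rewrite -st_eq memv_span // mem_nth // (eqP ss).
  by apply: eq_bigr => j _; rewrite mxE.
have HG : H *m G = 1%:M.
  apply/matrixP => i l; rewrite !mxE.
  have := @coord_free _ _ _ S i l fs; rewrite ST linear_sum => <-.
  by apply: eq_bigr => j _; rewrite linearZ mxE /= [G j l]mxE.
have cE : coord_mx s = H *m coord_mx t.
  apply/matrixP => i l; rewrite !mxE -[s`_i]/S`_i ST linear_sum.
  by apply: eq_bigr => j _; rewrite linearZ !mxE.
exists (\det H).
  by apply/eqP => H0; have /eqP := det_mulmx H G; rewrite HG det1 H0 mul0r oner_eq0.
move=> a; rewrite /minors -det_mulmx; congr (\det _).
by rewrite cE; apply/matrixP => i j; rewrite !mxE; apply: eq_bigr => l _; rewrite !mxE.
Qed.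

Lemma plucker_basis U s : size s = k -> free s -> val U = <<s>>%VS ->
  exists2 c, c != 0 & forall a, plucker U a = c * minors s a.
Proof.
move=> ss fs UE; have /andP[_ /eqP dU] := valP U.
apply: minors_change => //; first by rewrite size_tuple.
  exact: basis_free (vbasisP _).
by rewrite -UE (span_basis (vbasisP _)).
Qed.

(** Repeated columns give zero, and sorting distinct ones turns the
    determinant into a minor up to sign. *)
Lemma minors_sort (f : {ffun 'I_k -> 'I_n}) :
  exists (g : 'I_N -> K), forall s,
    \det (colsub f (coord_mx s)) = \sum_a g a * minors s a.
Proof.
have [/injectiveP fI|/injectivePn[i [j ij fij]]] := boolP (injectiveb f); last first.
  exists (fun=> 0) => s; rewrite big1 => [|a _]; last by rewrite mul0r.
  rewrite -det_tr; apply: (determinant_alternate ij) => l.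
  by rewrite !mxE fij.
pose t := sort (fun u v : 'I_n => (u <= v)%N) (codom f).
have st : size t == k by rewrite size_sort size_codom card_ord.
have pt : perm_eq (Tuple st) [tuple f i | i < k] by rewrite perm_sort codomE.
have tU : uniq t by rewrite sort_uniq; apply/injectiveP.
have tS : sorted (fun u v : 'I_n => (u < v)%N) t.
  rewrite -(sorted_map (e' := ltn) (f := val)) ltn_sorted_uniq_leq.
  rewrite (map_inj_uniq val_inj) tU /= sorted_map; apply: sort_sorted => u v; exact: leq_total.
have [p pE] := tuple_permP pt.
pose r : {ffun 'I_k -> 'I_n} := [ffun i => f (p i)].
have rE i : r i = tnth (Tuple st) i.
  rewrite /r ffunE (_ : Tuple st = [tuple tnth [tuple f i | i < k] (p i) | i < k]).
    by rewrite !tnth_mktuple.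
  by apply: val_inj.
have rinc : increasing r.
  apply/forallP => i; apply/forallP => j; apply/implyP => ij; rewrite !rE.
  rewrite !(tnth_nth (r i)); apply: (sorted_ltn_nth _ _ tS) => //=.
  - by move=> u v w; apply: ltn_trans.
  - by rewrite inE (eqP st).
  - by rewrite inE (eqP st).
pose a := enum_rank (Sub r rinc : plucker_index k E).
exists (fun b => if b == a then (-1) ^+ p else 0) => s.
rewrite (bigD1 a) //= eqxx big1 ?addr0 => [|b /negPf ->]; last by rewrite mul0r.
rewrite /minors /a enum_rankK /=.
have -> : colsub r (coord_mx s) = col_perm p (colsub f (coord_mx s)).
  by apply/matrixP => i j; rewrite !mxE ffunE.
rewrite col_permE det_mulmx det_perm perm.odd_permV mulrCA -signr_addb addbb.
by rewrite mulr1.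
Qed.

(** The easy half of the Cauchy-Binet formula. *)
Lemma det_mul_minors (A : 'M[K]_(n, k)) : exists (g : 'I_N -> K), forall s,
  \det (coord_mx s *m A) = \sum_a g a * minors s a.
Proof.
have /choice[G GE] := minors_sort.
have detE (X : 'M[K]_k) :
    \det X = \sum_(p : perm.perm_of 'I_k) (-1) ^+ p * \prod_j X (p j) j.
  rewrite -det_tr; apply: eq_bigr => p _; congr (_ * _).
  by apply: eq_bigr => j _; rewrite mxE.
exists (fun a => \sum_(f : {ffun 'I_k -> 'I_n}) (\prod_j A (f j) j) * G f a) => s.
transitivity (\sum_(f : {ffun 'I_k -> 'I_n})
    (\prod_j A (f j) j) * \det (colsub f (coord_mx s))).
  rewrite detE; transitivity (\sum_(p : perm.perm_of 'I_k) (-1) ^+ p *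
      \sum_(f : {ffun 'I_k -> 'I_n}) \prod_j (coord_mx s (p j) (f j) * A (f j) j)).
    apply: eq_bigr => p _; congr (_ * _).
    rewrite -(bigA_distr_bigA (fun j l => coord_mx s (p j) l * A l j)) /=.
    by apply: eq_bigr => j _; rewrite !mxE.
  under eq_bigr do rewrite mulr_sumr; rewrite exchange_big /=.
  apply: eq_bigr => f _; rewrite detE mulr_sumr.
  apply: eq_bigr => p _; rewrite big_split /= [RHS]mulrCA; congr (_ * _).
  by rewrite mulrC; congr (_ * _); apply: eq_bigr => j _; rewrite !mxE.
under eq_bigr do rewrite GE mulr_sumr; rewrite exchange_big /=.
by apply: eq_bigr => a _; rewrite mulr_suml; apply: eq_bigr => f _; rewrite mulrA.
Qed.

(** Apply [det_mul_minors] to the matrix of the functionals in the chosen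
    basis of [E]. *)
Lemma det_functionals_minors (phi : 'I_k -> 'Hom(V, K^o)) :
  exists (g : 'I_N -> K), forall s, size s = k -> (forall v, v \in s -> v \in E) ->
    \det (\matrix_(i < k, j < k) (phi j s`_i : K)) = \sum_a g a * minors s a.
Proof.
have [g gE] := det_mul_minors (\matrix_(l < n, j < k) (phi j (vbasis E)`_l : K)).
exists g => s ss sE; rewrite -gE; congr (\det _); apply/matrixP => i j.
have siE : s`_i \in E by apply: sE; rewrite mem_nth // ss.
rewrite !mxE {1}(coord_vbasis siE) linear_sum; apply: eq_bigr => l _.
by rewrite linearZ !mxE.
Qed.

End Plucker.

Section Determinant3.
Local Open Scope ring_scope.

Lemma det_nat33 (R : comPzRingType) (F : nat -> nat -> R) :
  \det (\matrix_(i < 3, j < 3) F i j) =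
  F 0%N 0%N * (F 1%N 1%N * F 2%N 2%N - F 1%N 2%N * F 2%N 1%N)
   - F 0%N 1%N * (F 1%N 0%N * F 2%N 2%N - F 1%N 2%N * F 2%N 0%N)
   + F 0%N 2%N * (F 1%N 0%N * F 2%N 1%N - F 1%N 1%N * F 2%N 0%N).
Proof.
rewrite (expand_det_row _ ord0) !big_ord_recl big_ord0 /cofactor.
rewrite !(expand_det_row _ ord0) !big_ord_recl !big_ord0 /cofactor !det_mx11 !mxE.
by rewrite /= /bump /= !(exprS, expr0); ring.
Qed.

End Determinant3.

(** * Zariski topology: curves and irreducibility *)

Section PolynomialsAlongCurves.
Local Open Scope ring_scope.
Variables (K : fieldType) (n : nat).
Implicit Types (p q : {mpoly K[n]}) (y : 'I_n -> {poly K}).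

Lemma mpoly_ring_ind (P : {mpoly K[n]} -> Prop) : (forall c, P c%:MP) ->
    (forall i, P 'X_i) -> (forall p q, P p -> P q -> P (p + q)) ->
    (forall p q, P p -> P q -> P (p * q)) -> forall p, P p.
Proof.
move=> PC PX PD PM; elim/mpolyind => [|c m p _ _ Pp]; first exact: (PC 0).
apply: PD Pp; rewrite -mul_mpolyC; apply: (PM); first exact: PC.
rewrite mpolyXE_id; apply: big_ind => [||i _]; [exact: (PC 1)|exact: PM|].
by elim: (m i) => [|e IHe]; [exact: (PC 1) | rewrite exprS; apply: (PM)].
Qed.

Definition along y p : {poly K} := mmap (@polyC K) y p.

Lemma along_horner y p s : (along y p).[s] = p.@[fun i => (y i).[s]].
Proof.
elim/mpoly_ring_ind: p => [c|i|p q Pp Pq|p q Pp Pq]; rewrite /along.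
- by rewrite mmapC mevalC hornerC.
- by rewrite mmapX mmap1U mevalXU.
- by rewrite rmorphD hornerD mevalD -Pp -Pq.
- by rewrite rmorphM hornerM mevalM -Pp -Pq.
Qed.

Lemma along_deriv y p :
  (along y p)^`() = \sum_i along y p^`M(i) * (y i)^`().
Proof.
elim/mpoly_ring_ind: p => [c|i|p q Pp Pq|p q Pp Pq]; rewrite /along.
- rewrite mmapC derivC big1 // => i _; by rewrite mderivC rmorph0 mul0r.
- rewrite mmapX mmap1U (bigD1 i) //= big1 => [|j ji].
    rewrite mderivX mnm1E eqxx scale1r.
    have -> : (U_(i) - U_(i) = 0 :> 'X_{1..n})%MM.
      by apply/mnmP => j; rewrite mnmBE subnn mnm0E.
    by rewrite mpolyX0 rmorph1 mul1r addr0.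
  by rewrite mderivX mnm1E eq_sym (negPf ji) scale0r rmorph0 mul0r.
- rewrite rmorphD derivD -!/(along _ _) Pp Pq -big_split; apply: eq_bigr => i _.
  by rewrite mderivD /along rmorphD mulrDl.
- rewrite rmorphM derivM -!/(along _ _) Pp Pq mulr_suml mulr_sumr -big_split.
  apply: eq_bigr => i _; rewrite mderivM /along rmorphD !rmorphM /= mulrDl.
  by rewrite mulrAC mulrA.
Qed.

Lemma meval_homog d p (c : K) v : p \is d.-homog ->
  p.@[fun i => c * v i] = c ^+ d * p.@[v].
Proof.
move=> /dhomogP hp; rewrite !mevalE mulr_sumr; apply: eq_big_seq => m mp.
have dm : mdeg m = d := hp m mp.
rewrite mulrCA; congr (_ * _); rewrite -dm mdegE -prodrXr -big_split /=.
by apply: eq_bigr => i _; rewrite exprMn.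
Qed.

End PolynomialsAlongCurves.

Section ZariskiGrassmannian.
Local Open Scope classical_set_scope.
Local Open Scope ring_scope.
Variables (K : closedFieldType) (V : vectType K) (k : nat) (E : {vspace V}).
Local Notation N := #|plucker_index k E|.
Local Notation Gr := (grassmannian k E).
Implicit Types (U W : Gr) (X Y C : set Gr) (p : {mpoly K[N]}) (x : 'I_N -> K).

(** The complement of a closed set is a union of nonvanishing loci of forms. *)
Lemma closed_separate C U : closed C -> ~ C U ->
  exists2 p, homogeneous p & p.@[plucker U] != 0 /\ forall W, C W -> p.@[plucker W] = 0.
Proof.
move=> cC CU; have : open (~` C) by exact: closed_openC.
case=> S SF CE; have : (~` C) U by [].
rewrite CE => -[f Sf fU]; have [p hp fE] := SF _ Sf.
exists p => //; split=> [|W CW]; first by move: fU; rewrite fE.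
apply: contrapT => /eqP pW; have : (~` C) W by rewrite CE; exists f => //; rewrite fE.
exact.
Qed.

Lemma closed_zero p : homogeneous p -> closed [set U | p.@[plucker U] = 0].
Proof.
move=> hp; rewrite -[X in closed X]setCK; apply: open_closedC.
exists [set fun U => p.@[plucker U]]; first by move=> _ ->; exists p.
apply/seteqP; split=> U /=; first by move=> /eqP pU; exists (fun U => p.@[plucker U]).
by move=> [_ -> /eqP].
Qed.

(** [x] is a vector of homogeneous coordinates of [U]. *)
Definition represents U x := exists2 c, c != 0 & forall a, plucker U a = c * x a.

Lemma represents_zero U x p : homogeneous p -> represents U x ->
  (p.@[plucker U] == 0) = (p.@[x] == 0).
Proof.
move=> [d hp] [c c0 cx]; rewrite (meval_eq _ (cx : _ =1 (fun a => c * x a))).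
by rewrite (meval_homog _ _ hp) mulf_eq0 expf_eq0 (negPf c0) andbF.
Qed.

(** Joined by rational curves inside [X]. The vector [y] may vanish at some
    parameters, so only those with a nonzero coordinate are required to give a
    point. *)
Definition curve_connected X := forall U W, X U -> X W ->
  exists2 y : 'I_N -> {poly K},
    represents U (fun a => (y a).[0]) /\ represents W (fun a => (y a).[1]) &
    forall s a, (y a).[s] != 0 -> exists2 Z, X Z & represents Z (fun b => (y b).[s]).

Lemma represents_along U p (y : 'I_N -> {poly K}) s : homogeneous p ->
  represents U (fun a => (y a).[s]) -> ((along y p).[s] == 0) = (p.@[plucker U] == 0).
Proof. by move=> hp yU; rewrite along_horner (represents_zero hp yU). Qed.

Lemma poly_nonroot (q : {poly K}) : q != 0 -> exists s, q.[s] != 0.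
Proof. by move/closed_nonrootP. Qed.

Lemma horner_neq0 (q : {poly K}) s : q.[s] != 0 -> q != 0.
Proof. by apply: contra_neq => ->; rewrite horner0. Qed.

Hypothesis plucker_neq0 : forall U, exists a, plucker U a != 0.

(** Two forms that do not vanish on [X] are nonzero polynomials along a curve
    joining points where they do not vanish, and some parameter is a root of
    neither. *)
Lemma curve_connected_irreducible X : X !=set0 -> curve_connected X -> irreducible X.
Proof.
move=> X0 Xc; split=> // A B cA cB XAB.
apply: contrapT => /not_orP[/existsNP[U /not_implyP[XU AU]]].
move=> /existsNP[W /not_implyP[XW BW]].
have [p hp [pU pA]] := closed_separate cA AU.
have [q hq [qW qB]] := closed_separate cB BW.
have [y [yU yW] yX] := Xc U W XU XW.
have [a aU] := plucker_neq0 U.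
have p0 : along y p != 0.
  by apply: (@horner_neq0 _ 0); rewrite (represents_along hp yU).
have q0 : along y q != 0.
  by apply: (@horner_neq0 _ 1); rewrite (represents_along hq yW).
have y0 : y a != 0.
  apply: (@horner_neq0 _ 0); case: yU => c c0 ya; move: aU; rewrite ya.
  by rewrite mulf_eq0 negb_or => /andP[].
have [s] := poly_nonroot (mulf_neq0 (mulf_neq0 p0 q0) y0).
rewrite !hornerM !mulf_eq0 !negb_or => /andP[/andP[ps qs] ys].
have [Z XZ yZ] := yX s a ys.
move: ps qs; rewrite (represents_along hp yZ) (represents_along hq yZ).
by case: (XAB Z XZ) => [/pA ->|/qB ->]; rewrite eqxx.
Qed.

(** A form that vanishes on [Y] vanishes along the curve outside the zeros of
    [g], hence everywhere on the curve, its start included. *)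
Lemma curve_dense X Y :
  (forall U, X U -> exists2 y : 'I_N -> {poly K}, represents U (fun a => (y a).[0]) &
    exists2 g : {poly K}, g != 0 & forall s a, (y a).[s] != 0 -> g.[s] != 0 ->
      exists2 Z, Y Z & represents Z (fun b => (y b).[s])) ->
  X `<=` closure Y.
Proof.
move=> XY U XU; apply: contrapT => YU.
have [p hp [pU pY]] := closed_separate (@closed_closure _ Y) YU.
have [y yU [g g0 yY]] := XY U XU.
have [a aU] := plucker_neq0 U.
have p0 : along y p != 0.
  by apply: (@horner_neq0 _ 0); rewrite (represents_along hp yU).
have y0 : y a != 0.
  apply: (@horner_neq0 _ 0); case: yU => c c0 ya; move: aU; rewrite ya.
  by rewrite mulf_eq0 negb_or => /andP[].
have [s] := poly_nonroot (mulf_neq0 (mulf_neq0 p0 g0) y0).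
rewrite !hornerM !mulf_eq0 !negb_or => /andP[/andP[ps gs] ys].
have [Z YZ yZ] := yY s a ys gs.
move: ps; rewrite (represents_along hp yZ) pY ?eqxx //.
exact: subset_closure.
Qed.

Lemma irreducible_closure Y : irreducible Y -> irreducible (closure Y).
Proof.
move=> [[U YU] Yi]; split; first by exists U; exact: subset_closure.
move=> A B cA cB /(subset_trans (@subset_closure _ Y)) /(Yi A B cA cB).
by case=> [/closureS|/closureS]; [left|right]; apply: subset_trans; eassumption.
Qed.

End ZariskiGrassmannian.

(** * Dimension of affine space *)

Section PolynomialIndependence.
Local Open Scope classical_set_scope.
Local Open Scope ring_scope.
Variables (K : fieldType) (m : nat).
Implicit Types (S : set ('I_m -> K)) (p q f : {mpoly K[m]}).

Definition vanishes S p := forall t, S t -> p.@[t] = 0.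

Definition prime_locus S := S !=set0 /\
  forall p q, vanishes S (p * q) -> vanishes S p \/ vanishes S q.

Definition independent_on S (I : finType) (F : I -> {mpoly K[m]}) :=
  forall c : I -> K, vanishes S (\sum_i c i *: F i) -> forall i, c i = 0.

(** In a linear relation on [S], restricting to [S'] kills all positive powers
    of [f], so that the coefficients of the zeroth power vanish by
    independence on [S']; then [f] can be cancelled because [S] is a prime
    locus, and the argument is repeated. *)
Lemma independent_on_powers S S' (I : finType) (F : I -> {mpoly K[m]}) f B :
    S' `<=` S -> prime_locus S -> vanishes S' f -> ~ vanishes S f ->
    independent_on S' F ->
  independent_on S (fun x : 'I_B * I => F x.2 * f ^+ x.1).
Proof.
move=> S'S [S0 Sp] S'f Sf FI c.
pose G (j : nat) := \sum_i (if insub j is Some j' then c (j', i) else 0) *: F i.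
have GE (j : 'I_B) : G j = \sum_i c (j, i) *: F i.
  by apply: eq_bigr => i _; rewrite insubT // => jB; rewrite (_ : Sub _ _ = j) //; exact: val_inj.
have -> : \sum_x c x *: (F x.2 * f ^+ x.1) = \sum_(j < B) G j * f ^+ j.
  transitivity (\sum_(j < B) \sum_i c (j, i) *: (F i * f ^+ j)).
    by rewrite pair_bigA; apply: eq_bigr => -[j i].
  apply: eq_bigr => j _; rewrite GE mulr_suml.
  by apply: eq_bigr => i _; rewrite scalerAl.
move=> h; suff H n j : (j + n)%N = B -> vanishes S (\sum_(l < n) G (j + l)%N * f ^+ l) ->
    forall (l : 'I_B) i, (j <= l)%N -> c (l, i) = 0.
  by case=> j i; apply: (H B 0%N).
elim: n j => [|n IHn] j jB.
  move=> _ l i jl; have := leq_ltn_trans jl (ltn_ord l).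
  by rewrite -[X in (_ < X)%N]jB addn0 ltnn.
rewrite big_ord_recl expr0 mulr1 addn0 => hS.
have jltB : (j < B)%N by rewrite -jB addnS ltnS leq_addr.
have tailE : \sum_(i < n) G (j + lift ord0 i)%N * f ^+ lift ord0 i =
    f * \sum_(l < n) G (j.+1 + l)%N * f ^+ l.
  rewrite mulr_sumr; apply: eq_bigr => l _.
  by rewrite /= /bump /= add1n exprS mulrCA addnS addSn.
have c0 i : c (Ordinal jltB, i) = 0.
  move: i; apply: FI => t S't; rewrite -GE.
  have := hS t (S'S t S't); rewrite tailE mevalD mevalM S'f // mul0r addr0.
  exact.
have Gj : G j = 0.
  by rewrite -[j]/(val (Ordinal jltB)) GE big1 // => i _; rewrite c0 scale0r.
have hS' : vanishes S (\sum_(l < n) G (j.+1 + l)%N * f ^+ l).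
  have /Sp[/Sf//|//] : vanishes S (f * \sum_(l < n) G (j.+1 + l)%N * f ^+ l).
  by move=> t St; rewrite -tailE; have := hS t St; rewrite Gj add0r.
move=> l i; rewrite leq_eqVlt => /orP[/eqP jl|jl].
  by rewrite (_ : l = Ordinal jltB) //; apply: val_inj.
by apply: (IHn j.+1) => //; rewrite -jB addnS addSn.
Qed.

Lemma mnm_le_mdeg (x : 'X_{1..m}) i : (x i <= mdeg x)%N.
Proof. by rewrite mdegE (bigD1 i) //= leq_addr. Qed.

Lemma card_bmultinom D : (#|{: 'X_{1..m < D}}| <= D ^ m)%N.
Proof.
have xD (x : 'X_{1..m < D}) i : (bmnm x i < D)%N.
  exact: leq_ltn_trans (mnm_le_mdeg _ _) (bmdeg x).
pose h (x : 'X_{1..m < D}) : {ffun 'I_m -> 'I_D} := [ffun i => Ordinal (xD x i)].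
have hI : injective h.
  move=> x y /ffunP e; apply/val_inj/mnmP => i.
  by have := congr1 val (e i); rewrite !ffunE.
by have := leq_card h hI; rewrite card_ffun !card_ord.
Qed.

(** There are at most [D ^ m] monomials of degree less than [D], and more
    polynomials than monomials are dependent. *)
Lemma independent_on_bound S (I : finType) (F : I -> {mpoly K[m]}) D :
  (forall i, msize (F i) <= D)%N -> independent_on S F -> (#|I| <= D ^ m)%N.
Proof.
move=> FD FI; apply: leq_trans (card_bmultinom D); rewrite leqNgt; apply/negP => lt.
pose M : 'M[K]_(#|I|, #|{: 'X_{1..m < D}}|) :=
  \matrix_(i, j) (F (enum_val i))@_(bmnm (enum_val j)).
have /rowV0Pn[u uM u0] : kermx M != 0.
  by rewrite kermx_eq0 /row_free neq_ltn (leq_ltn_trans (rank_leq_col M)).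
have c0 : forall i, u 0 (enum_rank i) = 0.
  apply: (FI (fun i => u 0 (enum_rank i))) => t _.
  rewrite (_ : \sum_i _ = 0) ?meval0 //; apply/mpolyP => x; rewrite mcoeff0 raddf_sum /=.
  have [xD|Dx] := ltnP (mdeg x) D; last first.
    apply: big1 => i _; rewrite mcoeffZ memN_msupp_eq0 ?mulr0 //.
    by apply: msize_mdeg_ge; apply: leq_trans Dx.
  have /rowP/(_ (enum_rank (BMultinom xD))) : u *m M = 0 by apply/sub_kermxP.
  rewrite !mxE => e; rewrite -[RHS]e.
  rewrite (reindex (@enum_val I predT)) /=; last first.
    by apply: onW_bij; exact: enum_val_bij.
  by apply: eq_bigr => i _; rewrite mcoeffZ enum_valK !mxE enum_rankK.
by case/negP: u0; apply/eqP/rowP => i; rewrite mxE -(enum_valK i) c0.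
Qed.

Lemma leq_exp2r_weak a b e : (a <= b -> a ^ e <= b ^ e)%N.
Proof. by case: e => // e ab; rewrite leq_exp2r. Qed.

Lemma msize_exp_le f D j : (msize f <= D -> msize (f ^+ j) <= (j * D.+1).+1)%N.
Proof.
move=> fD; elim: j => [|j IHj]; first by rewrite expr0 msize1.
rewrite exprS; apply: leq_trans (msizeM_le _ _) _.
by move: fD IHj; rewrite mulSn; lia.
Qed.

(** Affine [m]-space has dimension at most [m]: a chain of length [n] produces
    [B ^ n] independent polynomials of degree [O(B)], for every [B]. *)
Lemma chain_length n (S : nat -> set ('I_m -> K)) :
    (forall i, (i <= n)%N -> prime_locus (S i)) ->
    (forall i, (i < n)%N -> S i `<=` S i.+1 /\
       exists2 f, vanishes (S i) f & ~ vanishes (S i.+1) f) -> (n <= m)%N.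
Proof.
move=> Sp Schain; rewrite leqNgt; apply/negP => mn.
have /choice[f fP] i : exists f, (i <= m)%N -> S i `<=` S i.+1 /\
    vanishes (S i) f /\ ~ vanishes (S i.+1) f.
  have [im|im] := leqP i m; last by exists 0.
  by have [s [f f1 f2]] := Schain i (leq_ltn_trans im mn); exists f.
pose D := (\max_(i < m.+1) msize (f i))%N.
have fD i : (i <= m)%N -> (msize (f i) <= D)%N.
  by move=> im; exact: (leq_bigmax (Ordinal (im : (i < m.+1)%N))).
(* Then [B ^ m.+1] exceeds the number of monomials of the degrees that occur
   below, which grows with [B] only like [B ^ m]. *)
pose B := ((m.+1 * D.+3).+1 ^ m).+1.
have build l : (l <= m.+1)%N -> exists (I : finType) (F : I -> {mpoly K[m]}),
    [/\ #|I| = (B ^ l)%N, forall i, (msize (F i) <= (l * (B * D.+3)).+1)%N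
      & independent_on (S l) F].
  elim: l => [|l IHl] lm.
    exists unit, (fun=> 1); split; [by rewrite card_unit|by move=> _; rewrite msize1|].
    move=> c h []; have [[t St] _] := Sp 0%N isT; have := h t St.
    by rewrite (bigD1 tt) //= big1 ?addr0 => [|[]//]; rewrite mevalZ meval1 mulr1.
  have [I [F [cI FD FI]]] := IHl (ltnW lm).
  have [sub [f1 f2]] := fP l lm.
  exists ('I_B * I)%type, (fun x : 'I_B * I => F x.2 * f l ^+ x.1); split.
  - by rewrite card_prod card_ord cI expnS.
  - case=> j i /=; apply: leq_trans (msizeM_le _ _) _; rewrite ltnS.
    apply: leq_trans (leq_add (FD i) (msize_exp_le j (fD l lm))) _.
    rewrite mulSn addSn addnS -!addnS addnC; apply: leq_add => //.
    apply: (@leq_trans (j.+1 * D.+3)); last by rewrite leq_mul2r ltn_ord orbT.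
    rewrite mulSn !mulnS; by lia.
  - apply: independent_on_powers f1 f2 FI => //; apply: Sp; exact: leq_trans lm mn.
have [I [F [cI FD FI]]] := build m.+1 (leqnn _).
have := independent_on_bound FD FI; rewrite cI leqNgt => /negP; apply.
apply: (@leq_ltn_trans ((B * (m.+1 * D.+3).+1) ^ m)).
  have key a b e : (0 < b -> (a * (b * e)).+1 <= b * (a * e).+1)%N.
    by move=> b0; rewrite mulnS mulnCA -add1n leq_add2r.
  by apply: leq_exp2r_weak; apply: key.
rewrite expnMn expnS mulnC ltn_mul2r expn_gt0 /=; exact: ltnSn.
Qed.

End PolynomialIndependence.

(** * Charts *)

Section Charts.
Local Open Scope classical_set_scope.
Local Open Scope ring_scope.
Variables (K : closedFieldType) (V : vectType K) (k : nat) (E : {vspace V}).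
Local Notation N := #|plucker_index k E|.
Local Notation Gr := (grassmannian k E).
Implicit Types (U W : Gr) (X Y C : set Gr) (p : {mpoly K[N]}).
Implicit Types (x w l : 'I_N -> K).

Lemma plucker_neq0 U : exists a, plucker U a != 0.
Proof.
have /andP[UE /eqP dU] := valP U.
have fU := basis_free (vbasisP (val U)).
have sU : size (vbasis (val U)) == k by rewrite size_tuple dU.
pose phi (j : 'I_k) := linfun (coord (Tuple sU) j : V -> K^o).
have [g gE] := det_functionals_minors E phi.
apply: contrapT => h; have := gE (vbasis (val U)).
rewrite big1 => [|a _]; last first.
  rewrite -plucker_minors; have [->|a0] := eqVneq (plucker U a) 0; first by rewrite mulr0.
  by case: h; exists a.
rewrite (_ : \matrix_(_, _) _ = 1%:M) ?det1 => [/(_ (eqP sU)) h1|].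
  have /eqP := h1 (fun v vU => subvP UE _ (vbasis_mem vU)).
  by rewrite oner_eq0.
apply/matrixP => i j; rewrite !mxE lfunE /=.
exact: (@coord_free _ _ _ (Tuple sU) i j fU).
Qed.

Definition linear_form l x : K := \sum_a l a * x a.

Definition linear_mpoly l : {mpoly K[N]} := \sum_a l a *: 'X_a.

Lemma linear_mpolyE l x : (linear_mpoly l).@[x] = linear_form l x.
Proof.
by rewrite [LHS]raddf_sum; apply: eq_bigr => a _ /=; rewrite mevalZ mevalXU.
Qed.

Lemma linear_mpoly_homog l : linear_mpoly l \is 1.-homog.
Proof.
rewrite rpred_sum // => a _; apply: rpredZ; rewrite dhomogX; apply/eqP.
exact: mdeg1.
Qed.

Lemma linear_formZ l c x y : (forall a, y a = c * x a) ->
  linear_form l y = c * linear_form l x.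
Proof.
by move=> yx; rewrite /linear_form mulr_sumr; apply: eq_bigr => a _; rewrite yx mulrCA.
Qed.

(** A parametrization by affine [m]-space, by polynomials, of the part of [X]
    where the linear form [l0] does not vanish; the parameters are recovered
    as quotients of the linear forms [l] by [l0]. *)
Record chart X m (l0 : 'I_N -> K) (l : 'I_m -> 'I_N -> K)
    (Q : 'I_N -> {mpoly K[m]}) : Prop := Chart {
  chart_point : forall t, exists2 U, X U & represents U (fun a => (Q a).@[t]);
  chart_cover : forall U, X U -> linear_form l0 (plucker U) != 0 ->
    exists t, represents U (fun a => (Q a).@[t]);
  chart_denom : forall t, linear_form l0 (fun a => (Q a).@[t]) = 1;
  chart_coord : forall t j, linear_form (l j) (fun a => (Q a).@[t]) = t j }.

Definition dirder p x w : K := \sum_a p^`M(a).@[x] * w a.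

Lemma dirderD p q x w : dirder (p + q) x w = dirder p x w + dirder q x w.
Proof.
by rewrite -big_split; apply: eq_bigr => a _ /=; rewrite mderivD mevalD mulrDl.
Qed.

Lemma dirderZ c p x w : dirder (c *: p) x w = c * dirder p x w.
Proof.
by rewrite [RHS]mulr_sumr; apply: eq_bigr => a _; rewrite mderivZ mevalZ mulrA.
Qed.

Lemma dirderM p q x w :
  dirder (p * q) x w = dirder p x w * q.@[x] + p.@[x] * dirder q x w.
Proof.
rewrite mulr_suml mulr_sumr -big_split; apply: eq_bigr => a _ /=.
rewrite mderivM mevalD !mevalM; ring.
Qed.

Lemma dirder1 x w : dirder 1 x w = 0.
Proof.
by apply: big1 => a _; rewrite -mpolyC1 mderivC meval0 mul0r.
Qed.

Lemma dirderX a x w : dirder 'X_a x w = w a.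
Proof.
rewrite /dirder (bigD1 a) //= big1 => [|b ba].
  rewrite mderivX mnm1E eqxx scale1r.
  have -> : (U_(a) - U_(a) = 0 :> 'X_{1..N})%MM.
    by apply/mnmP => j; rewrite mnmBE subnn mnm0E.
  by rewrite mpolyX0 meval1 mul1r addr0.
by rewrite mderivX mnm1E eq_sym (negPf ba) scale0r meval0 mul0r.
Qed.

Lemma dirder_sum I (r : seq I) (F : I -> {mpoly K[N]}) x w :
  dirder (\sum_(i <- r) F i) x w = \sum_(i <- r) dirder (F i) x w.
Proof.
apply: (big_morph (fun p => dirder p x w)); first by move=> p q; exact: dirderD.
by apply: big1 => a _; rewrite mderiv0 meval0 mul0r.
Qed.

Lemma dirder_linear_mpoly l x w : dirder (linear_mpoly l) x w = linear_form l w.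
Proof.
by rewrite dirder_sum; apply: eq_bigr => a _; rewrite dirderZ dirderX.
Qed.

Lemma dirder_exp0 p x w e : dirder p x w = 0 -> dirder (p ^+ e) x w = 0.
Proof.
move=> p0; elim: e => [|e IHe]; first exact: dirder1.
by rewrite exprS dirderM p0 IHe mul0r mulr0 addr0.
Qed.

(** Homogenization with respect to [l0], with one degree to spare so that the
    result vanishes with [l0]. The last clause holds because it is a polynomial
    in the forms [l0] and [l]. *)
Lemma homogenize m (l0 : 'I_N -> K) (l : 'I_m -> 'I_N -> K) (f : {mpoly K[m]}) D :
    (msize f <= D)%N ->
  exists F : {mpoly K[N]}, F \is D.-homog /\
  [/\ forall x c t, linear_form l0 x = c -> (forall j, linear_form (l j) x = c * t j) ->
        F.@[x] = c ^+ D * f.@[t],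
      forall x, linear_form l0 x = 0 -> F.@[x] = 0
    & forall x w, linear_form l0 w = 0 -> (forall j, linear_form (l j) w = 0) ->
        dirder F x w = 0].
Proof.
move=> fD; pose T (e : 'X_{1..m}) : {mpoly K[N]} :=
  linear_mpoly l0 ^+ (D - mdeg e) * \prod_j linear_mpoly (l j) ^+ e j.
have eD e : e \in msupp f -> (mdeg e < D)%N.
  by move=> /msize_mdeg_lt h; exact: leq_trans h fD.
exists (\sum_(e <- msupp f) f@_e *: T e); split; [|split].
- rewrite big_seq rpred_sum // => e /eD eltD; apply: rpredZ.
  rewrite -(subnK (ltnW eltD)); apply: dhomogM.
    by have := dhomogMn (D - mdeg e) (linear_mpoly_homog l0); rewrite mul1n.
  rewrite mdegE; elim/big_rec2: _ => [|j d P _ Ph]; first exact: dhomog1.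
  by apply: dhomogM => //; have := dhomogMn (e j) (linear_mpoly_homog (l j)); rewrite mul1n.
- move=> x c t x0 xl; rewrite [LHS]raddf_sum /= mevalE mulr_sumr.
  apply: eq_big_seq => e /eD eltD; rewrite mevalZ mevalM rmorphXn /= linear_mpolyE x0.
  rewrite [in RHS]mulrCA; congr (_ * _).
  rewrite rmorph_prod -[in RHS](subnK (ltnW eltD)) exprD -mulrA; congr (_ * _).
  rewrite mdegE -prodrXr -big_split; apply: eq_bigr => j _ /=.
  by rewrite rmorphXn /= linear_mpolyE xl exprMn.
- move=> x x0; rewrite [LHS]raddf_sum /=; apply: big1_seq => e /= /eD eltD.
  by rewrite mevalZ mevalM rmorphXn /= linear_mpolyE x0 expr0n subn_eq0 leqNgt eltD
     mul0r mulr0.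
- move=> x w w0 wl; rewrite dirder_sum big1 // => e _.
  rewrite dirderZ dirderM dirder_exp0 ?dirder_linear_mpoly // mul0r add0r.
  rewrite (_ : dirder (\prod__ _) _ _ = 0) ?mulr0 //.
  apply: (big_ind (fun q => dirder q x w = 0)) => [|p q p0 q0|j _].
  + exact: dirder1.
  + by rewrite dirderM p0 q0 mul0r mulr0 addr0.
  + by apply: dirder_exp0; rewrite dirder_linear_mpoly.
Qed.

Lemma poly_eq_horner (p q : {poly K}) : (forall s, p.[s] = q.[s]) -> p = q.
Proof.
move=> pq; apply/eqP; rewrite -subr_eq0; apply: contrapT => /negP/poly_nonroot[s].
by rewrite hornerD hornerN pq subrr eqxx.
Qed.

(** Differentiate the relations along the curve. *)
Lemma cone_tangent_curve X U (y : 'I_N -> {poly K}) :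
    (forall a, plucker U a = (y a).[0]) ->
    (forall p s, homogeneous p -> (forall W, X W -> p.@[plucker W] = 0) ->
       p.@[fun a => (y a).[s]] = 0) ->
  cone_tangent X U (\row_a (y a)^`().[0]).
Proof.
move=> yU yX p hp pX; have : along y p = 0.
  by apply: poly_eq_horner => s; rewrite along_horner horner0 yX.
move/(congr1 (fun q : {poly K} => q^`().[0])); rewrite along_deriv derivC horner0.
rewrite horner_sum => e; rewrite -[RHS]e; apply: eq_bigr => a _.
by rewrite mxE hornerM along_horner (meval_eq _ yU).
Qed.

Section Chart.
Variables (X : set Gr) (m : nat) (l0 : 'I_N -> K) (l : 'I_m -> 'I_N -> K).
Variable Q : 'I_N -> {mpoly K[m]}.
Hypothesis XQ : chart X l0 l Q.

Lemma chart_vanish p t : homogeneous p -> (forall W, X W -> p.@[plucker W] = 0) ->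
  p.@[fun a => (Q a).@[t]] = 0.
Proof.
move=> hp pX; have [U XU UQ] := chart_point XQ t.
by apply/eqP; rewrite -(represents_zero hp UQ) pX.
Qed.

(** The tangent vectors are the derivatives of the parametrization, because the
    forms [X_a l0^D - H_a] vanish on [X], where [H_a] is the homogenization of
    [Q a]. *)
Lemma chart_tangent U : X U -> linear_form l0 (plucker U) != 0 -> tangent_dim X U m.
Proof.
move=> XU U0; have [t [c c0 UQ]] := chart_cover XQ XU U0.
pose ln (f : 'I_N -> K) (w : 'rV[K]_N) := linear_form f (fun a => w 0 a).
have lnD f u v : ln f (u + v) = ln f u + ln f v.
  by rewrite /ln /linear_form -big_split; apply: eq_bigr => a _; rewrite mxE mulrDr.
have lnZ f b u : ln f (b *: u) = b * ln f u.
  by rewrite /ln /linear_form mulr_sumr; apply: eq_bigr => a _; rewrite mxE mulrCA.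
have ln_sum f I (r : seq I) (F : I -> 'rV[K]_N) :
    ln f (\sum_(i <- r) F i) = \sum_(i <- r) ln f (F i).
  apply: (big_morph (ln f)); first exact: lnD.
  by apply: big1 => a _; rewrite mxE mulr0.
have coneD u v : cone_tangent X U u -> cone_tangent X U v -> cone_tangent X U (u + v).
  move=> hu hv p hp pX; rewrite -[RHS](addr0 0).
  rewrite -[X in _ = X + _](hu p hp pX) -[X in _ = _ + X](hv p hp pX).
  by rewrite -big_split; apply: eq_bigr => a _; rewrite mxE mulrDr.
have coneZ b u : cone_tangent X U u -> cone_tangent X U (b *: u).
  move=> hu p hp pX; rewrite -[RHS](mulr0 b) -[X in _ = b * X](hu p hp pX) mulr_sumr.
  by apply: eq_bigr => a _; rewrite mxE mulrCA.
have cone0 : cone_tangent X U 0.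
  by move=> p _ _; apply: big1 => a _; rewrite mxE mulr0.
(* The cone over [X] contains the line through the point: one more dimension. *)
pose v0 : 'rV[K]_N := \row_a plucker U a.
have v0P : cone_tangent X U v0.
  pose y a : {poly K} := plucker U a *: (1 + 'X).
  have -> : v0 = \row_a (y a)^`().[0].
    by apply/rowP => a; rewrite !mxE derivZ derivD derivX derivC add0r hornerZ hornerC mulr1.
  apply: cone_tangent_curve => [a|p s [d hp] pX].
    by rewrite hornerZ hornerD hornerX hornerC addr0 mulr1.
  rewrite (@meval_eq _ _ _ (fun a => (1 + s) * plucker U a)) => [|a].
    by rewrite (meval_homog _ _ hp) pX // mulr0.
  by rewrite hornerZ hornerD hornerX hornerC mulrC.
(* Moving a single parameter gives a tangent vector; the forms [l] are dual to
   these vectors up to the factor [c], and [l0] is dual to [v0]. *)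
pose tj (j i : 'I_m) : {poly K} := (t i)%:P + (i == j)%:R *: 'X.
pose y j a : {poly K} := c *: along (tj j) (Q a).
have yE j a s : (y j a).[s] = c * (Q a).@[fun i => t i + (i == j)%:R * s].
  rewrite hornerZ along_horner; congr (_ * _); apply: meval_eq => i.
  by rewrite hornerD hornerC hornerZ hornerX.
pose v j : 'rV[K]_N := \row_a (y j a)^`().[0].
have vP j : cone_tangent X U (v j).
  apply: cone_tangent_curve => [a|p s hp pX].
    by rewrite yE UQ; congr (_ * _); apply: meval_eq => i; rewrite mulr0 addr0.
  rewrite (meval_eq _ (yE j ^~ s)); have [d hd] := hp.
  by rewrite (meval_homog _ _ hd) (chart_vanish _ hp pX) mulr0.
have lnv f j (q : {poly K}) :
    (forall s, c * linear_form f (fun a => (Q a).@[fun i => t i + (i == j)%:R * s]) = q.[s]) ->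
  ln f (v j) = q^`().[0].
  move=> h; have <- : \sum_a f a *: y j a = q.
    apply: poly_eq_horner => s; rewrite -h horner_sum /linear_form mulr_sumr.
    by apply: eq_bigr => a _; rewrite hornerZ yE mulrCA.
  rewrite raddf_sum horner_sum; apply: eq_bigr => a _ /=.
  by rewrite derivZ hornerZ mxE.
have l0v0 : ln l0 v0 = c.
  rewrite /ln (@linear_formZ _ c (fun a => (Q a).@[t])); last by move=> a; rewrite mxE.
  by rewrite (chart_denom XQ) mulr1.
have l0v j : ln l0 (v j) = 0.
  rewrite (lnv _ _ c%:P) ?derivC ?horner0 // => s.
  by rewrite (chart_denom XQ) mulr1 hornerC.
have lv i j : ln (l i) (v j) = c * (i == j)%:R.
  rewrite (lnv _ _ (c *: ((t i)%:P + (i == j)%:R *: 'X))) => [|s].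
    by rewrite derivZ derivD derivC derivZ derivX add0r !hornerZ hornerC mulr1.
  by rewrite (chart_coord XQ) hornerZ hornerD hornerC hornerZ hornerX.
(* The derivative of [X_a l0^D - H_a] in a direction killed by [l0] and [l] is
   [w_a] times a nonzero number. *)
have ker (w : 'rV[K]_N) : cone_tangent X U w -> ln l0 w = 0 -> (forall j, ln (l j) w = 0) -> w = 0.
  move=> wT w0 wl; apply/rowP => a; rewrite mxE.
  pose D := (msize (Q a)).+1.
  have [F [Fh [FQ F0 Fd]]] := @homogenize m l0 l (Q a) D.+1 (leqW (leqnSn _)).
  pose G := 'X_a * linear_mpoly l0 ^+ D - F.
  have hG : homogeneous G.
    exists D.+1; apply: rpredB => //; rewrite -add1n; apply: dhomogM.
      by rewrite dhomogX; apply/eqP; exact: mdeg1.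
    by have := dhomogMn D (linear_mpoly_homog l0); rewrite mul1n.
  have GX W : X W -> G.@[plucker W] = 0.
    move=> XW; rewrite mevalB mevalM mevalXU rmorphXn /= linear_mpolyE.
    have [W0|W0] := eqVneq (linear_form l0 (plucker W)) 0.
      by rewrite F0 // W0 expr0n mulr0 subrr.
    have [t' [c' c'0 WQ]] := chart_cover XQ XW W0.
    rewrite (FQ _ c' t') => [||j'].
    - rewrite (linear_formZ _ WQ) (chart_denom XQ) mulr1 WQ exprS.
      by rewrite mulrAC -mulrA subrr.
    - by rewrite (linear_formZ _ WQ) (chart_denom XQ) mulr1.
    - by rewrite (linear_formZ _ WQ) (chart_coord XQ).
  have : dirder G (plucker U) (fun b => w 0 b) = 0 := wT G hG GX.
  rewrite dirderD -scaleN1r dirderZ Fd // mulr0 addr0 dirderM dirderX.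
  rewrite dirder_exp0 ?dirder_linear_mpoly // mulr0 addr0 rmorphXn /= linear_mpolyE.
  by move/eqP; rewrite mulf_eq0 expf_eq0 (negPf U0) andbF orbF => /eqP.
pose vs (i : 'I_m.+1) := oapp v v0 (unlift ord0 i).
pose T := [tuple vs i | i < m.+1].
have TE (i : 'I_m.+1) : T`_i = vs i by rewrite -tnth_nth tnth_mktuple.
have vs0 : vs ord0 = v0 by rewrite /vs unlift_none.
have vsS j : vs (lift ord0 j) = v j by rewrite /vs liftK.
have lift_sum f (b : 'I_m.+1 -> K) : ln f (\sum_i b i *: T`_i) =
    b ord0 * ln f v0 + \sum_j b (lift ord0 j) * ln f (v j).
  rewrite ln_sum big_ord_recl lnZ TE vs0; congr (_ + _).
  by apply: eq_bigr => j _; rewrite lnZ TE vsS.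
have Tfree : free T.
  apply/freeP => b b0.
  have ln0 f : ln f 0 = 0 by rewrite -(scale0r 0) lnZ mul0r.
  have bo : b ord0 = 0.
    have := lift_sum l0 b; rewrite b0 ln0 l0v0 big1 => [|j _].
      by rewrite addr0 => /esym/eqP; rewrite mulf_eq0 (negPf c0) orbF => /eqP.
    by rewrite l0v mulr0.
  move=> i; have [j ->|->] := unliftP ord0 i; last exact: bo.
  have := lift_sum (l j) b; rewrite b0 ln0 bo mul0r add0r (bigD1 j) //= big1.
    rewrite lv eqxx mulr1 addr0 => /esym/eqP.
    by rewrite mulf_eq0 (negPf c0) orbF => /eqP.
  by move=> j' j'j; rewrite lv eq_sym (negPf j'j) !mulr0.
exists <<T>>%VS; last by rewrite (eqnP Tfree) size_tuple.
apply/seteqP; split=> [u /= uT|w wT] /=.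
  have -> : u = \sum_(i < m.+1) coord T i u *: T`_i by exact: coord_span.
  apply: (big_ind (cone_tangent X U)) => // i _; apply: (coneZ); rewrite TE.
  by have [j ->|->] := unliftP ord0 i; rewrite ?vsS ?vs0.
pose b0 := ln l0 w / c; pose b j := (ln (l j) w - b0 * ln (l j) v0) / c.
have uT : b0 *: v0 + \sum_j b j *: v j \in <<T>>%VS.
  have vsT i : vs i \in <<T>>%VS by rewrite -TE memv_span // mem_nth // size_tuple.
  by rewrite rpredD ?rpred_sum // => [|j _]; rewrite memvZ // -?vs0 -?vsS.
have lnu f : ln f (b0 *: v0 + \sum_j b j *: v j) =
    b0 * ln f v0 + \sum_j b j * ln f (v j).
  by rewrite lnD lnZ ln_sum; congr (_ + _); apply: eq_bigr => j _; rewrite lnZ.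
rewrite (_ : w = b0 *: v0 + \sum_j b j *: v j) //; apply/subr0_eq; apply: ker.
- apply: (coneD) => //; rewrite -scaleN1r; apply: (coneZ); apply: (coneD); first exact: (coneZ).
  by apply: (big_ind (cone_tangent X U)) => // j _; exact: (coneZ).
- rewrite lnD -scaleN1r lnZ lnu l0v0 big1 => [|j _]; last by rewrite l0v mulr0.
  by rewrite addr0 divfK // mulN1r subrr.
- move=> j; rewrite lnD -scaleN1r lnZ lnu (bigD1 j) //= big1 => [|i ij].
    by rewrite lv eqxx mulr1 addr0 divfK // [b0 * _ + _]addrC subrK mulN1r subrr.
  by rewrite lv eq_sym (negPf ij) !mulr0.
Qed.

End Chart.

(** Chains of irreducible closed subsets of [X] restrict to chains of prime
    loci in a chart around a point of the smallest member. *)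
Lemma charts_krull_le X m n Z :
    (forall U, X U -> exists l0 (l : 'I_m -> _) Q,
       chart X l0 l Q /\ linear_form l0 (plucker U) != 0) ->
  irreducible_chain X n Z -> (n <= m)%N.
Proof.
move=> Xcov [Zi Zs].
have [[C0 _ Z0E] [[U ZU] _]] := Zi 0%N isT.
have XU : X U by move: ZU; rewrite Z0E => -[].
have [l0 [l [Q [XQ U0]]]] := Xcov U XU.
have ZX i W : (i <= n)%N -> Z i W -> X W.
  by move=> /Zi[[C _ ->] _] [].
have ZUi i : (i <= n)%N -> Z i U.
  by elim: i => // i IHi lt; apply: (Zs i lt).1; apply: IHi; exact: ltnW.
pose S i : set ('I_m -> K) := [set t | exists2 W, Z i W & represents W (fun a => (Q a).@[t])].
have form f : exists F : {mpoly K[N]}, homogeneous F /\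
    [/\ forall W t, represents W (fun a => (Q a).@[t]) ->
          (F.@[plucker W] == 0) = (f.@[t] == 0)
      & forall W, linear_form l0 (plucker W) = 0 -> F.@[plucker W] = 0].
  have [F [Fh [FQ F0 _]]] := @homogenize m l0 l f _ (leqnn _).
  exists F; split; [by exists (msize f)|split=> [W t WQ|W /F0 //]].
  rewrite (represents_zero _ WQ); last by exists (msize f).
  rewrite (FQ _ 1 t) ?expr1n ?mul1r ?(chart_denom XQ) // => j.
  by rewrite (chart_coord XQ) mul1r.
have Zprime i A B : (i <= n)%N -> homogeneous A -> homogeneous B ->
    (forall W, Z i W -> A.@[plucker W] = 0 \/ B.@[plucker W] = 0) ->
    (forall W, Z i W -> A.@[plucker W] = 0) \/ (forall W, Z i W -> B.@[plucker W] = 0).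
  move=> /Zi[_ [_ Zirr]] hA hB AB.
  by have [] := Zirr _ _ (closed_zero hA) (closed_zero hB) AB; [left|right].
apply: (@chain_length K m n S) => i.
- move=> ile; split.
    have [t UQ] := chart_cover XQ XU U0; exists t; exists U => //; exact: ZUi.
  move=> p q pq; have [P [hP [PQ P0]]] := form p; have [R [hR [RQ R0]]] := form q.
  case: (Zprime i P R ile hP hR) => [W ZW|h|h].
  + have [W0|W0] := eqVneq (linear_form l0 (plucker W)) 0; first by left; exact: P0.
    have [t WQ] := chart_cover XQ (ZX i W ile ZW) W0.
    have /eqP : (p * q).@[t] = 0 by apply: pq; exists W.
    rewrite mevalM mulf_eq0 -(PQ W t WQ) -(RQ W t WQ).
    by case/orP => /eqP; [left|right].
  + by left=> t [W ZW WQ]; apply/eqP; rewrite -(PQ W t WQ) h.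
  + by right=> t [W ZW WQ]; apply/eqP; rewrite -(RQ W t WQ) h.
- move=> ilt; have [ZZ ZnZ] := Zs i ilt.
  split; first by move=> t [W ZW WQ]; exists W => //; exact: ZZ.
  have [W ZW WN] : exists2 W, Z i.+1 W & ~ Z i W.
    by apply: contrapT => h; apply: ZnZ => W ZW; apply: contrapT => WN; apply: h; exists W.
  have [[C cC ZE] _] := Zi i (ltnW ilt).
  have CW : ~ C W by move=> CW; apply: WN; rewrite ZE; split=> //; exact: ZX ilt ZW.
  have [p hp [pW pC]] := closed_separate cC CW.
  exists (p \mPo [tuple Q a | a < N]) => [t [W' ZW' WQ]|h].
    rewrite comp_mpoly_meval (meval_eq _ (fun a => congr1 (meval t) (tnth_mktuple _ _))).
    apply/eqP; rewrite -(represents_zero hp WQ); apply/eqP/pC.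
    by move: ZW'; rewrite ZE => -[].
  have hl0 : homogeneous (linear_mpoly l0) by exists 1%N; exact: linear_mpoly_homog.
  case: (Zprime i.+1 p (linear_mpoly l0) ilt hp hl0) => [W' ZW'|h1|h1].
  + rewrite linear_mpolyE.
    have [W0|W0] := eqVneq (linear_form l0 (plucker W')) 0; first by right.
    have [t WQ] := chart_cover XQ (ZX i.+1 W' ilt ZW') W0; left.
    apply/eqP; rewrite (represents_zero hp WQ); apply/eqP.
    have := h t; rewrite comp_mpoly_meval.
    rewrite (meval_eq _ (fun a => congr1 (meval t) (tnth_mktuple _ _))); apply.
    by exists W'.
  + by move: pW; rewrite h1 // eqxx.
  + by move: U0; rewrite -linear_mpolyE h1 ?eqxx //; exact: ZUi.
Qed.

(** The chain consists of the closures of the coordinate subspaces of the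
    chart, which the forms [l] tell apart. *)
Lemma chart_krull_ge X m l0 (l : 'I_m -> _) Q : closed X -> chart X l0 l Q ->
  exists Z, irreducible_chain X m Z.
Proof.
move=> cX XQ; pose Y i : set Gr := [set W | X W /\ exists2 t : 'I_m -> K,
  (forall j : 'I_m, (i <= j)%N -> t j = 0) & represents W (fun a => (Q a).@[t])].
have YX i : Y i `<=` X by move=> W [].
have clX i : closure (Y i) `<=` X.
  by move/closure_id: cX => ->; apply: closureS.
have YZ i (t : 'I_m -> K) : (forall j : 'I_m, (i <= j)%N -> t j = 0) ->
    exists2 W, Y i W & represents W (fun a => (Q a).@[t]).
  move=> t0; have [W XW WQ] := chart_point XQ t; exists W => //.
  by split=> //; exists t.
exists (fun i => closure (Y i)); split=> i ile.
  split.
    exists (closure (Y i)); first exact: closed_closure.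
    by apply/seteqP; split=> W; [move=> h; split=> //; exact: (clX i W h) | case].
  apply: irreducible_closure; apply: (curve_connected_irreducible plucker_neq0).
    by have [W YW _] := YZ i (fun=> 0) (fun j _ => erefl); exists W.
  move=> U W [XU [t t0 UQ]] [XW [t' t'0 WQ]].
  pose h j : {poly K} := (t j)%:P + (t' j - t j) *: 'X.
  have hE a s : (along h (Q a)).[s] = (Q a).@[fun j => t j + (t' j - t j) * s].
    by rewrite along_horner; apply: meval_eq => j; rewrite hornerD hornerC hornerZ hornerX.
  exists (fun a => along h (Q a)); [split|].
  - case: UQ => c c0 cQ; exists c => // a; rewrite cQ hE; congr (_ * _).
    by apply: meval_eq => j; rewrite mulr0 addr0.
  - case: WQ => c c0 cQ; exists c => // a; rewrite cQ hE; congr (_ * _).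
    by apply: meval_eq => j; rewrite mulr1 addrC subrK.
  - move=> s _ _; have [|Z YZs ZQ] := YZ i (fun j => t j + (t' j - t j) * s).
      by move=> j ij; rewrite t0 // t'0 // subrr mul0r addr0.
    exists Z => //; case: ZQ => c c0 cQ; exists c => // a; by rewrite cQ hE.
split.
  by apply: closureS => W [XW [t t0 WQ]]; split=> //; exists t => // j /ltnW; exact: t0.
pose lm := linear_mpoly (l (Ordinal ile)).
have hl : homogeneous lm by exists 1%N; exact: linear_mpoly_homog.
have [|W YW WQ] := YZ i.+1 (fun j => (j == Ordinal ile)%:R).
  by move=> j ij; case: eqP => // je; move: ij; rewrite je ltnn.
move=> /(_ W (subset_closure YW)) Wi.
have : closure (Y i) `<=` [set U | lm.@[plucker U] = 0].
  move/closure_id: (closed_zero hl) => ->; apply: closureS => U [XU [t t0 UQ]] /=.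
  apply/eqP; rewrite (represents_zero hl UQ) linear_mpolyE (chart_coord XQ).
  by rewrite t0.
move=> /(_ W Wi) /= /eqP; rewrite (represents_zero hl WQ) linear_mpolyE (chart_coord XQ).
by rewrite eqxx oner_eq0.
Qed.

End Charts.

(** * The Cayley Grassmannian as a projective variety *)

Section CayleyGrassmannian.
Local Open Scope classical_set_scope.
Local Open Scope ring_scope.
Variables (K : numClosedFieldType) (C : compAlg K).
Local Notation "x ** y" := (omul x y) (at level 40, left associativity).
Local Notation uno := (@oone K C).
Local Notation N := #|plucker_index 3 (im C)|.
Local Notation Gr := (grassmannian 3 (im C)).
Local Notation minors3 := (@minors K C 3 (im C)).
Local Notation X := (@subalg_variety K C).
Implicit Types (u v w : C) (U : Gr) (s : seq C).

Lemma polynomial_functions : fun_algebra [set f : K -> K | exists p : {poly K}, f = horner p].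
Proof.
split=> [c|_ _ [p ->] [q ->]|_ _ [p ->] [q ->]].
- by exists c%:P; apply: funext => s; rewrite hornerC.
- by exists (p + q); apply: funext => s; rewrite hornerD.
- by exists (p * q); apply: funext => s; rewrite hornerM.
Qed.

Lemma mpolynomial_functions m :
  fun_algebra [set f : ('I_m -> K) -> K | exists p : {mpoly K[m]}, f = fun t => p.@[t]].
Proof.
split=> [c|_ _ [p ->] [q ->]|_ _ [p ->] [q ->]].
- by exists c%:MP; apply: funext => s; rewrite mevalC.
- by exists (p + q); apply: funext => s; rewrite mevalD.
- by exists (p * q); apply: funext => s; rewrite mevalM.
Qed.

Lemma cross_linl a u v w : cross (a *: u + v) w = a *: cross u w + cross v w.
Proof. by rewrite crossDl crossZl. Qed.

Lemma cross_linr a u v w : cross w (a *: u + v) = a *: cross w u + cross w v.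
Proof. by rewrite crossDr crossZr. Qed.

Lemma minors_fun (T : Type) (A : set (T -> K)) (f g h : T -> C) a : fun_algebra A ->
  vec_fun A f -> vec_fun A g -> vec_fun A h ->
  A (fun t => minors3 [:: f t; g t; h t] a).
Proof.
move=> AP Af Ag Ah; apply: fun_det => // i j.
apply: (@fun_ext _ _ _ _ (fun t => coord (vbasis (im C)) (val (enum_val a) j)
   ([:: f t; g t; h t]`_i))) => [t|]; first by rewrite !mxE.
by case: i => [[|[|[|//]]] ?] /=; exact: vec_fun_coord.
Qed.

Lemma minors_free s a : size s = 3%N -> minors3 s a != 0 -> free s.
Proof.
case: s => [|s0 [|s1 [|s2 []]]] // _ m0.
apply: free3P => p q r h.
pose k : 'rV[K]_3 := \row_i [:: p; q; r]`_i.
have kM : k *m colsub (val (enum_val a)) (@coord_mx K C 3 (im C) [:: s0; s1; s2]) = 0.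
  apply/rowP => j; rewrite !mxE !big_ord_recl big_ord0 !mxE /= addr0 addrA.
  by rewrite -!linearZ -!linearD h linear0.
have M1 : colsub (val (enum_val a)) (@coord_mx K C 3 (im C) [:: s0; s1; s2]) \in unitmx.
  by rewrite unitmxE unitfE.
have k0 : k = 0 by rewrite -(mulmxK M1 k) kM mul0mx.
have kE (i : 'I_3) : [:: p; q; r]`_i = 0 by have := congr1 (fun z : 'rV[K]_3 => z 0 i) k0; rewrite !mxE.
by split; [exact: (kE (@Ordinal 3 0 isT))|exact: (kE (@Ordinal 3 1 isT))
  |exact: (kE (@Ordinal 3 2 isT))].
Qed.

Lemma represents_span U s : size s = 3%N -> free s -> val U = <<s>>%VS ->
  represents U (minors3 s).
Proof. exact: plucker_basis. Qed.

(** Points of [X] are joined by lines in the space of pairs of generators. *)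
Lemma subalg_line U W : X U -> X W -> exists (f g : K -> C) (y : 'I_N -> {poly K}),
  [/\ vec_fun [set h : K -> K | exists p : {poly K}, h = horner p] f,
      vec_fun [set h : K -> K | exists p : {poly K}, h = horner p] g,
      forall (s : K) a, (y a).[s] = minors3 [:: f s; g s; cross (f s) (g s)] a,
      represents U (fun a => (y a).[0]) /\ represents W (fun a => (y a).[1])
    & [/\ val W = <<[:: f 1; g 1; cross (f 1) (g 1)]>>%VS,
        forall s : K, dot uno (f s) = 0, forall s : K, dot uno (g s) = 0 &
        forall (s : K) a, (y a).[s] != 0 ->
        exists Z, [/\ X Z, represents Z (fun b => (y b).[s])
          & val Z = <<[:: f s; g s; cross (f s) (g s)]>>%VS]]].
Proof.
move=> /subalg_two_gen[u [v [u1 v1 fr UE]]] /subalg_two_gen[u' [v' [u'1 v'1 fr' WE]]].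
pose A := [set h : K -> K | exists p : {poly K}, h = horner p].
have AP : fun_algebra A := polynomial_functions.
have AX : A (fun s : K => s) by exists 'X; apply: funext => s; rewrite hornerX.
pose f (s : K) := u + s *: (u' - u); pose g (s : K) := v + s *: (v' - v).
have Af : vec_fun A f.
  by apply: vec_fun_add => //; [|apply: vec_fun_scale => //]; exact: vec_fun_cst.
have Ag : vec_fun A g.
  by apply: vec_fun_add => //; [|apply: vec_fun_scale => //]; exact: vec_fun_cst.
have Aw : vec_fun A (fun s : K => cross (f s) (g s)).
  by apply: (vec_fun_bilinear AP _ _ Af Ag) => *; rewrite ?cross_linl ?cross_linr.
have /choice[y yE] a : exists p : {poly K},
    (fun s : K => minors3 [:: f s; g s; cross (f s) (g s)] a) = horner p.
  exact: (minors_fun a AP Af Ag Aw).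
have yE' (s : K) a : (y a).[s] = minors3 [:: f s; g s; cross (f s) (g s)] a.
  by have := congr1 (fun h => h s) (yE a).
have f0 : f 0 = u by rewrite /f scale0r addr0.
have g0 : g 0 = v by rewrite /g scale0r addr0.
have f1 : f 1 = u' by rewrite /f scale1r addrC subrK.
have g1 : g 1 = v' by rewrite /g scale1r addrC subrK.
have fi (s : K) : dot uno (f s) = 0 by rewrite !(dotDr, dotZr, dotNr) u1 u'1; ring.
have gi (s : K) : dot uno (g s) = 0 by rewrite !(dotDr, dotZr, dotNr) v1 v'1; ring.
exists f, g, y; split=> //; split=> //.
- have [c c0 cU] := @represents_span _ [:: u; v; _] erefl fr UE.
  by exists c => // a; rewrite yE' f0 g0 cU.
- have [c c0 cU] := @represents_span _ [:: u'; v'; _] erefl fr' WE.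
  by exists c => // a; rewrite yE' f1 g1 cU.
- by rewrite f1 g1.
- move=> s a; rewrite yE' => ya.
  have frs := @minors_free [:: _; _; _] _ erefl ya.
  have [Z XZ ZE] := ex_two_gen (fi s) (gi s) frs.
  exists Z; split=> //.
  have [c c0 cZ] := @represents_span _ [:: f s; g s; _] erefl frs ZE.
  by exists c => // b; rewrite yE' cZ.
Qed.

Lemma subalg_curve_connected : curve_connected X.
Proof.
move=> U W XU XW; have [f [g [y [_ _ _ yUW [_ _ _ yX]]]]] := subalg_line XU XW.
exists y => // s a /yX[Z [XZ yZ _]]; by exists Z.
Qed.

Lemma subalg_nonempty : X !=set0.
Proof.
have [x [y [z bt]]] := ex_basic_triple C.
by have [U XU _] := ex_model 0 bt; exists U.
Qed.

Lemma subalg_irreducible : irreducible X.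
Proof.
apply: curve_connected_irreducible; first exact: plucker_neq0.
  exact: subalg_nonempty.
exact: subalg_curve_connected.
Qed.

Section Determinants.
Implicit Types (al be ga la : 'Hom(C, K^o)).

Definition det3 al be ga s : K :=
  (al s`_0 : K) * ((be s`_1 : K) * (ga s`_2 : K) - (ga s`_1 : K) * (be s`_2 : K))
  - (be s`_0 : K) * ((al s`_1 : K) * (ga s`_2 : K) - (ga s`_1 : K) * (al s`_2 : K))
  + (ga s`_0 : K) * ((al s`_1 : K) * (be s`_2 : K) - (be s`_1 : K) * (al s`_2 : K)).

Lemma det3_minors al be ga : exists g : 'I_N -> K,
  forall s, size s = 3%N -> (forall v, v \in s -> v \in im C) ->
    det3 al be ga s = linear_form g (minors3 s).
Proof.
pose F (j : nat) := match j with 0%N => al | 1%N => be | _ => ga end.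
have [g gE] := det_functionals_minors (im C) (fun j : 'I_3 => F j).
exists g => s ss sI; rewrite /linear_form -gE //.
by rewrite (det_nat33 (fun i j => F j s`_i : K)) /det3 /=; ring.
Qed.

(** The contraction of the trivector of [s] with two functionals: a vector of
    the span of [s] whose coordinates are linear in the Plücker coordinates. *)
Definition contract be ga s : C :=
  ((be s`_1 : K) * (ga s`_2 : K) - (ga s`_1 : K) * (be s`_2 : K)) *: s`_0
  - ((be s`_0 : K) * (ga s`_2 : K) - (ga s`_0 : K) * (be s`_2 : K)) *: s`_1
  + ((be s`_0 : K) * (ga s`_1 : K) - (ga s`_0 : K) * (be s`_1 : K)) *: s`_2.

Lemma contractE la be ga s : la (contract be ga s) = det3 la be ga s :> K.
Proof.
have laZ (c : K) v : la (c *: v) = c * (la v : K) :> K by rewrite linearZ.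
have laD v w : la (v + w) = (la v : K) + (la w : K) :> K by rewrite linearD.
have laN v : la (- v) = - (la v : K) :> K by rewrite linearN.
rewrite /contract !laD laN !laZ /det3 /=.
move: (la s`_0) (la s`_1) (la s`_2) (be s`_0) (be s`_1) (be s`_2) (ga s`_0) (ga s`_1) (ga s`_2).
by rewrite /GRing.regular => *; ring.
Qed.

Lemma mem_contract be ga s (U : {vspace C}) :
  (forall i, (i < 3)%N -> s`_i \in U) -> contract be ga s \in U.
Proof. by move=> sU; rewrite rpredD ?rpredB // memvZ ?sU. Qed.

(** Equations in Plücker coordinates are written as functions of a frame that
    happen to be forms in its minors. *)
Definition form_of d (P : seq C -> K) := exists2 F : {mpoly K[N]}, F \is d.-homog &
  forall s, size s = 3%N -> (forall v, v \in s -> v \in im C) ->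
    P s = F.@[minors3 s].

Lemma form_det3 al be ga : form_of 1 (det3 al be ga).
Proof.
have [g gE] := det3_minors al be ga.
exists (linear_mpoly g); first exact: linear_mpoly_homog.
by move=> s ss sI; rewrite linear_mpolyE gE.
Qed.

Lemma form_add d (P R : seq C -> K) : form_of d P -> form_of d R ->
  form_of d (fun s => P s + R s).
Proof.
move=> [F hF PF] [G hG RG]; exists (F + G); first exact: rpredD.
by move=> s ss sI; rewrite mevalD PF // RG.
Qed.

Lemma form_scale d c (P : seq C -> K) : form_of d P -> form_of d (fun s => c * P s).
Proof.
move=> [F hF PF]; exists (c *: F); first exact: rpredZ.
by move=> s ss sI; rewrite mevalZ PF.
Qed.

Lemma form_mul d e (P R : seq C -> K) : form_of d P -> form_of e R ->
  form_of (d + e) (fun s => P s * R s).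
Proof.
move=> [F hF PF] [G hG RG]; exists (F * G); first exact: dhomogM.
by move=> s ss sI; rewrite mevalM PF // RG.
Qed.

Lemma form_ext d (P R : seq C -> K) : P =1 R -> form_of d R -> form_of d P.
Proof. by move=> /funext ->. Qed.

Lemma form_sum d (I : finType) (P : I -> seq C -> K) : (forall i, form_of d (P i)) ->
  form_of d (fun s => \sum_i P i s).
Proof.
move=> hP; elim: (index_enum I) => [|i r IHr].
  apply: (form_ext (fun s => big_nil _ _ _ _)).
  by exists 0; [exact: rpred0 | move=> s _ _; rewrite meval0].
by apply: (form_ext (fun s => big_cons _ _ _ _ _ _)) => /=; exact: form_add.
Qed.

(** By bilinearity, a combination of products of a coordinate of [f s] with a
    coordinate of [g s]. *)
Lemma form_cross la (f g : seq C -> C) d e :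
  (forall la, form_of d (fun s => la (f s) : K)) ->
  (forall la, form_of e (fun s => la (g s) : K)) ->
  form_of (d + e) (fun s => la (cross (f s) (g s)) : K).
Proof.
move=> hf hg.
have laZ (c : K) v : la (c *: v) = c * (la v : K) :> K by rewrite linearZ.
pose b := vbasis {:C}.
pose co i : 'Hom(C, K^o) := linfun (coord b i : C -> K^o).
have coE v : v = \sum_i (co i v : K) *: b`_i.
  rewrite {1}(coord_vbasis (memvf v)); apply: eq_bigr => i _; by rewrite lfunE.
have cross_suml (F : 'I_(\dim {:C}) -> K) w :
    cross (\sum_i F i *: b`_i) w = \sum_i F i *: cross b`_i w.
  have c0 : cross 0 w = 0 by have := crossZl 0 0 w; rewrite !scale0r.
  by apply: (big_rec2 (fun p q => cross p w = q)) => // i p q _ <-; rewrite cross_linl.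
have cross_sumr (F : 'I_(\dim {:C}) -> K) w :
    cross w (\sum_i F i *: b`_i) = \sum_i F i *: cross w b`_i.
  have c0 : cross w 0 = 0 by have := crossZr 0 w 0; rewrite !scale0r.
  by apply: (big_rec2 (fun p q => cross w p = q)) => // i p q _ <-; rewrite cross_linr.
refine (@form_ext _ _ (fun s => \sum_(i < \dim {:C}) \sum_(j < \dim {:C})
    (la (cross b`_i b`_j) : K) * ((co i (f s) : K) * (co j (g s) : K))) _ _).
  move=> s; rewrite {1}(coE (f s)) cross_suml linear_sum; apply: eq_bigr => i _.
  rewrite {1}(coE (g s)) cross_sumr scaler_sumr linear_sum; apply: eq_bigr => j _.
  rewrite scalerA; exact: etrans (laZ _ _) (mulrC _ _).
apply: form_sum => i; apply: form_sum => j; apply: form_scale.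
exact: form_mul.
Qed.

(** Near a three-space [U] that is not closed, with [u], [v] in [U] and
    [cross u v] outside, the vectors [u], [v] extend to sections [f], [g] of the
    tautological bundle, and by Cramer's rule the cubic form below vanishes when
    [cross (f s) (g s)] lies in the span of [s]. *)
Lemma subalg_closed : closed X.
Proof.
suff sep U : ~ X U -> exists2 p, homogeneous p & p.@[plucker U] != 0 /\
    forall W, X W -> p.@[plucker W] = 0.
  have -> : X = \bigcap_(p in [set p | homogeneous p /\
      forall W, X W -> p.@[plucker W] = 0]) [set U | p.@[plucker U] = 0].
    apply/seteqP; split=> [U XU p [hp pX]|U UX]; first exact: pX.
    apply: contrapT => /sep[p hp [pU pX]]; move: pU.
    by rewrite (UX p (conj hp pX)) eqxx.
  by apply: closed_bigI => p [hp _]; exact: closed_zero.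
move=> XU; have /andP[Uim /eqP dU] := valP U.
have sU : size (vbasis (val U)) == 3 by rewrite size_tuple dU.
pose S := Tuple sU; have fU := basis_free (vbasisP (val U)).
have SI v : v \in vbasis (val U) -> v \in im C.
  by move=> /vbasis_mem; exact: (subvP Uim).
pose phi i : 'Hom(C, K^o) := linfun (coord S i : C -> K^o).
pose a0 := @Ordinal 3 0 isT; pose a1 := @Ordinal 3 1 isT; pose a2 := @Ordinal 3 2 isT.
have phiS (i j : 'I_3) : phi i S`_j = (j == i)%:R by rewrite lfunE /= coord_free.
have [u uU [v vU uvN]] : exists2 u, u \in val U & exists2 v, v \in val U & cross u v \notin val U.
  apply: contrapT => h; apply: XU; apply/subalg_varietyP => u v uU vU.
  by apply: contrapT => /negP uvN; apply: h; exists u => //; exists v.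
(* [sec w] has values in the span of [s], is linear in the minors, and takes the
   value [w] at the basis [S] of [U]. *)
pose sec (w : C) (s : seq C) := (phi a0 w : K) *: contract (phi a1) (phi a2) s
  - (phi a1 w : K) *: contract (phi a0) (phi a2) s
  + (phi a2 w : K) *: contract (phi a0) (phi a1) s.
have secS w : w \in val U -> sec w S = w.
  move=> wU; have {2}-> : w = \sum_(i < 3) coord S i w *: S`_i.
    by apply: coord_span; rewrite /= (span_basis (vbasisP _)).
  rewrite !big_ord_recl big_ord0 addr0 /sec /contract.
  have e j : S`_j = S`_j by [].
  have p0 := phiS a0; have p1 := phiS a1; have p2 := phiS a2.
  rewrite -[0%N]/(val a0) -[1%N]/(val a1) -[2%N]/(val a2) !p0 !p1 !p2 /=.
  rewrite !lfunE /=.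
  have -> : lift ord0 ord0 = a1 :> 'I_3 by exact: val_inj.
  have -> : lift ord0 (lift ord0 ord0) = a2 :> 'I_3 by exact: val_inj.
  have -> : ord0 = a0 :> 'I_3 by exact: val_inj.
  by vec_ring.
have [psi psiU psi1] : exists2 psi : 'Hom(C, K^o), forall w, w \in val U -> psi w = 0 &
    psi (cross u v) != 0.
  have fr : free (cross u v :: S) by rewrite free_cons (span_basis (vbasisP _)) uvN.
  pose S' := [tuple of cross u v :: S].
  exists (linfun (coord S' ord0 : C -> K^o)); last first.
    have := @coord_free _ _ _ S' ord0 ord0 fr; rewrite lfunE /= => ->.
    by rewrite oner_neq0.
  move=> w; rewrite -(span_basis (vbasisP (val U))) => /(@coord_span _ _ _ S) ->.
  rewrite lfunE /= linear_sum big1 // => i _; rewrite linearZ /=.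
  have := @coord_free _ _ _ S' (lift ord0 i) ord0 fr; rewrite /= => ->.
  by rewrite /= mulr0.
pose w s := cross (sec u s) (sec v s).
(* By Cramer's rule, [P s] is [psi] of [w s] minus its component in the span of
   [s], times a determinant. *)
pose P s := (psi (w s) : K) * det3 (phi a0) (phi a1) (phi a2) s
  - (phi a0 (w s) : K) * det3 psi (phi a1) (phi a2) s
  - (phi a1 (w s) : K) * det3 (phi a0) psi (phi a2) s
  - (phi a2 (w s) : K) * det3 (phi a0) (phi a1) psi s.
have Psec c la : form_of 1 (fun s => la (sec c s) : K).
  apply: (@form_ext _ _ (fun s => (phi a0 c : K) * det3 la (phi a1) (phi a2) s
     + - (phi a1 c : K) * det3 la (phi a0) (phi a2) s
     + (phi a2 c : K) * det3 la (phi a0) (phi a1) s)).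
    move=> s; rewrite /sec linearD linearB !linearZ /= -!contractE.
    by rewrite mulNr -mulrN.
  by repeat first [exact: form_det3 | apply: form_scale | apply: form_add].
have Pw la : form_of 2 (fun s => la (w s) : K) := form_cross la (Psec u) (Psec v).
have [F hF PF] : form_of 3 P.
  apply: (@form_ext _ _ (fun s => (psi (w s) : K) * det3 (phi a0) (phi a1) (phi a2) s
    + -1 * ((phi a0 (w s) : K) * det3 psi (phi a1) (phi a2) s)
    + -1 * ((phi a1 (w s) : K) * det3 (phi a0) psi (phi a2) s)
    + -1 * ((phi a2 (w s) : K) * det3 (phi a0) (phi a1) psi s))).
    by move=> s; rewrite /P !mulN1r.
  by repeat first [exact: Pw | exact: form_det3 | apply: form_scale
    | apply: (@form_mul 2 1) | apply: form_add].
exists F; first by exists 3.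
split.
  rewrite plucker_minors -PF //; last exact: (eqP sU).
  rewrite /P /w !(secS u) // !(secS v) //.
  have d0 (al be : 'Hom(C, K^o)) : [/\ det3 psi al be S = 0, det3 al psi be S = 0 & det3 al be psi S = 0].
    have pS i : (i < 3)%N -> psi S`_i = 0.
      by move=> i3; apply: psiU; apply: vbasis_mem; rewrite mem_nth // (eqP sU).
    by rewrite /det3 !pS //; split; ring.
  have [-> _ _] := d0 (phi a1) (phi a2); have [_ -> _] := d0 (phi a0) (phi a2).
  have [_ _ ->] := d0 (phi a0) (phi a1).
  rewrite /det3 -[0%N]/(val a0) -[1%N]/(val a1) -[2%N]/(val a2).
  rewrite !(phiS a0) !(phiS a1) !(phiS a2) /=.
  by rewrite !(mulr0, mulr1, subr0, mul0r, addr0, sub0r, oppr0, mul1r).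
move=> W /subalg_varietyP cW; have /andP[Wim /eqP dW] := valP W.
have sW : size (vbasis (val W)) = 3 by rewrite size_tuple dW.
rewrite plucker_minors -PF //; last by move=> z /vbasis_mem; exact: (subvP Wim).
have nW i : (i < 3)%N -> (vbasis (val W))`_i \in val W.
  by move=> i3; apply: vbasis_mem; rewrite mem_nth // sW.
have secW c : sec c (vbasis (val W)) \in val W.
  by rewrite /sec !rpredD // ?rpredN memvZ // mem_contract.
have wW : w (vbasis (val W)) \in <<vbasis (val W)>>%VS.
  by rewrite (span_basis (vbasisP _)); apply: cW.
rewrite /P; move: wW; generalize (w (vbasis (val W))) => w0.
move: (vbasis _ : seq C) sW => s.
case: s => [|s0 [|s1 [|s2 []]]] // _ /memv_span3[p [q [r ->]]].
rewrite /det3 /=.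
have E (la : 'Hom(C, K^o)) : (la (p *: s0 + q *: s1 + r *: s2) : K) =
  p * (la s0 : K) + q * (la s1 : K) + r * (la s2 : K) by rewrite !linearD !linearZ.
rewrite !E; move: (psi s0) (psi s1) (psi s2) (phi a0 s0) (phi a0 s1) (phi a0 s2)
 (phi a1 s0) (phi a1 s1) (phi a1 s2) (phi a2 s0) (phi a2 s1) (phi a2 s2).
by rewrite /GRing.regular => *; ring.
Qed.

End Determinants.
End CayleyGrassmannian.

(** * Charts of the Cayley Grassmannian *)

Section CayleyCharts.
Local Open Scope classical_set_scope.
Local Open Scope ring_scope.
Variables (K : numClosedFieldType) (C : compAlg K).
Local Notation "x ** y" := (omul x y) (at level 40, left associativity).
Local Notation uno := (@oone K C).
Local Notation N := #|plucker_index 3 (im C)|.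
Local Notation Gr := (grassmannian 3 (im C)).
Local Notation minors3 := (@minors K C 3 (im C)).
Local Notation X := (@subalg_variety K C).
Implicit Types (u v w : C) (U : Gr) (s : seq C).

Let two : 2 != 0 :> K := two_neq0 K.

Lemma dot_lfun (w : C) : exists phi : 'Hom(C, K^o), forall v, phi v = dot v w :> K.
Proof.
by apply: (@lfun_of_linear _ _ K^o (fun v => dot v w)) => a u v; rewrite dotDl dotZl.
Qed.

Definition dot_form w : 'Hom(C, K^o) := projT1 (cid (dot_lfun w)).

Lemma dot_formE w v : dot_form w v = dot v w :> K.
Proof. by rewrite /dot_form; case: cid. Qed.

Section NullCoordinates.
Variables x y z : C.

(** The basis dual to that of [nb]; the isotropic vectors of degrees [d] and
    [-d] pair to [2]. *)
Definition nb_dual i : C := let h : K := 2^-1 in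
  nth 0 [:: nb x y z 1 0 0 0 0 0 0 0; nb x y z 0 0 0 0 0 0 0 h;
  nb x y z 0 0 0 0 0 0 h 0; nb x y z 0 0 0 0 0 h 0 0; nb x y z 0 0 0 0 1 0 0 0;
  nb x y z 0 0 0 h 0 0 0 0; nb x y z 0 0 h 0 0 0 0 0; nb x y z 0 h 0 0 0 0 0 0] i.

Definition nb_coord i : 'Hom(C, K^o) := dot_form (nb_dual i).

Lemma nb_coordE a0 a1 a2 a3 a4 a5 a6 a7 i : basic_triple x y z -> (i < 8)%N ->
  nb_coord i (nb x y z a0 a1 a2 a3 a4 a5 a6 a7) = [:: a0; a1; a2; a3; a4; a5; a6; a7]`_i :> K.
Proof.
move=> bt; rewrite dot_formE /nb_dual; set h : K := 2^-1.
have h2 : 2 * h = 1 by rewrite /h divff.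
clearbody h; case: i => [|[|[|[|[|[|[|[|//]]]]]]]] _ /=; rewrite nb_dot //.
- by ring.
- by apply: (lincomb1 (c := a1)) h2 _; ring.
- by apply: (lincomb1 (c := a2)) h2 _; ring.
- by apply: (lincomb1 (c := a3)) h2 _; ring.
- by ring.
- by apply: (lincomb1 (c := a5)) h2 _; ring.
- by apply: (lincomb1 (c := a6)) h2 _; ring.
- by apply: (lincomb1 (c := a7)) h2 _; ring.
Qed.

End NullCoordinates.

(** In the big cell, a subalgebra is generated by its two normalized vectors
    [r2] and [r3], with eight arbitrary parameters, which are minors of a
    frame. *)
Lemma subalg_chart x y z : basic_triple x y z ->
  exists l0 (l : 'I_8 -> 'I_N -> K) Q, chart X l0 l Q /\
    forall U, X U -> (exists c4 c5 c6 c7 d4 d5 d6 d7,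
      nb x y z 0 0 1 0 c4 c5 c6 c7 \in val U /\
      nb x y z 0 0 0 1 d4 d5 d6 d7 \in val U) -> linear_form l0 (plucker U) != 0.
Proof.
move=> bt; pose phi := nb_coord x y z.
have phiE a0 a1 a2 a3 a4 a5 a6 a7 i : (i < 8)%N ->
    phi i (nb x y z a0 a1 a2 a3 a4 a5 a6 a7) = [:: a0; a1; a2; a3; a4; a5; a6; a7]`_i :> K.
  exact: nb_coordE.
pose o k (k8 : (k < 8)%N) : 'I_8 := Ordinal k8.
pose r2 (t : 'I_8 -> K) := nb x y z 0 0 1 0 (t (@o 0%N isT)) (t (@o 1%N isT)) (t (@o 2%N isT)) (t (@o 3%N isT)).
pose r3 (t : 'I_8 -> K) := nb x y z 0 0 0 1 (t (@o 4%N isT)) (t (@o 5%N isT)) (t (@o 6%N isT)) (t (@o 7%N isT)).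
pose s t := [:: r2 t; r3 t; cross (r2 t) (r3 t)].
have r2I t : dot uno (r2 t) = 0 by apply: imP; rewrite nb_im.
have r3I t : dot uno (r3 t) = 0 by apply: imP; rewrite nb_im.
have crE t : exists b4 b5 b6 b7, cross (r2 t) (r3 t) =
    nb x y z 0 2 ('i * t (@o 4%N isT)) (- 'i * t (@o 0%N isT)) b4 b5 b6 b7.
  have [a0 [a1 [a2 [a3 [a4 [a5 [a6 [a7 e]]]]]]]] := nb_surj bt (cross (r2 t) (r3 t)).
  have e0 : a0 = 0 by apply/eqP; rewrite -(nb_im bt a0 a1 a2 a3 a4 a5 a6 a7) -e cross_im.
  exists a4, a5, a6, a7; rewrite e; move: e; rewrite crossE ?r2I // -(nb1 x y z) nbZ nb_mul // nbD.
  case/(nb_inj bt) => -[_ <- <- <-] _; rewrite e0.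
  by congr nb; ring.
pose A := [set f : ('I_8 -> K) -> K | exists p : {mpoly K[8]}, f = fun t => p.@[t]].
have AP : fun_algebra A := @mpolynomial_functions K 8.
have AX j : A (fun t => t j) by exists 'X_j; apply: funext => t; rewrite mevalXU.
have Anb i f0 f1 f2 f3 : vec_fun A (fun t : 'I_8 -> K => nb x y z 0 0 i (1 - i) (t f0) (t f1) (t f2) (t f3)).
  have e (t : 'I_8 -> K) : nb x y z 0 0 i (1 - i) (t f0) (t f1) (t f2) (t f3) =
      nb x y z 0 0 i (1 - i) 0 0 0 0 + (t f0 *: nb x y z 0 0 0 0 1 0 0 0 +
      (t f1 *: nb x y z 0 0 0 0 0 1 0 0 + (t f2 *: nb x y z 0 0 0 0 0 0 1 0 +
       t f3 *: nb x y z 0 0 0 0 0 0 0 1))).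
    by rewrite !nbZ !nbD !(mulr0, mulr1, addr0, add0r).
  rewrite (funext e).
  have sc j (v : C) : vec_fun A (fun t : 'I_8 -> K => t j *: v).
    by apply: (vec_fun_scale AP) => //; exact: (vec_fun_cst AP).
  do 4! [apply: (vec_fun_add AP); first by [exact: (vec_fun_cst AP) | exact: sc]].
  exact: sc.
have Ar2 : vec_fun A r2 by have := Anb 1 (@o 0%N isT) (@o 1%N isT) (@o 2%N isT) (@o 3%N isT); rewrite subrr.
have Ar3 : vec_fun A r3 by have := Anb 0 (@o 4%N isT) (@o 5%N isT) (@o 6%N isT) (@o 7%N isT); rewrite subr0.
have Acr : vec_fun A (fun t => cross (r2 t) (r3 t)).
  by apply: (vec_fun_bilinear AP _ _ Ar2 Ar3) => *; rewrite ?cross_linl ?cross_linr.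
have /choice[Q QE] a : exists p : {mpoly K[8]}, (fun t => minors3 (s t) a) = fun t => p.@[t].
  exact: (minors_fun a AP Ar2 Ar3 Acr).
have QE' t a : (Q a).@[t] = minors3 (s t) a by have := congr1 (fun f => f t) (QE a).
have QEl l t : linear_form l (fun a => (Q a).@[t]) = linear_form l (minors3 (s t)).
  by apply: eq_bigr => a _; rewrite QE'.
have sI t v : v \in s t -> v \in im C.
  by rewrite !inE => /or3P[] /eqP ->; rewrite ?mem_im ?r2I ?r3I // -mem_im cross_im.
(* Replacing a coordinate by another one in the determinant of [r2], [r3] and
   their cross product picks out a parameter. The cross product starts with the
   coordinate [2], whence the factor [2^-1] below. *)
have [g0 g0E] := det3_minors (phi 1%N) (phi 2%N) (phi 3%N).
have /choice[g gE] (j : 'I_8) := det3_minors (phi 1%N)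
  (phi (if (j < 4)%N then 4 + j else 2)%N) (phi (if (j < 4)%N then 3 else j)%N).
pose l0 a : K := 2^-1 * g0 a; pose l (j : 'I_8) a : K := 2^-1 * g j a.
have lZ (f v : 'I_N -> K) : linear_form (fun a => 2^-1 * f a) v = 2^-1 * linear_form f v :> K.
  by rewrite /linear_form mulr_sumr; apply: eq_bigr => a _; rewrite mulrA.
have det1 t : linear_form l0 (minors3 (s t)) = 1.
  rewrite lZ -g0E //; last exact: sI.
  have [b4 [b5 [b6 [b7 e]]]] := crE t.
  apply: (mulfI two); rewrite mulrA divff // mul1r /det3 /s /= e !phiE //=; ring.
have detl t j : linear_form (l j) (minors3 (s t)) = t j.
  have [b4 [b5 [b6 [b7 e]]]] := crE t.
  apply: (mulfI two); rewrite lZ mulrA divff // mul1r.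
  have := gE j (s t) erefl (@sI t); case: ifP => j4 <-; rewrite /det3 /s /= e.
    have -> : t j = [:: t (@o 0%N isT); t (@o 1%N isT); t (@o 2%N isT); t (@o 3%N isT)]`_j.
      by case: j j4 => -[|[|[|[|//]]]] ? _ /=; congr t; apply: val_inj.
    by case: j j4 => -[|[|[|[|//]]]] ? _; rewrite !phiE //=; ring.
  have -> : t j = [:: t (@o 4%N isT); t (@o 5%N isT); t (@o 6%N isT); t (@o 7%N isT)]`_(j - 4).
    by case: j j4 => -[|[|[|[|[|[|[|[|//]]]]]]]] ? //= _; congr t; apply: val_inj.
  by case: j j4 => -[|[|[|[|[|[|[|[|//]]]]]]]] ? //= _; rewrite !phiE //=; ring.
have frs t : free (s t).
  have [a ma] : exists a, minors3 (s t) a != 0.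
    apply: contrapT => h; have /eqP := det1 t; rewrite /linear_form big1 => [|a _].
      by rewrite eq_sym oner_eq0.
    have [->|a0] := eqVneq (minors3 (s t) a) 0; first by rewrite mulr0.
    by case: h; exists a.
  exact: minors_free ma.
have rep U t : val U = <<s t>>%VS -> represents U (fun a => (Q a).@[t]).
  move=> /(@represents_span _ _ U (s t) erefl (frs t)) [c c0 cU].
  by exists c => // a; rewrite QE' cU.
have repX U t : X U -> r2 t \in val U -> r3 t \in val U -> represents U (fun a => (Q a).@[t]).
  move=> /subalg_varietyP cU r2U r3U; apply: rep; have /andP[_ /eqP dU] := valP U.
  by apply: span3_eq => //; [exact: frs | exact: cU].
pose tup c0 c1 c2 c3 c4 c5 c6 c7 : 'I_8 -> K := fun j => [:: c0; c1; c2; c3; c4; c5; c6; c7]`_j.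
exists l0, l, Q; split; last first.
  move=> U XU [c0 [c1 [c2 [c3 [c4 [c5 [c6 [c7 [h2 h3]]]]]]]]].
  have [c cn0 /linear_formZ ->] := repX U (tup c0 c1 c2 c3 c4 c5 c6 c7) XU h2 h3.
  by rewrite QEl det1 mulr1.
split=> [t|U XU U0|t|t j]; try by rewrite QEl.
- have [U XU UE] := ex_two_gen (r2I t) (r3I t) (frs t); exists U => //; exact: rep.
- have /andP[Uim /eqP dU] := valP U.
  have sU : size (vbasis (val U)) = 3%N by rewrite size_tuple dU.
  have SI v : v \in vbasis (val U) -> v \in im C.
    by move=> /vbasis_mem; exact: (subvP Uim).
  have SU i : (i < 3)%N -> (vbasis (val U))`_i \in val U.
    by move=> i3; apply: vbasis_mem; rewrite mem_nth // sU.
  move: U0; rewrite plucker_minors lZ mulf_eq0 negb_or -g0E // => /andP[_ D0].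
  move: D0; set D := det3 _ _ _ _ => D0.
  pose v2 := (- D^-1) *: contract (phi 1%N) (phi 3%N) (vbasis (val U)).
  pose v3 := D^-1 *: contract (phi 1%N) (phi 2%N) (vbasis (val U)).
  have v2U : v2 \in val U by rewrite memvZ // mem_contract.
  have v3U : v3 \in val U by rewrite memvZ // mem_contract.
  have v2I : v2 \in im C := subvP Uim _ v2U.
  have v3I : v3 \in im C := subvP Uim _ v3U.
  have phiZ i c v : phi i (c *: v) = c * (phi i v : K) :> K by rewrite linearZ.
  have p2 i : phi i v2 = - D^-1 * det3 (phi i) (phi 1%N) (phi 3%N) (vbasis (val U)) :> K.
    by rewrite phiZ contractE.
  have p3 i : phi i v3 = D^-1 * det3 (phi i) (phi 1%N) (phi 2%N) (vbasis (val U)) :> K.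
    by rewrite phiZ contractE.
  have [a1 [a2 [a3 [a4 [a5 [a6 [a7 e2]]]]]]] := nb_im_surj bt v2I.
  have [b1 [b2 [b3 [b4 [b5 [b6 [b7 e3]]]]]]] := nb_im_surj bt v3I.
  have DV : D^-1 * D = 1 by rewrite mulVf.
  have := p2 1%N; have := p2 2%N; have := p2 3%N.
  have := p3 1%N; have := p3 2%N; have := p3 3%N.
  rewrite {1 2 3}e2 {1 2 3}e3 !phiE //= => h33 h32 h31 h23 h22 h21.
  have h0 c (d : K) : d = 0 -> c * d = 0 by move=> ->; rewrite mulr0.
  exists (tup a4 a5 a6 a7 b4 b5 b6 b7); apply: repX => //; rewrite /r2 /r3 /tup /=.
    have e21 : a1 = 0 by rewrite h21 h0 // /det3; ring.
    have e22 : a2 = 1.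
      by rewrite h22 mulNr -mulrN -DV; congr (_ * _); rewrite /D /det3; ring.
    have e23 : a3 = 0 by rewrite h23 h0 // /det3; ring.
    by move: v2U; rewrite e2 e21 e22 e23.
  have e31 : b1 = 0 by rewrite h31 h0 // /det3; ring.
  have e32 : b2 = 0 by rewrite h32 h0 // /det3; ring.
  have e33 : b3 = 1.
    by rewrite h33 -DV; congr (_ * _); rewrite /D /det3; ring.
  by move: v3U; rewrite e3 e31 e32 e33.
Qed.

Lemma subalg_charts U : X U -> exists l0 (l : 'I_8 -> 'I_N -> K) Q,
  chart X l0 l Q /\ linear_form l0 (plucker U) != 0.
Proof.
move=> XU; have [x [y [z [bt cell]]]] := big_cell_cover XU.
have [l0 [l [Q [XQ h]]]] := subalg_chart bt.
by exists l0, l, Q; split=> //; exact: h.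
Qed.

Lemma subalg_krull_dim : krull_dim X 8.
Proof.
split; last by move=> n Z; apply: charts_krull_le; exact: subalg_charts.
have [U /subalg_charts[l0 [l [Q [XQ _]]]]] := subalg_nonempty C.
exact: chart_krull_ge (@subalg_closed K C) XQ.
Qed.

Lemma subalg_smooth : smooth X.
Proof.
exists 8%N; first exact: subalg_krull_dim.
move=> U XU; have [l0 [l [Q [XQ U0]]]] := subalg_charts XU.
by have := chart_tangent XQ XU U0.
Qed.

End CayleyCharts.

(** * The Zariski topology of affine space *)

Section ZariskiAffine.
Local Open Scope classical_set_scope.
Local Open Scope ring_scope.
Variables (K : fieldType) (V : vectType K).
Implicit Types (u v : V) (f : V -> K).

Lemma polyfuns_algebra : fun_algebra (@polyfuns K V).
Proof.
split=> [c|_ _ [p ->] [q ->]|_ _ [p ->] [q ->]].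
- by exists c%:MP; apply: funext => s; rewrite mevalC.
- by exists (p + q); apply: funext => s; rewrite mevalD.
- by exists (p * q); apply: funext => s; rewrite mevalM.
Qed.

(** Both the continuity of polynomial maps and the regularity of polynomials
    along curves are instances of this. *)
Lemma polyfuns_comp (T : Type) (A : set (T -> K)) (g : T -> V) f :
  fun_algebra A -> vec_fun A g -> polyfuns f -> A (fun t => f (g t)).
Proof.
move=> AP Ag [p ->]; elim/mpoly_ring_ind: p => [c|i|p q Ap Aq|p q Ap Aq].
- by apply: (fun_ext (fun t => mevalC _ _)); exact: fun_cst.
- have e t : ('X_i : {mpoly K[_]}).@[coords (g t)] = coord (vbasis {:V}) i (g t) by rewrite mevalXU.
  by apply: (fun_ext e); apply: vec_fun_coord.
- by apply: (fun_ext (fun t => mevalD _ _ _)); exact: fun_add.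
- by apply: (fun_ext (fun t => mevalM _ _ _)); exact: fun_mul.
Qed.

Lemma polyfuns_linear f : (forall a u v, f (a *: u + v) = a * f u + f v) -> polyfuns f.
Proof.
move=> fl; have f0 : f 0 = 0 by rewrite -[0 in LHS](addNr 0) -scaleN1r fl mulN1r addNr.
pose b := vbasis {:V}; have fsum (c : 'I_(\dim {:V}) -> K) :
    f (\sum_i c i *: b`_i) = \sum_i c i * f b`_i.
  by apply: (big_rec2 (fun p q => f p = q)) => // i p q _ <-; rewrite fl.
apply: (fun_ext (g := fun v => \sum_i coord b i v * f b`_i)) => [v|].
  by rewrite -fsum -coord_vbasis // memvf.
have P := polyfuns_algebra; apply: (fun_sum P) => i _; apply: (fun_mul P).
  by exists 'X_i; apply: funext => v; rewrite mevalXU.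
exact: (fun_cst P).
Qed.

Lemma vec_fun_linear (W : vectType K) (g : V -> W) :
  (forall a u v, g (a *: u + v) = a *: g u + g v) -> vec_fun (@polyfuns K V) g.
Proof.
by move=> gl phi; apply: polyfuns_linear => a u v; rewrite gl linearP.
Qed.

Lemma closed_polyfun f : polyfuns f -> closed ([set v | f v = 0] : set (affine_space V)).
Proof.
move=> Pf; rewrite -(setCK [set _ | _]); apply: open_closedC.
exists [set f]; first by move=> _ ->.
apply/seteqP; split=> v /=; first by move=> /eqP h; exists f.
by case=> _ -> /eqP.
Qed.

Lemma closed_subspace (W : vectType K) (g : V -> W) (U : {vspace W}) :
  vec_fun (@polyfuns K V) g -> closed ([set v | g v \in U] : set (affine_space V)).
Proof.
move=> Pg; have P := polyfuns_algebra.
pose b := vbasis {:W}; pose pr : 'End(W) := (\1 - projv U)%VF.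
rewrite (_ : [set v | _] = \bigcap_(i in [set: 'I_(\dim {:W})])
    [set v | coord b i (pr (g v)) = 0]).
  apply: closed_bigI => i _; apply: closed_polyfun.
  apply: vec_fun_coord => phi.
  by apply: (fun_ext _ (Pg (phi \o pr)%VF)) => v; rewrite comp_lfunE.
have prE w : pr w = w - projv U w by rewrite !lfunE /= !lfunE.
apply/seteqP; split=> v /=.
  by move=> gU i _ /=; rewrite prE projv_id // subrr linear0.
move=> h; have /eqP : pr (g v) = 0.
  by rewrite (coord_vbasis (memvf (pr _))) big1 // => i _; rewrite (h i I) scale0r.
by rewrite prE subr_eq0 => /eqP ->; exact: memv_proj.
Qed.

End ZariskiAffine.

Section ZariskiContinuous.
Local Open Scope classical_set_scope.

Lemma zariski_continuous (K : fieldType) (V W : vectType K) (g : V -> W) :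
  vec_fun (@polyfuns K V) g -> continuous (g : affine_space V -> affine_space W).
Proof.
move=> Pg; apply/continuousP => _ [S SP ->].
exists [set f | exists2 q, S q & f = fun v => q (g v)].
  by move=> _ [q /SP Pq ->]; exact: (polyfuns_comp (@polyfuns_algebra K V) Pg Pq).
apply/seteqP; split=> v /=; first by case=> q Sq qv; exists (fun v => q (g v)) => //; exists q.
by case=> _ [q Sq ->] qv; exists q.
Qed.

End ZariskiContinuous.

Section Connectedness.
Local Open Scope classical_set_scope.
Variable T : topologicalType.

Lemma connected_image (U : topologicalType) (f : T -> U) (A : set T) :
  continuous f -> connected A -> connected (f @` A).
Proof.
by move=> fc cA; apply: connected_continuous_connected => //; exact: continuous_subspaceT.
Qed.

Lemma connected_setU (A B : set T) x : A x -> B x -> connected A -> connected B ->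
  connected (A `|` B).
Proof.
move=> Ax Bx cA cB; have -> : A `|` B = \bigcup_(b in [set: bool]) (if b then A else B).
  apply/seteqP; split=> y /=; first by case=> h; [exists true | exists false].
  by case=> -[] _ h; [left | right].
by apply: bigcup_connected => [|[]] //; exists x => -[].
Qed.

(** A fibre is the complement of the finitely many other ones, hence open as well as
    closed. The function, which has its values in [s], is given by its fibres. *)
Lemma connected_fibre (I : choiceType) (s : seq I) (F : I -> set T) (A : set T) :
    connected A -> (forall i, closed (F i)) ->
    (forall x, A x -> exists2 i, i \in s & F i x) ->
    (forall i j x, A x -> F i x -> F j x -> i = j) ->
  forall i x, A x -> F i x -> A `<=` F i.
Proof.
move=> cA cF cov dis i x Ax Fix.
have cG : closed (\bigcup_(j in [set` rem i (undup s)]) F j).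
  by apply: closed_bigcup; [exact: finite_seq | move=> j _; exact: cF].
have <- : A `&` F i = A; last by move=> ? [].
apply: cA.
- by exists x.
- exists (~` \bigcup_(j in [set` rem i (undup s)]) F j); first exact: closed_openC.
  apply/seteqP; split=> y [Ay Fy]; split=> //.
    case=> j /=; rewrite mem_rem_uniq ?undup_uniq // !inE => /andP[ji _] Fj.
    by move/eqP: ji; apply; exact: dis Fj Fy.
  have [j js Fj] := cov y Ay; have [<-//|ij] := eqVneq j i.
  case: Fy; exists j => //=.
  by rewrite mem_rem_uniq ?undup_uniq // !inE ij mem_undup.
- by exists (F i).
Qed.

End Connectedness.

(** * The Lie-Kolchin theorem *)

Section Eigenvectors.
Local Open Scope ring_scope.
Variables (K : fieldType) (V : vectType K).
Implicit Types (u v w : V) (a g h : 'End(V)) (U W : {vspace V}) (p q : {poly K}).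

(** A subspace of maximal dimension on which [P] holds contains every vector
    with [P]. *)
Lemma vspace_of_pred (P : V -> Prop) : P 0 ->
  (forall c u v, P u -> P v -> P (c *: u + v)) -> exists U, forall v, v \in U <-> P v.
Proof.
move=> P0 PD; pose Q n := `[< exists U : {vspace V}, \dim U = n /\ forall v, v \in U -> P v >].
have exQ : exists n, Q n.
  by exists 0%N; apply/asboolP; exists 0%VS; rewrite dimv0; split=> // v; rewrite memv0 => /eqP ->.
have bQ n : Q n -> (n <= \dim {:V})%N by move=> /asboolP[U [<- _]]; rewrite dimvS ?subvf.
have [n /asboolP[U [dU UP]] nmax] := ex_maxnP exQ bQ.
exists U => v; split=> [|Pv]; first exact: UP.
apply: contrapT => /negP vU; suff : (n.+1 <= n)%N by rewrite ltnn.
apply: nmax; apply/asboolP; exists (<[v]> + U)%VS; split.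
  rewrite dimv_disjoint_sum ?dU ?dim_vline; last first.
    apply/eqP; rewrite -subv0; apply/subvP => w; rewrite memv_cap => /andP[/vlineP[c ->] cU].
    have [->|c0] := eqVneq c 0; first by rewrite scale0r mem0v.
    by case/negP: vU; rewrite -[v](scalerK c0) memvZ.
  by rewrite (_ : v != 0) //; apply: contraNneq vU => ->; exact: mem0v.
by move=> _ /memv_addP[_ /vlineP[c ->] [u /UP Pu ->]]; exact: PD.
Qed.

Definition peval p a v : V := \sum_(i < size p) p`_i *: iter i a v.

Lemma pevalE n p a v : (size p <= n)%N -> peval p a v = \sum_(i < n) p`_i *: iter i a v.
Proof.
move=> pn; rewrite /peval (big_ord_widen n (fun i => p`_i *: iter i a v) pn) big_mkcond.
apply: eq_bigr => i _ /=; case: ltnP => // h; by rewrite nth_default // scale0r.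
Qed.

Lemma peval_mulXsub p r a v : peval (p * ('X - r%:P)) a v = a (peval p a v) - r *: peval p a v.
Proof.
pose n := (size p).+1.
have pn : (size p <= n)%N := leqnSn _.
have qn : (size (p * ('X - r%:P))%R <= n)%N.
  have [->|p0] := eqVneq p 0; first by rewrite mul0r size_poly0.
  by rewrite size_Mmonic ?monicXsubC // size_XsubC addn2.
rewrite (pevalE _ _ qn).
have -> : a (peval p a v) = \sum_(i < n) (p * 'X)`_i *: iter i a v.
  rewrite big_ord_recl coefMX eqxx scale0r add0r /peval linear_sum.
  by apply: eq_bigr => i _; rewrite linearZ coefMX.
rewrite (pevalE _ _ pn) scaler_sumr -sumrB; apply: eq_bigr => i _.
by rewrite mulrBr coefB coefMC scalerBl scalerA [r * _]mulrC.
Qed.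

Lemma iter_eigen a W w l i : (forall x, x \in W -> a x \in W) -> a w - l *: w \in W ->
  iter i a w - l ^+ i *: w \in W.
Proof.
move=> aW aw; elim: i => [|i IHi]; first by rewrite expr0 scale1r subrr mem0v.
rewrite iterS (_ : _ - _ = a (iter i a w - l ^+ i *: w) + l ^+ i *: (a w - l *: w)).
  by rewrite rpredD ?aW // memvZ.
have -> : a (iter i a w - l ^+ i *: w) = a (iter i a w) - l ^+ i *: a w.
  by rewrite linearB linearZ.
by rewrite scalerBr scalerA -exprSr addrA subrK.
Qed.

Lemma roots_seq p : p != 0 -> exists s : seq K, forall l, root p l -> l \in s.
Proof.
have [n] := ubnP (size p); elim: n p => // n IHn p /ltnSE sp p0.
have [[r rp]|h] := pselect (exists r, root p r); last first.
  by exists [::] => l lp; case: h; exists l.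
have [q pE] := factor_theorem p r rp.
have q0 : q != 0 by apply: contraNneq p0 => q0; rewrite pE q0 mul0r.
have [|s sP] := IHn q _ q0.
  by move: sp; rewrite pE size_Mmonic ?monicXsubC // size_XsubC addn2.
exists (r :: s) => l; rewrite pE rootM root_XsubC inE => /orP[/sP ->|->//].
by rewrite orbT.
Qed.

(** The powers of [a] lie in a finite-dimensional space. *)
Lemma annihilating_poly a : exists2 p, p != 0 & forall v, peval p a v = 0.
Proof.
pose n := (\dim {:'End(V)}).+1.
pose pw i : 'End(V) := iter i (fun f => a \o f)%VF \1%VF.
have pwE i v : pw i v = iter i a v.
  by elim: i => [|i IHi]; rewrite /pw /= ?id_lfunE // comp_lfunE -IHi.
pose X := [tuple pw i | i < n].
have nfX : ~~ free X.
  apply/negP => fX; have := dimvS (subvf <<X>>%VS).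
  by rewrite (eqnP fX) size_tuple ltnn.
have [k [k0 [i ki]]] : exists k : 'I_n -> K, \sum_(i < n) k i *: X`_i = 0 /\ exists i, k i != 0.
  apply: contrapT => h; case/negP: nfX; apply/freeP => k k0 i.
  by apply: contrapT => /eqP ki; apply: h; exists k; split=> //; exists i.
exists (\poly_(i < n) k (inord i)).
  apply: contraNneq ki => /(congr1 (fun q : {poly K} => q`_i)).
  by rewrite coef_poly ltn_ord inord_val coef0 => ->.
move=> v; rewrite (pevalE _ _ (size_poly _ _)).
have := congr1 (fun f : 'End(V) => f v) k0; rewrite zero_lfunE sum_lfunE => h.
rewrite -[RHS]h; apply: eq_bigr => j _.
by rewrite coef_poly ltn_ord inord_val scale_lfunE -tnth_nth tnth_mktuple pwE.
Qed.

(** Eigenvalues modulo stable subspaces are roots of an annihilating polynomial. *)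
Lemma eigenvalues_finite a : exists s : seq K, forall W w l,
  (forall x, x \in W -> a x \in W) -> w \notin W -> a w - l *: w \in W -> l \in s.
Proof.
have [p p0 pv] := annihilating_poly a; have [s sE] := roots_seq p0.
exists s => W w l aW wW aw; apply: sE.
apply/eqP; apply: contraNeq wW => pl.
have : p.[l] *: w \in W.
  rewrite horner_coef scaler_suml.
  have -> : \sum_(i < size p) (p`_i * l ^+ i) *: w =
      \sum_(i < size p) p`_i *: (l ^+ i *: w - iter i a w).
    rewrite -[LHS]subr0 -[X in _ - X](pv w) -sumrB; apply: eq_bigr => j _.
    by rewrite scalerBr scalerA.
  apply: rpred_sum => j _; apply: memvZ.
  by rewrite -opprB rpredN; exact: iter_eigen.
by move=> /(memvZ p.[l]^-1); rewrite scalerA mulVf // scale1r.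
Qed.

End Eigenvectors.

Section LieKolchin.
Local Open Scope classical_set_scope.
Local Open Scope ring_scope.
Variables (K : closedFieldType) (V : vectType K).
Implicit Types (u v w : V) (a f g h : 'End(V)) (E U W : {vspace V}) (H G : set 'End(V)).

(** A polynomial [p] of least size with [p(a) v] in [W] has size at least two,
    and dividing it by a linear factor produces the eigenvector. *)
Lemma eigenvector_mod a E W v : (forall x, x \in E -> a x \in E) -> v \in E -> v \notin W ->
  exists w l, [/\ w \in E, w \notin W & a w - l *: w \in W].
Proof.
move=> aE vE vW.
pose Q n := `[< exists p : {poly K}, [/\ size p = n, p != 0 & peval p a v \in W] >].
have exQ : exists n, Q n.
  have [p p0 pv] := annihilating_poly a.
  by exists (size p); apply/asboolP; exists p; rewrite pv mem0v.
have [n /asboolP[p [pn p0 pW]] nmin] := ex_minnP exQ.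
have [r rp] : exists r, root p r.
  apply/closed_rootP; apply: contraNneq vW => /eqP/size_poly1P[c c0 pE]; move: pW.
  rewrite pE /peval size_polyC c0 big_ord_recl big_ord0 addr0 coefC eqxx /=.
  by move=> /(memvZ c^-1); rewrite scalerA mulVf // scale1r.
have [q pE] := factor_theorem p r rp.
have q0 : q != 0 by apply: contraNneq p0 => q0; rewrite pE q0 mul0r.
exists (peval q a v), r; split; last by rewrite -peval_mulXsub -pE.
  by apply: rpred_sum => i _; apply: memvZ; elim: {i}(nat_of_ord i) => //= i; exact: aE.
apply/negP => qW; have : Q (size q) by apply/asboolP; exists q.
by move=> /nmin; rewrite -pn pE size_Mmonic ?monicXsubC // size_XsubC addn2 ltnn.
Qed.

Definition preserves H U := forall g, H g -> forall v, v \in U -> g v \in U.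

(** Inversion is the restriction of a polynomial map, so that conjugation and
    commutators are continuous. This holds for orthogonal groups, where the
    inverse is the adjoint. *)
Definition regular_inverse H := exists2 J : 'End(V) -> 'End(V),
  vec_fun (@polyfuns K 'End(V)) J & forall g, H g -> (g^-1)%VF = J g.

(** For [v] fixed and [g] in the connected group, [a (g v)] is a multiple of [g v]
    with a factor from a finite set, hence with a constant factor. *)
Lemma connected_eigenvalue H a W v l : connected (H : set (affine_space 'End(V))) ->
    H \1%VF -> (forall x, x \in W -> a x \in W) ->
    (forall g, H g -> g v \notin W) -> a v - l *: v \in W ->
    (forall g, H g -> exists m, a (g v) - m *: g v \in W) ->
  forall g, H g -> a (g v) - l *: g v \in W.
Proof.
move=> cH H1 aW gvW av Hg; have [s sP] := eigenvalues_finite a.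
pose F m : set (affine_space 'End(V)) := [set g : 'End(V) | a (g v) - m *: g v \in W].
have Fcl m : closed (F m).
  apply: (@closed_subspace K 'End(V) V (fun g : 'End(V) => a (g v) - m *: g v)).
  apply: vec_fun_linear => c f g; rewrite add_lfunE scale_lfunE linearP /=.
  by rewrite scalerDr scalerBr !scalerA [m * c]mulrC opprD addrACA.
apply: (@connected_fibre _ _ s F H cH Fcl _ _ l \1%VF H1).
- by move=> g gH; have [m gm] := Hg g gH; exists m => //; exact: sP aW (gvW g gH) gm.
- move=> i j g gH; rewrite /F /= => gi gj; apply: contrapT => /eqP ij.
  have := gvW g gH; have : (i - j) *: g v \in W.
    rewrite (_ : _ *: _ = (a (g v) - j *: g v) - (a (g v) - i *: g v)); first by rewrite rpredB.
    by rewrite scalerBl opprB [RHS]addrC addrA subrK.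
  by move=> /(memvZ (i - j)^-1); rewrite scalerA mulVf ?subr_eq0 // scale1r => ->.
- by rewrite /F /= id_lfunE.
Qed.

Section Group.
Variable H : set 'End(V).
Hypothesis HG : linear_group H.

Lemma group_invK g v : H g -> (g^-1)%VF (g v) = v.
Proof. by case: HG => H0 _ _ _ /H0 g0; exact: lker0_lfunK. Qed.

Lemma group_Kinv g v : H g -> g ((g^-1)%VF v) = v.
Proof. by case: HG => H0 _ _ _ /H0 g0; exact: lker0_lfunVK. Qed.

Lemma group_inv g : H g -> H (g^-1)%VF. Proof. by case: HG => _ _ _; apply. Qed.

Lemma group_comp f g : H f -> H g -> H (f \o g)%VF. Proof. by case: HG => _ _ + _; apply. Qed.

Lemma group_id : H \1%VF. Proof. by case: HG. Qed.

Lemma group_notin g v W : H g -> preserves H W -> v \notin W -> g v \notin W.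
Proof. by move=> gH HW; apply: contra => /(HW _ (group_inv gH)); rewrite group_invK. Qed.

Lemma derived_sub : derived_group H `<=` H.
Proof.
apply: smallest_sub => // _ [f fH [g gH <-]].
by do 2! [apply: group_comp; last exact: group_inv]; apply: group_comp.
Qed.

Lemma derived_linear : linear_group (derived_group H).
Proof.
split=> [g /derived_sub|A [AG _]|f g fD gD A AP|g gD A AP].
- by case: HG => H0 _ _ _; exact: H0.
- by case: AG.
- by have [[_ _ AM _] _] := AP; apply: AM; [exact: fD | exact: gD].
- by have [[_ _ _ AV] _] := AP; apply: AV; exact: gD.
Qed.

Lemma derived_comm f g : H f -> H g -> derived_group H (f \o g \o f^-1 \o g^-1)%VF.
Proof. by move=> fH gH; apply: sub_gen_smallest; exists f => //; exists g. Qed.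

(** The conjugate is the product of [d] with the commutator of [g^-1] and [d]. *)
Lemma derived_conj d g : derived_group H d -> H g -> derived_group H (g^-1 \o d \o g)%VF.
Proof.
move=> dD gH; have dH := derived_sub dD; have [_ _ DM _] := derived_linear.
have gVH := group_inv gH.
have := DM _ _ (derived_comm gVH dH) dD; congr (derived_group H _).
apply/lfunP => v; rewrite !comp_lfunE; congr ((g^-1)%VF (d _)).
rewrite group_invK //; have inj := can_inj (fun u => group_invK u gVH).
by apply: inj; rewrite group_Kinv // group_invK.
Qed.

Lemma regular_inverse_derived : regular_inverse H -> regular_inverse (derived_group H).
Proof. by case=> J PJ JE; exists J => // g /derived_sub; exact: JE. Qed.

Definition comm f g : 'End(V) := (f \o g \o f^-1 \o g^-1)%VF.

Fixpoint comm_products n : set 'End(V) := if n is m.+1 then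
  [set h | exists p f g, [/\ comm_products m p, H f, H g & h = (p \o comm f g)%VF]]
  else [set \1%VF].

Lemma inv_unique f g : H f -> (f \o g = \1)%VF -> (f^-1 = g)%VF.
Proof.
move=> fH fg; apply/lfunP => v; apply: (can_inj (fun u => group_invK u fH)).
by rewrite group_Kinv // -comp_lfunE fg id_lfunE.
Qed.

Lemma group_comm f g : H f -> H g -> H (comm f g).
Proof. by move=> fH gH; apply: derived_sub; exact: derived_comm. Qed.

Lemma comm_inv f g : H f -> H g -> (comm f g \o comm g f = \1)%VF.
Proof.
move=> fH gH; apply/lfunP => v; rewrite !comp_lfunE id_lfunE.
by rewrite (group_invK _ gH) (group_invK _ fH) (group_Kinv _ gH) (group_Kinv _ fH).
Qed.

Lemma comm1 f : H f -> comm f \1%VF = \1%VF.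
Proof.
move=> fH; have i1 : (\1^-1 = \1 :> 'End(V))%VF.
  by apply: inv_unique; [exact: group_id | rewrite comp_lfun1l].
by rewrite /comm i1 !comp_lfun1r; apply/lfunP => v; rewrite comp_lfunE group_Kinv // id_lfunE.
Qed.

Lemma comm_products_sub n : comm_products n `<=` derived_group H.
Proof.
have [_ D1 DM _] := derived_linear.
elim: n => [_ -> //|n IHn] _ [p [f [g [/IHn pD fH gH ->]]]].
by apply: DM => //; exact: derived_comm.
Qed.

Lemma comm_productsM m n p q : comm_products m p -> comm_products n q ->
  comm_products (m + n) (p \o q)%VF.
Proof.
move=> mp; elim: n q => [|n IHn] q /=; first by move=> ->; rewrite addn0 comp_lfun1r.
move=> [q' [f [g [/IHn h fH gH ->]]]]; rewrite addnS comp_lfunA.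
by exists (p \o q')%VF, f, g.
Qed.

Lemma comm_productsV n p : comm_products n p -> comm_products n (p^-1)%VF.
Proof.
elim: n p => [_ ->|n IHn p].
  by apply: inv_unique; [exact: group_id | rewrite comp_lfun1l].
move=> [q [f [g [nq fH gH ->]]]]; rewrite -add1n.
have qH : H q by apply: derived_sub; exact: comm_products_sub nq.
have -> : ((q \o comm f g)^-1 = comm g f \o q^-1)%VF.
  apply: inv_unique; first by apply: group_comp => //; exact: group_comm.
  rewrite comp_lfunA -(comp_lfunA q) comm_inv // comp_lfun1r.
  by apply/lfunP => v; rewrite comp_lfunE group_Kinv // id_lfunE.
apply: comm_productsM; last exact: IHn.
by exists \1%VF, g, f; split=> //; rewrite comp_lfun1l.
Qed.

Lemma derived_products : derived_group H = \bigcup_n comm_products n.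
Proof.
apply/seteqP; split=> [|g [n _ /comm_products_sub //]].
apply: smallest_sub => [|_ [f fH [g gH <-]]]; last first.
  by exists 1%N => //; exists \1%VF, f, g; split=> //; rewrite comp_lfun1l.
split=> [g [n _ /comm_products_sub/derived_sub gH]||f g [m _ mf] [n _ ng]|g [n _ ng]].
- by case: HG => H0 _ _ _; exact: H0.
- by exists 0%N.
- by exists (m + n)%N => //; exact: comm_productsM.
- by exists n => //; exact: comm_productsV.
Qed.

(** The derived group is the increasing union of the sets of products of [n]
    commutators, and each of these is connected as a union of translates, through
    common points, of the sets of commutators with a fixed left entry. *)
Lemma derived_connected : regular_inverse H ->
  connected (H : set (affine_space 'End(V))) ->
  connected (derived_group H : set (affine_space 'End(V))).
Proof.
move=> [J PJ JE] cH.
have conn p f : connected ([set (p \o comm f g)%VF | g in H] : set (affine_space 'End(V))).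
  pose F g : 'End(V) := (p \o (f \o g \o f^-1 \o J g))%VF.
  rewrite (_ : [set _ | g in H] = F @` (H : set (affine_space 'End(V)))).
    apply: connected_image => //; apply: zariski_continuous.
    apply: (@vec_fun_bilinear _ _ _ (@polyfuns_algebra K _) _ _ _
      (fun g h : 'End(V) => p \o (g \o h))%VF (fun g : 'End(V) => f \o g \o f^-1)%VF J) => //.
    - move=> a x y z; apply/lfunP => v.
      by rewrite !(add_lfunE, scale_lfunE, comp_lfunE) linearP.
    - move=> a x y z; apply/lfunP => v.
      by rewrite !(add_lfunE, scale_lfunE, comp_lfunE) !linearP.
    - apply: vec_fun_linear => a x y; apply/lfunP => v.
      by rewrite !(add_lfunE, scale_lfunE, comp_lfunE) !linearP.
  by apply/seteqP; split=> _ [g gH <-]; exists g => //; rewrite /F /comm (JE g gH).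
have P1 n : comm_products n \1%VF.
  elim: n => // n IHn; have h1 := group_id; exists \1%VF, \1%VF, \1%VF; split=> //.
  by rewrite comm1 // comp_lfun1l.
have cP n : connected (comm_products n : set (affine_space 'End(V))).
  elim: n => [|n IHn]; first exact: connected1.
  have -> : (comm_products n.+1 : set (affine_space 'End(V))) =
      \bigcup_(i in [set i : 'End(V) * 'End(V) | comm_products n i.1 /\ H i.2])
        (comm_products n `|` [set (i.1 \o comm i.2 g)%VF | g in H]).
    apply/seteqP; split=> [_ [p [f [g [np fH gH ->]]]]|h [[p f] /= [np fH]]].
      by exists (p, f) => //; right; exists g.
    case=> [nh|[g gH <-]]; last by exists p, f, g.
    by exists h, f, \1%VF; split=> //; [exact: group_id | rewrite comm1 // comp_lfun1r].
  apply: bigcup_connected => [|[p f] /= [np fH]]; first by exists \1%VF => i _; left.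
  apply: (@connected_setU (affine_space 'End(V)) _ _ p) => //.
  by exists \1%VF; [exact: group_id | rewrite comm1 // comp_lfun1r].
by rewrite derived_products; apply: bigcup_connected => // ; exists \1%VF => n _.
Qed.

End Group.

(** The derived group has by induction a weight vector modulo [W]. Its weight
    space [S] is stable under [H], because the weight cannot vary along a
    connected group. In a minimal stable subspace of [S] properly containing
    [W], an eigenspace of an element of [H] is stable too, as commutators act
    by scalars and eigenvalues cannot vary; by minimality it is everything.
    Working modulo [W] allows the theorem to be applied along a flag without
    forming quotients. *)
Lemma lie_kolchin n H E W v0 : linear_group H ->
    connected (H : set (affine_space 'End(V))) -> regular_inverse H ->
    iter n (@derived_group K V) H = [set \1%VF] -> preserves H E -> preserves H W ->
    (W <= E)%VS -> v0 \in E -> v0 \notin W ->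
  exists v, [/\ v \in E, v \notin W & forall g, H g -> exists c, g v - c *: v \in W].
Proof.
elim: n H E W v0 => [|n IHn] H E W v0 HG cH HJ Hn HE HW WE v0E v0W.
  exists v0; split=> // g; rewrite -[H]/(iter 0 (@derived_group K V) H) Hn => ->.
  by exists 1; rewrite id_lfunE scale1r subrr mem0v.
pose D := derived_group H; have DH : D `<=` H := derived_sub HG.
have [v1 [v1E v1W /choice[chi chiP]]] : exists v, [/\ v \in E, v \notin W &
    forall g, exists c, D g -> g v - c *: v \in W].
  have [|||||||||v [vE vW vc]] := IHn D E W v0.
  - exact: derived_linear.
  - exact: derived_connected.
  - exact: regular_inverse_derived.
  - by rewrite -Hn iterSr.
  - by move=> g /DH; exact: HE.
  - by move=> g /DH; exact: HW.
  - by [].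
  - by [].
  - by [].
  - exists v; split=> // g; have [/vc[c gc]|gD] := pselect (D g); first by exists c.
    by exists 0.
have gW g v : H g -> v \notin W -> g v \notin W by move=> gH; exact: (group_notin HG gH HW).
have subW g c v : H g -> v \in W -> g v - c *: v \in W.
  by move=> gH vW; rewrite rpredB ?memvZ //; exact: HW vW.
(* The weight space, modulo [W], of the weight [chi] of the derived group. *)
have [S SP] : exists S : {vspace V}, forall v, v \in S <-> v \in E /\ forall d, D d -> d v - chi d *: v \in W.
  apply: (@vspace_of_pred _ _ (fun v => v \in E /\ forall d, D d -> d v - chi d *: v \in W))
    => [|c u v [uE uc] [vE vc]].
    split=> [|d dD]; first exact: mem0v.
    by rewrite (linear0 d) scaler0 subrr mem0v.
  split=> [|d dD]; first by rewrite rpredD // memvZ.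
  rewrite (_ : _ - _ = c *: (d u - chi d *: u) + (d v - chi d *: v)).
    by rewrite rpredD ?vc // memvZ ?uc.
  by rewrite linearP scalerDr scalerBr !scalerA [chi d * c]mulrC opprD addrACA.
have WS : (W <= S)%VS.
  apply/subvP => w wW; apply/SP; split=> [|d /DH dH]; first exact: (subvP WE).
  exact: subW.
have v1S : v1 \in S by apply/SP.
have HS : preserves H S.
  move=> g gH v; have [vW _|vW] := boolP (v \in W).
    by apply: (subvP WS); exact: HW vW.
  move=> vS; have [vE vc] := (SP v).1 vS; apply/SP; split=> [|d dD]; first exact: HE vE.
  have dW x : x \in W -> d x \in W by apply: HW; exact: DH.
  have gvW g' : H g' -> g' v \notin W by move=> /gW; apply.
  apply: (connected_eigenvalue cH (group_id HG) dW gvW (vc d dD)) gH => {}g gH.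
  exists (chi (g^-1 \o d \o g)%VF); have := vc _ (derived_conj HG dD gH).
  move=> /(HW _ gH); rewrite linearB linearZ /= !comp_lfunE.
  by rewrite (group_Kinv HG).
(* Minimality is for stable subspaces of [S] larger than [W]. *)
pose Q m := `[< exists U, [/\ \dim U = m, (W <= U)%VS, (U <= S)%VS, preserves H U &
  exists2 v, v \in U & v \notin W] >].
have exQ : exists m, Q m.
  by exists (\dim S); apply/asboolP; exists S; split=> //; exists v1.
have [m /asboolP[U [dU WU US HU [v vU vW]]] mmin] := ex_minnP exQ.
exists v; split=> // [|g gH]; first by case: ((SP v).1 (subvP US _ vU)).
have [w [l [wU wW gw]]] := eigenvector_mod (HU _ gH) vU vW.
have [T TP] : exists T : {vspace V}, forall v, v \in T <-> v \in U /\ g v - l *: v \in W.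
  apply: (@vspace_of_pred _ _ (fun v => v \in U /\ g v - l *: v \in W))
    => [|c u u' [uU uc] [u'U u'c]].
    by split; rewrite ?(linear0 g) ?scaler0 ?subrr mem0v.
  split; first by rewrite rpredD // memvZ.
  rewrite (_ : _ - _ = c *: (g u - l *: u) + (g u' - l *: u')).
    by rewrite rpredD // memvZ.
  by rewrite linearP scalerDr scalerBr !scalerA [l * c]mulrC opprD addrACA.
have WT : (W <= T)%VS.
  by apply/subvP => x xW; apply/TP; split; [exact: (subvP WU) | exact: subW].
have TU : (T <= U)%VS by apply/subvP => x /TP[].
have HT : preserves H T.
  move=> h hH x; have [xW _|xW] := boolP (x \in W).
    by apply: (subvP WT); exact: HW xW.
  move=> xT; have [xU gx] := (TP x).1 xT; apply/TP; split; first exact: HU xU.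
  have hxW h' : H h' -> h' x \notin W by move=> /gW; apply.
  apply: (connected_eigenvalue cH (group_id HG) (HW _ gH) hxW gx) hH => {}h hH.
  pose k := (g \o h \o g^-1 \o h^-1)%VF; have kD : D k := derived_comm gH hH.
  have hxS : h x \in S by apply: (subvP US); exact: HU xU.
  have kh := ((SP _).1 hxS).2 k kD.
  have kE y : g (h y) = k (h (g y)).
    by rewrite /k !comp_lfunE (group_invK HG) // (group_invK HG).
  exists (l * chi k); rewrite kE.
  rewrite (_ : _ - _ = k (h (g x - l *: x)) + l *: (k (h x) - chi k *: h x)).
    by rewrite rpredD ?memvZ //; apply: (HW _ (DH _ kD)); exact: (HW _ hH).
  have -> : k (h (g x - l *: x)) = k (h (g x)) - l *: k (h x).
    by rewrite linearB linearZ linearB linearZ.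
  by rewrite scalerBr scalerA addrA subrK.
have TUE : T = U.
  apply/eqP; rewrite eqEdim TU dU; apply: mmin; apply/asboolP; exists T; split=> //.
    exact: subv_trans US.
  by exists w => //; apply/TP.
by exists l; case: ((TP v).1 _) => //; rewrite TUE.
Qed.

End LieKolchin.

(** * Flags and rational curves *)

Section Flags.
Local Open Scope classical_set_scope.
Local Open Scope ring_scope.
Variables (K : closedFieldType) (V : vectType K) (N : nat).
Variables (phi : nat -> 'Hom(V, K^o)) (e : nat -> V).
Implicit Types (u v w : V) (f g h : 'End(V)) (H G : set 'End(V)).

Definition flag k : {vspace V} := (\bigcap_(j < k) lker (phi j))%VS.

Lemma flagP k v : reflect (forall j, (j < k)%N -> phi j v = 0) (v \in flag k).
Proof.
apply: (iffP idP) => [h j jk|h].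
  move: h; rewrite memvE => /subv_bigcapP/(_ (Ordinal jk) isT).
  by rewrite -memvE memv_ker => /eqP.
by rewrite memvE; apply/subv_bigcapP => i _; rewrite -memvE memv_ker h.
Qed.

Lemma flagS j k : (j <= k)%N -> (flag k <= flag j)%VS.
Proof.
by move=> jk; apply/subvP => v /flagP h; apply/flagP => i ij; apply: h; exact: leq_trans jk.
Qed.

Hypothesis phiE : forall i j, (i < N)%N -> (j < N)%N -> phi i (e j) = (i == j)%:R :> K.
Hypothesis expand : forall v, v = \sum_(k < N) (phi k v : K) *: e k.

Lemma flag_full k : (N <= k)%N -> flag k = 0%VS.
Proof.
move=> Nk; apply/eqP; rewrite -subv0; apply/subvP => v /flagP h.
rewrite memv0 [v]expand big1 // => i _.
by rewrite h ?scale0r // (leq_trans (ltn_ord i)).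
Qed.

Lemma flag_basis k : (k < N)%N -> e k \in flag k.
Proof.
move=> kN; apply/flagP => j jk; rewrite phiE ?(ltn_trans jk) //.
by rewrite (ltn_eqF jk).
Qed.

Lemma flag_step k v : (k < N)%N -> v \in flag k -> v - (phi k v : K) *: e k \in flag k.+1.
Proof.
move=> kN vk; have /flagP h := vk; apply/flagP => j; rewrite ltnS linearB linearZ /=.
rewrite leq_eqVlt => /orP[/eqP ->|jk].
  by rewrite phiE // eqxx /GRing.scale /= mulr1 subrr.
by rewrite (h j jk) (phiE (ltn_trans jk kN) kN) (ltn_eqF jk) /GRing.scale /= mulr0 subrr.
Qed.

Lemma flag_scalar f k w : (k < N)%N -> (forall j v, v \in flag j -> f v \in flag j) ->
  w \in flag k -> f w - (phi k (f (e k)) : K) *: w \in flag k.+1.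
Proof.
move=> kN fF wk; have w' := flag_step kN wk; have ek := flag_basis kN.
have := flag_step kN (fF _ _ ek); set a := phi k (f (e k)); set b := phi k w => fe.
rewrite (_ : _ - _ = f (w - (b : K) *: e k) + (b : K) *: (f (e k) - (a : K) *: e k)
    - (a : K) *: (w - (b : K) *: e k)).
  by rewrite rpredB ?rpredD ?memvZ // fF.
have -> : f (w - (b : K) *: e k) = f w - (b : K) *: f (e k) by rewrite linearB linearZ.
by rewrite !scalerBr !scalerA [(b : K) * a]mulrC addrA subrK opprB addrA subrK.
Qed.

(** Commutators raise the filtration degree: the [r]-th derived group acts
    trivially on each quotient of [flag k] by [flag (k + r)]. *)
Lemma triangular_solvable G : linear_group G -> (forall k, preserves G (flag k)) ->
  solvable_group G.
Proof.
move=> GG GF.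
have step r : [/\ linear_group (iter r (@derived_group K V) G),
    iter r (@derived_group K V) G `<=` G &
    forall g, iter r (@derived_group K V) G g -> forall k v, v \in flag k ->
      g v - v \in flag (k + r)].
  elim: r => [|r [DG DS DF]].
    split=> // g gG k v vk; rewrite addn0 rpredB //; exact: GF vk.
  rewrite iterS; set D := iter r _ G in DG DS DF *.
  have dS := derived_sub DG.
  split; [exact: derived_linear | by move=> g /dS/DS |].
  move=> g gD; suff : [set g | D g /\ forall k v, v \in flag k -> g v - v \in flag (k + r.+1)] g.
    by case.
  apply: (smallest_sub _ _ gD) => [|_ [f fD [h hD <-]]].
    split=> [f [fD _]||f h [fD fF] [hD hF]|f [fD fF]].
    - by case: DG => D0 _ _ _; exact: D0.
    - by split=> [|k v vk]; [exact: group_id | rewrite id_lfunE subrr mem0v].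
    - split=> [|k v vk]; first exact: group_comp.
      rewrite comp_lfunE (_ : _ - _ = f (h v - v) + (f v - v)).
        by rewrite rpredD ?fF //; apply: (GF _ _ (DS _ fD)); exact: hF.
      by rewrite linearB addrA subrK.
    - have fV := group_inv DG fD; split=> // k v vk.
      rewrite (_ : _ - _ = - (f^-1)%VF (f v - v)).
        by rewrite rpredN; apply: (GF _ _ (DS _ fV)); exact: fF.
      have -> : (f^-1)%VF (f v - v) = (f^-1)%VF (f v) - (f^-1)%VF v by rewrite linearB.
      by rewrite (group_invK DG) // opprB.
  split; first by apply: dS; exact: derived_comm.
  move=> k v vk; pose u := (f^-1)%VF ((h^-1)%VF v).
  have [fV hV] := (group_inv DG fD, group_inv DG hD).
  have uk : u \in flag k by apply: (GF _ _ (DS _ fV)); exact: (GF _ _ (DS _ hV)).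
  have vE : v = h (f u) by rewrite /u !(group_Kinv DG).
  rewrite !comp_lfunE -/u vE.
  have [kN|Nk] := ltnP k N; last first.
    by move: uk; rewrite flag_full // memv0 => /eqP ->; rewrite (linear0 h) (linear0 f) (linear0 h) subrr mem0v.
  (* In degree zero, elements act on the quotient lines by commuting scalars; in
     degree [r > 0], the commutator of [f - 1] and [h - 1] raises degrees by [2 r]. *)
  have [r0|r0] := posnP r.
    rewrite r0 addn1; pose a : K := phi k (f (e k)).
    have fF j : forall v, v \in flag j -> f v \in flag j by move=> w; exact: (GF _ _ (DS _ fD)).
    have huk : h u \in flag k by exact: (GF _ _ (DS _ hD)).
    rewrite (_ : _ - _ = (f (h u) - a *: h u) - h (f u - a *: u)).
      rewrite rpredB ?(flag_scalar kN fF) //; apply: (GF _ _ (DS _ hD)).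
      exact: (flag_scalar kN fF).
    have -> : h (f u - a *: u) = h (f u) - a *: h u by rewrite linearB linearZ.
    by rewrite opprB addrA subrK.
  have hr : (k + r.+1 <= k + r + r)%N by rewrite -addnA leq_add2l -add1n leq_add2r.
  rewrite (_ : _ - _ = (f (h u - u) - (h u - u)) - (h (f u - u) - (f u - u))).
    by apply: (subvP (flagS hr)); rewrite rpredB //; apply: (DF) => //; exact: (DF).
  have -> : f (h u - u) = f (h u) - f u by rewrite linearB.
  have -> : h (f u - u) = h (f u) - h u by rewrite linearB.
  rewrite -(addrA (f (h u))) -opprD -(addrA (h (f u))) -opprD (addrCA (h u)).
  by move: (f u + _) => w; rewrite opprB addrA subrK.
exists N; have [NG _ NF] := step N.
apply/seteqP; split=> g; last by move=> ->; exact: group_id.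
move=> /NF gF; apply/lfunP => v; rewrite id_lfunE.
have := gF 0%N v; rewrite add0n (flag_full (leqnn _)) memv0 subr_eq0 => h.
by apply/eqP/h/flagP.
Qed.

End Flags.

Section RationalCurves.
Local Open Scope classical_set_scope.
Local Open Scope ring_scope.
Variables (K : closedFieldType) (V : vectType K).
Implicit Types (d p q : {poly K}) (f : K -> V).

(** Regular functions on the complement of the zeros of [d] in the affine line. *)
Definition regular_off d : set (K -> K) :=
  [set h | exists p n, forall s, d.[s] != 0 -> h s * d.[s] ^+ n = p.[s]].

Lemma regular_off_algebra d : fun_algebra (regular_off d).
Proof.
split=> [c|h1 h2 [p1 [n1 e1]] [p2 [n2 e2]]|h1 h2 [p1 [n1 e1]] [p2 [n2 e2]]].
- by exists c%:P, 0%N => s _; rewrite expr0 mulr1 hornerC.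
- exists (p1 * d ^+ n2 + p2 * d ^+ n1), (n1 + n2)%N => s s0.
  by rewrite hornerD !hornerM !horner_exp -e1 // -e2 // exprD; ring.
- exists (p1 * p2), (n1 + n2)%N => s s0.
  by rewrite hornerM -e1 // -e2 // exprD; ring.
Qed.

(** If the curve were the union of two disjoint nonempty relatively open
    subsets, a polynomial not vanishing at a point of the one, times a
    polynomial not vanishing at a point of the other, would vanish on the
    whole curve, while both are nonzero in the parameter. *)
Lemma rational_curve_connected d f : d != 0 -> vec_fun (regular_off d) f ->
  connected (f @` [set s | d.[s] != 0] : set (affine_space V)).
Proof.
move=> d0 Df B [b Bb] [O [SO SOP OE] BO] [C cC BC].
apply/seteqP; split=> [a|_ [s sD <-]]; first by rewrite BO => -[].
apply: contrapT => nB.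
have nC : ~ C (f s) by move=> Cs; apply: nB; rewrite BC; split=> //; exists s.
have [S SP SE] : open (~` C) by exact: closed_openC.
have : (~` C) (f s) by []; rewrite SE => -[p Sp ps].
have : O b by move: Bb; rewrite BO => -[].
rewrite OE => -[q Sq qb]; have [t tD tb] : (f @` [set s | d.[s] != 0]) b.
  by move: Bb; rewrite BO => -[].
have dP := regular_off_algebra d.
have [P [n PE]] := polyfuns_comp dP Df (SP _ Sp).
have [Q [m QE]] := polyfuns_comp dP Df (SOP _ Sq).
have PQ0 r : d.[r] != 0 -> p (f r) * q (f r) = 0.
  move=> rD; have Ar : (f @` [set s | d.[s] != 0]) (f r) by exists r.
  have [Cr|Cr] := pselect (C (f r)).
    have [->|pr] := eqVneq (p (f r)) 0; first by rewrite mul0r.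
    have : (~` C) (f r) by rewrite SE; exists p.
    by [].
  have [->|qr] := eqVneq (q (f r)) 0; first by rewrite mulr0.
  have Or : O (f r) by rewrite OE; exists q.
  have : B (f r) by rewrite BO.
  by rewrite BC => -[].
have : P * Q * d = 0.
  apply/eqP; apply: contrapT => /negP/poly_nonroot[r].
  rewrite !hornerM !mulf_eq0 !negb_or => /andP[/andP[Pr Qr] rD].
  move: Pr Qr; rewrite -PE // -QE // !mulf_eq0 !negb_or => /andP[pr _] /andP[qr _].
  by have /eqP := PQ0 r rD; rewrite mulf_eq0 (negPf pr) (negPf qr).
move/eqP; rewrite !mulf_eq0 (negPf d0) orbF => /orP[] /eqP e0.
  have /eqP := PE s sD; rewrite e0 horner0 mulf_eq0 (negPf ps) expf_eq0.
  by rewrite (negPf sD) andbF.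
have /eqP := QE t tD; rewrite e0 horner0 mulf_eq0 tb (negPf qb) expf_eq0.
by rewrite (negPf tD) andbF.
Qed.

End RationalCurves.

(** * A Borel subgroup *)

Section Borel.
Local Open Scope classical_set_scope.
Local Open Scope ring_scope.
Variables (K : numClosedFieldType) (C : compAlg K).
Local Notation "x ** y" := (omul x y) (at level 40, left associativity).
Local Notation uno := (@oone K C).
Local Notation G := (@alg_aut K C).
Variables x y z : C.
Hypothesis bt : basic_triple x y z.
Local Notation nc := (@nb_coord K C x y z).
Local Notation nb := (nb x y z).
Implicit Types (u v w : C) (g h : 'End(C)) (H : set 'End(C)).

Let two : 2 != 0 :> K := two_neq0 K.
Let ii : 'i * 'i = -1 :> K := sqr_i K.

Definition nb_vec i : C := nb (i == 0%N)%:R (i == 1%N)%:R (i == 2%N)%:R (i == 3%N)%:R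
  (i == 4%N)%:R (i == 5%N)%:R (i == 6%N)%:R (i == 7%N)%:R.

Lemma nb_expand v :
  v = nb (nc 0%N v) (nc 1%N v) (nc 2%N v) (nc 3%N v) (nc 4%N v) (nc 5%N v) (nc 6%N v) (nc 7%N v).
Proof.
have [a0 [a1 [a2 [a3 [a4 [a5 [a6 [a7 ->]]]]]]]] := nb_surj bt v.
by rewrite !nb_coordE.
Qed.

Lemma nb_coord_vec i j : (i < 8)%N -> (j < 8)%N -> nc i (nb_vec j) = (i == j)%:R :> K.
Proof.
move=> i8 j8; rewrite nb_coordE //.
by case: i i8 => [|[|[|[|[|[|[|[|//]]]]]]]] _ /=; rewrite eq_sym.
Qed.

Lemma nb_sum (a : nat -> K) : \sum_(k < 8) a k *: nb_vec k =
  nb (a 0%N) (a 1%N) (a 2%N) (a 3%N) (a 4%N) (a 5%N) (a 6%N) (a 7%N).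
Proof.
rewrite !big_ord_recr big_ord0 /= /nb_vec /= !nbZ add0r !nbD.
by rewrite !(mulr0, mulr1, addr0, add0r).
Qed.

Lemma nb_expand_sum v : v = \sum_(k < 8) (nc k v : K) *: nb_vec k.
Proof. by rewrite (nb_sum (fun k => nc k v)) -nb_expand. Qed.

(** The inverse of an automorphism is its adjoint for [dot], which depends
    linearly on it. *)
Lemma aut_regular_inverse H : H `<=` G -> regular_inverse H.
Proof.
move=> HG; have nb_dualE w k : dot w (nb_dual x y z k) = nc k w by rewrite dot_formE.
pose J g : C -> C := fun v => \sum_(k < 8) dot v (g (nb_vec k)) *: nb_dual x y z k.
have JP g v w : dot (J g v) w = dot v (g w).
  rewrite [w in RHS]nb_expand_sum linear_sum /J.
  have suml (F : 'I_8 -> C) : dot (\sum_k F k) w = \sum_k dot (F k) w.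
    by apply: (big_morph (fun v => dot v w)) => [a b|]; rewrite ?dotDl ?dot0l.
  have sumr (F : 'I_8 -> C) : dot v (\sum_k F k) = \sum_k dot v (F k).
    by apply: (big_morph (dot v)) => [a b|]; rewrite ?dotDr ?dot0r.
  rewrite suml sumr; apply: eq_bigr => k _.
  by rewrite linearZ dotZl dotZr mulrC (dotC _ w) nb_dualE.
have /choice[Jl JlE] g : exists h : 'End(C), h =1 J g.
  apply: lfun_of_linear => a u v; apply: dot_inj => w.
  by rewrite dotDl dotZl !JP dotDl dotZl.
exists Jl => [|g gH].
  apply: vec_fun_linear => a g h; apply/lfunP => v.
  rewrite add_lfunE scale_lfunE !JlE; apply: dot_inj => w.
  by rewrite dotDl dotZl !JP add_lfunE scale_lfunE dotDr dotZr.
have gG := HG _ gH; have [g0 _ _] := gG.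
apply/lfunP => v; rewrite JlE; apply: dot_inj => w.
by rewrite JP -[v in RHS](lker0_lfunVK g0) (aut_dot gG).
Qed.

Local Notation F := (@flag K C nc).

Definition triangular_aut : set 'End(C) :=
  [set g | G g /\ forall k v, v \in F k -> g v \in F k].
Local Notation B := triangular_aut.

Lemma triangular_aut_group : linear_group B.
Proof.
have [G0 G1 GM GV] := alg_aut_group C.
split=> [g [/G0]//||f g [fG fF] [gG gF]|g [gG gF]].
- by split=> // k v; rewrite id_lfunE.
- by split=> [|k v vk]; [exact: GM | rewrite comp_lfunE; apply: fF; exact: gF].
split=> [|k v]; first exact: GV.
have gk : (g @: F k)%VS = F k.
  apply/eqP; rewrite eqEdim limg_dim_eq ?(eqP (G0 _ gG)) ?capv0 // leqnn andbT.
  by apply/subvP => _ /memv_imgP[w wk ->]; exact: gF.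
by rewrite -{1}gk => /memv_imgP[w wk ->]; rewrite lker0_lfunK // G0.
Qed.

Lemma triangular_aut_closed : closed_in (G : set (affine_space 'End(C))) B.
Proof.
exists [set g : 'End(C) | forall k v, v \in F k -> g v \in F k] => //.
rewrite (_ : [set g : 'End(C) | _] = \bigcap_(i in [set i : nat * C | i.2 \in F i.1])
    [set g : 'End(C) | g i.2 \in F i.1]).
  apply: closed_bigI => -[k v] _.
  apply: (@closed_subspace K 'End(C) C (fun g : 'End(C) => g v)).
  by apply: vec_fun_linear => a g h; rewrite add_lfunE scale_lfunE.
by apply/seteqP; split=> g /= h; [case=> k v /=; exact: h | move=> k v vk; exact: (h (k, v))].
Qed.

Lemma triangular_aut_solvable : solvable_group B.
Proof.
apply: (@triangular_solvable K C 8 nc nb_vec nb_coord_vec nb_expand_sum).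
  exact: triangular_aut_group.
by move=> k g [_ gF] v; exact: gF.
Qed.

Lemma aut_of_fun (f : C -> C) : (forall a u v, f (a *: u + v) = a *: f u + f v) ->
    f uno = uno -> (forall u v, f (u ** v) = f u ** f v) -> (forall u, f u = 0 -> u = 0) ->
  exists2 g, G g & g =1 f.
Proof.
move=> fl f1 fM f0; have [g gE] := lfun_of_linear fl.
exists g => //; split; [|by rewrite gE|by move=> u v; rewrite !gE].
by rewrite -subv0; apply/subvP => v; rewrite memv_ker memv0 gE => /eqP/f0 ->.
Qed.

Lemma nc_linear i a u v : nc i (a *: u + v) = a * (nc i u : K) + (nc i v : K) :> K.
Proof. by rewrite linearP. Qed.

(** The maximal torus; [nb_vec 1] and [nb_vec 2] have weights [p] and [q]. *)
Definition torus_weight (p q : K) := nth 0 [:: 1; p; q; p / q; 1; q / p; q^-1; p^-1].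

Lemma ex_torus p q : p != 0 -> q != 0 -> exists2 g, G g &
  forall v, g v = \sum_(k < 8) (torus_weight p q k * (nc k v : K)) *: nb_vec k.
Proof.
move=> p0 q0; apply: aut_of_fun => [a u v||u v|v].
- rewrite scaler_sumr -big_split; apply: eq_bigr => k _ /=.
  by rewrite nc_linear mulrDr scalerDl scalerA; congr (_ *: _ + _); rewrite mulrCA.
- rewrite -(nb1 x y z) (nb_sum (fun k => torus_weight p q k * (nc k _ : K))).
  by rewrite !nb_coordE //= !(mulr0, mulr1).
- have [a0 [a1 [a2 [a3 [a4 [a5 [a6 [a7 ->]]]]]]]] := nb_surj bt u.
  have [b0 [b1 [b2 [b3 [b4 [b5 [b6 [b7 ->]]]]]]]] := nb_surj bt v.
  rewrite !(nb_sum (fun k => torus_weight p q k * (nc k _ : K))) nb_mul //.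
  rewrite !nb_coordE //= nb_mul //.
  by rewrite /torus_weight /=; congr nb; field; rewrite ?p0 ?q0.
- have [a0 [a1 [a2 [a3 [a4 [a5 [a6 [a7 ->]]]]]]]] := nb_surj bt v.
  rewrite (nb_sum (fun k => torus_weight p q k * (nc k _ : K))) !nb_coordE //=.
  move/(nb_eq0 bt) => -[[e0 e1 e2 e3] [e4 e5 e6 e7]].
  have cancel (a b : K) : a != 0 -> a * b = 0 -> b = 0.
    by move=> a0' /eqP; rewrite mulf_eq0 (negPf a0') => /eqP.
  move: e0 e1 e2 e3 e4 e5 e6 e7.
  do 8! [move/cancel => ->; last by rewrite ?oner_neq0 ?mulf_neq0 ?invr_eq0].
  exact: nb0.
Qed.

(** The product of the exponentials of the two simple root vectors; the
    nonzero entries next to the diagonal are what [unipotent_step] extracts. *)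
Lemma ex_regular_unipotent : exists2 g, G g & forall a0 a1 a2 a3 a4 a5 a6 a7,
  g (nb a0 a1 a2 a3 a4 a5 a6 a7) = nb a0 a1 (a2 + a1) (a3 + a2) (a4 - 2 * 'i * (a3 + a2))
    (a5 + (a3 + a2) + 'i * a4) (a6 - a5) (a7 - (a6 - a5)).
Proof.
pose f a0 a1 a2 a3 a4 a5 a6 a7 := nb a0 a1 (a2 + a1) (a3 + a2) (a4 - 2 * 'i * (a3 + a2))
    (a5 + (a3 + a2) + 'i * a4) (a6 - a5) (a7 - (a6 - a5)).
have [||||g gG gE] := @aut_of_fun (fun v => f (nc 0%N v) (nc 1%N v) (nc 2%N v) (nc 3%N v)
    (nc 4%N v) (nc 5%N v) (nc 6%N v) (nc 7%N v)); rewrite /f; last first.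
- by exists g => // a0 a1 a2 a3 a4 a5 a6 a7; rewrite gE !nb_coordE.
- move=> v; have [a0 [a1 [a2 [a3 [a4 [a5 [a6 [a7 ->]]]]]]]] := nb_surj bt v.
  rewrite !nb_coordE //=.
  move/(nb_eq0 bt) => -[[-> -> e2 e3] [e4 e5 e6 e7]].
  move: e2; rewrite addr0 => e2; move: e3; rewrite e2 addr0 => e3.
  move: e4 e5; rewrite e2 e3 addr0 mulr0 subr0 => -> ; rewrite mulr0 !addr0 => e5.
  by move: e6 e7; rewrite e5 subr0 => ->; rewrite subr0 => ->; exact: nb0.
- move=> u v.
  have [a0 [a1 [a2 [a3 [a4 [a5 [a6 [a7 ->]]]]]]]] := nb_surj bt u.
  have [b0 [b1 [b2 [b3 [b4 [b5 [b6 [b7 ->]]]]]]]] := nb_surj bt v.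
  rewrite nb_mul // !nb_coordE //= nb_mul //.
  by congr nb; ring: ii.
- by rewrite -(nb1 x y z) !nb_coordE //= !(mulr0, addr0, subr0).
- move=> a u v; rewrite !nc_linear nbZ nbD; congr nb; ring.
Qed.

Lemma aut_coef i g v : nc i (g v) = \sum_(l < 8) (nc l v : K) * (nc i (g (nb_vec l)) : K) :> K.
Proof.
rewrite [v in LHS]nb_expand_sum !linear_sum; apply: eq_bigr => l _.
by rewrite !linearZ.
Qed.

Lemma triangularP g : (forall i j, (i < j)%N -> (j < 8)%N -> nc i (g (nb_vec j)) = 0) <->
  (forall k v, v \in F k -> g v \in F k).
Proof.
split=> [gt k v /flagP vk|gF i j ij j8].
  apply/flagP => j jk; have := aut_coef j g v => /= ->; apply: big1 => l _.
  have [lk|kl] := ltnP l k; first by rewrite vk ?mul0r.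
  by rewrite gt ?mulr0 // (leq_trans jk).
have ej : nb_vec j \in F j by apply: (flag_basis (N := 8)) => //; exact: nb_coord_vec.
by have /flagP := gF j _ ej; apply.
Qed.

Lemma lfun_eq_vec g h : (forall l, (l < 8)%N -> g (nb_vec l) = h (nb_vec l)) -> g = h.
Proof.
move=> gh; apply/lfunP => v; rewrite (nb_expand_sum v) !linear_sum.
by apply: eq_bigr => l _; rewrite !linearZ /= gh.
Qed.

Lemma ex_elem : exists E : nat -> nat -> 'End(C), forall i j v, E i j v = (nc j v : K) *: nb_vec i.
Proof.
have /choice[E EE] (ij : nat * nat) : exists g : 'End(C), forall v, g v = (nc ij.2 v : K) *: nb_vec ij.1.
  by apply: lfun_of_linear => a u v; rewrite nc_linear scalerDl scalerA.
by exists (fun i j => E (i, j)) => i j v; rewrite EE.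
Qed.

Lemma torus_triangular p q g : G g ->
  (forall v, g v = \sum_(k < 8) (torus_weight p q k * (nc k v : K)) *: nb_vec k) -> B g.
Proof.
move=> gG gE; split=> //; apply/triangularP => i j ij j8.
have i8 := ltn_trans ij j8.
rewrite gE (nb_sum (fun k => torus_weight p q k * (nc k (nb_vec j) : K))) nb_coordE //.
by case: i ij i8 => [|[|[|[|[|[|[|[|//]]]]]]]] ij _ /=;
  rewrite nb_coord_vec // ltn_eqF // mulr0.
Qed.

Lemma sum_vec_eq0 (a : nat -> K) l : (l < 8)%N -> (forall k, k != l -> a k = 0) ->
  \sum_(k < 8) a k *: nb_vec k = a l *: nb_vec l.
Proof.
move=> l8 h; rewrite (bigD1 (Ordinal l8)) //= big1 ?addr0 // => k kl.
by rewrite h ?scale0r.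
Qed.

(** Products and inner products of the null basis vectors express all
    eigenvalues by those of the first two isotropic vectors. *)
Lemma diagonal_torus g : G g -> (forall j, (j < 8)%N -> exists l : K, g (nb_vec j) = l *: nb_vec j) ->
  exists p q, [/\ p != 0, q != 0 &
    forall v, g v = \sum_(k < 8) (torus_weight p q k * (nc k v : K)) *: nb_vec k].
Proof.
move=> gG gd; pose l j : K := nc j (g (nb_vec j)).
have gl j : (j < 8)%N -> g (nb_vec j) = l j *: nb_vec j.
  move=> j8; have [m gm] := gd j j8; rewrite gm /l gm linearZ /=.
  by congr (_ *: _); rewrite nb_coord_vec // eqxx /GRing.scale /= mulr1.
have [_ g1 gM] := gG.
have dual i j : (i < 8)%N -> (j < 8)%N -> dot (nb_vec i) (nb_vec j) = 2 -> l i * l j = 1.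
  move=> i8 j8 e; apply: (mulIf two); rewrite mul1r -e.
  by rewrite -[in RHS](aut_dot gG) !gl // dotZl dotZr mulrA.
have l17 : l 1%N * l 7 = 1 by apply: dual => //; rewrite nb_dot //=; ring.
have l26 : l 2%N * l 6 = 1 by apply: dual => //; rewrite nb_dot //=; ring.
have l35 : l 3%N * l 5 = 1 by apply: dual => //; rewrite nb_dot //=; ring.
have prod i j k (c : K) : (i < 8)%N -> (j < 8)%N -> (k < 8)%N -> c != 0 ->
    nb_vec i ** nb_vec j = c *: nb_vec k -> l i * l j = l k.
  move=> i8 j8 k8 c0 e; have := congr1 (fun v => g v : C) e.
  rewrite gM linearZ /= !gl // omulZl omulZr e !scalerA => /(congr1 (fun v => nc k v : K)).
  rewrite !linearZ /= nb_coord_vec // eqxx /GRing.scale /= !mulr1 => h.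
  by apply: (mulIf c0); rewrite h mulrC.
have l23 : l 2%N * l 3%N = l 1%N.
  apply: (@prod 2 3 1 2) => //; rewrite /nb_vec /= nbZ nb_mul //.
  by congr nb; ring.
have l14 : l 1%N * l 4%N = l 1%N.
  apply: (@prod 1 4 1 (- 'i)) => //; first by rewrite oppr_eq0 neq0Ci.
  by rewrite /nb_vec /= nbZ nb_mul //; congr nb; ring.
have l0 : l 0%N = 1.
  rewrite /l (_ : nb_vec 0 = uno); last by rewrite -(nb1 x y z).
  by rewrite g1 -(nb1 x y z) nb_coordE.
have nz i j : l i * l j = 1 -> l i != 0 /\ l j = (l i)^-1.
  move=> e; have li : l i != 0 by apply: contraTneq (oner_neq0 K) => li; rewrite -e li mul0r eqxx.
  by split=> //; apply: (mulfI li); rewrite e divff.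
have [n1 e7] := nz _ _ l17; have [n2 e6] := nz _ _ l26; have [n3 e5] := nz _ _ l35.
have e4 : l 4%N = 1 by apply: (mulfI n1); rewrite l14 mulr1.
have e3 : l 3%N = l 1%N / l 2%N by apply: (mulfI n2); rewrite l23 mulrCA divff ?mulr1.
exists (l 1%N), (l 2%N); split=> // v.
rewrite [v in LHS]nb_expand_sum linear_sum; apply: eq_bigr => k _.
rewrite linearZ /= gl // scalerA mulrC; congr (_ * _ *: _).
case: k => -[|[|[|[|[|[|[|[|//]]]]]]]] ? //=.
by rewrite /torus_weight /= e5 e3 invf_div.
Qed.

Lemma regular_off_poly (d p : {poly K}) : regular_off d (horner p).
Proof. by exists p, 0%N => s _; rewrite expr0 mulr1. Qed.

Lemma vec_fun_sum (T : Type) (A : set (T -> K)) (V : vectType K) n (f : 'I_n -> T -> V) :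
  fun_algebra A -> (forall i, vec_fun A (f i)) -> vec_fun A (fun t => \sum_i f i t).
Proof.
move=> AP Af phi; apply: (fun_ext (g := fun t => \sum_i (phi (f i t) : K))) => [t|].
  by rewrite linear_sum.
by apply: (fun_sum AP) => i _; exact: Af.
Qed.

(** Both parameters of the torus are moved linearly to [1]. *)
Lemma torus_curve p q g : G g -> p != 0 -> q != 0 ->
    (forall v, g v = \sum_(k < 8) (torus_weight p q k * (nc k v : K)) *: nb_vec k) ->
  exists A : set (affine_space 'End(C)), [/\ connected A, A `<=` B, A \1%VF & A g].
Proof.
move=> gG p0 q0 gE; have [E EE] := ex_elem.
pose P : {poly K} := 1 + (p - 1) *: 'X; pose Q : {poly K} := 1 + (q - 1) *: 'X.
have PE s : P.[s] = 1 + (p - 1) * s by rewrite hornerD hornerZ hornerX hornerC.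
have QE s : Q.[s] = 1 + (q - 1) * s by rewrite hornerD hornerZ hornerX hornerC.
pose d := P * Q; pose f s : 'End(C) := \sum_(k < 8) torus_weight P.[s] Q.[s] k *: E k k.
have fE s v : f s v = \sum_(k < 8) (torus_weight P.[s] Q.[s] k * (nc k v : K)) *: nb_vec k.
  by rewrite sum_lfunE; apply: eq_bigr => k _; rewrite scale_lfunE EE scalerA.
have d00 : d.[0] != 0 by rewrite hornerM PE QE !mulr0 addr0 mulr1 oner_neq0.
have d10 : d.[1] != 0.
  by rewrite hornerM PE QE !mulr1 ![1 + _]addrC !subrK mulf_neq0.
have d0 : d != 0 by apply: contraNneq d00 => ->; rewrite horner0.
have freg : vec_fun (regular_off d) f.
  have dP := regular_off_algebra d.
  apply: (vec_fun_sum dP) => k; apply: (vec_fun_scale dP); last exact: (vec_fun_cst dP).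
  have ds s : d.[s] = P.[s] * Q.[s] by rewrite hornerM.
  have nz s : d.[s] != 0 -> P.[s] != 0 /\ Q.[s] != 0.
    by rewrite ds mulf_eq0 negb_or => /andP.
  rewrite /torus_weight; case: k => -[|[|[|[|[|[|[|[|//]]]]]]]] ? /=.
  - exact: (fun_cst dP).
  - exact: regular_off_poly.
  - exact: regular_off_poly.
  - by exists (P ^+ 2), 1%N => s /nz[Ps Qs]; rewrite ds horner_exp; field.
  - exact: (fun_cst dP).
  - by exists (Q ^+ 2), 1%N => s /nz[Ps Qs]; rewrite ds horner_exp; field.
  - by exists P, 1%N => s /nz[Ps Qs]; rewrite ds; field.
  - by exists Q, 1%N => s /nz[Ps Qs]; rewrite ds; field.
exists (f @` [set s | d.[s] != 0]); split.
- exact: rational_curve_connected.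
- move=> _ [s /= sD <-]; have [Ps Qs] : P.[s] != 0 /\ Q.[s] != 0.
    by move: sD; rewrite hornerM mulf_eq0 negb_or => /andP.
  have [h hG hE] := ex_torus Ps Qs.
  have -> : f s = h by apply/lfunP => v; rewrite fE hE.
  exact: torus_triangular hG hE.
- exists 0 => //; apply/lfunP => v; rewrite fE id_lfunE [RHS]nb_expand_sum.
  apply: eq_bigr => k _; congr (_ *: _); rewrite PE QE !mulr0 addr0.
  by case: k => -[|[|[|[|[|[|[|[|//]]]]]]]] ? /=; rewrite /torus_weight /= ?invr1 ?divr1 !mul1r.
- exists 1 => //; apply/lfunP => v; rewrite fE gE.
  by rewrite PE QE !mulr1 ![1 + _]addrC !subrK.
Qed.

(** A polynomial identity in [s] that holds for [s != 0] holds at [0]. *)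
Lemma regular_off1_zero (V : vectType K) (h : K -> V) : vec_fun (regular_off 1) h ->
  (forall s, s != 0 -> h s = 0) -> h 0 = 0.
Proof.
move=> hreg h0; rewrite (coord_vbasis (memvf (h 0))); apply: big1 => i _.
have [p [n pE]] := vec_fun_coord (vbasis {:V}) i hreg.
have pE' s : coord (vbasis {:V}) i (h s) = p.[s].
  by rewrite -pE hornerC ?oner_neq0 // expr1n mulr1.
suff p0 : p = 0 by rewrite pE' p0 horner0 scale0r.
have /eqP : p * 'X = 0.
  apply: poly_eq_horner => s; rewrite hornerM hornerX horner0.
  by have [->|/h0 hs] := eqVneq s 0; rewrite ?mulr0 // -pE' hs linear0 mul0r.
by rewrite mulf_eq0 polyX_eq0 orbF => /eqP.
Qed.

(** The entries of [f s] are those of [g], scaled by powers of [s] that come from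
    conjugation with a one-parameter subgroup of the torus; at [s = 0] only the
    diagonal survives. *)
Lemma scale_curve g : B g ->
  exists f : K -> 'End(C), [/\ vec_fun (regular_off 1) f, forall s, B (f s), f 1 = g
    & forall j, (j < 8)%N -> exists l : K, f 0 (nb_vec j) = l *: nb_vec j].
Proof.
move=> gB; have [E EE] := ex_elem.
pose c (g : 'End(C)) i j : K := nc i (g (nb_vec j)).
pose f (g : 'End(C)) s : 'End(C) :=
  \sum_(i < 8) \sum_(j < 8) (s ^+ (i - j) * c g i j) *: E i j.
have fE h s l : (l < 8)%N ->
    f h s (nb_vec l) = \sum_(i < 8) (s ^+ (i - l) * c h i l) *: nb_vec i.
  move=> l8; rewrite sum_lfunE; apply: eq_bigr => i _; rewrite sum_lfunE.
  rewrite (bigD1 (Ordinal l8)) //= big1 => [|j jl].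
    by rewrite scale_lfunE EE nb_coord_vec // eqxx scale1r addr0.
  have jl' : (j == l :> nat) = false := negPf jl.
  by rewrite scale_lfunE EE nb_coord_vec // jl' scale0r scaler0.
have dP := @regular_off_algebra K 1.
have freg h : vec_fun (regular_off 1) (f h).
  apply: (vec_fun_sum dP) => i; apply: (vec_fun_sum dP) => j.
  apply: (vec_fun_scale dP); last exact: (vec_fun_cst dP).
  apply: (fun_mul dP); last exact: (fun_cst dP).
  by apply: (fun_ext (g := horner 'X^(i - j))) => [s|]; [rewrite hornerXn | exact: regular_off_poly].
have ctri h i j : B h -> (i < j)%N -> (j < 8)%N -> c h i j = 0.
  by case=> _ /triangularP; exact.
have ftri h s : B h -> forall k v, v \in F k -> f h s v \in F k.
  move=> hB; apply/triangularP => i j ij j8; have i8 := ltn_trans ij j8.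
  rewrite fE // (nb_sum (fun i => s ^+ (i - j) * c h i j)) nb_coordE //.
  by case: i ij i8 => [|[|[|[|[|[|[|[|//]]]]]]]] ij _ /=; rewrite ctri ?mulr0.
have f1 h : f h 1 = h.
  apply: lfun_eq_vec => l l8; rewrite fE // [RHS]nb_expand_sum.
  by apply: eq_bigr => i _; rewrite expr1n mul1r.
(* The torus element [t] multiplies the [i]-th vector, [i > 0], by [s^(i - 4)], so
   that conjugation with it multiplies the entry [c h i j] by [s^(i - j)]. *)
have conj s : s != 0 -> exists2 t, B t & forall h, B h -> forall v, f h s (t v) = t (h v).
  move=> s0; have [||t tG tE] := @ex_torus (s^-1 ^+ 3) (s^-1 ^+ 2); rewrite ?expf_neq0 ?invr_eq0 //.
  exists t; first exact: torus_triangular tG tE.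
  move=> h hB v; have [hG hF] := hB.
  pose w i : K := torus_weight (s^-1 ^+ 3) (s^-1 ^+ 2) i.
  have tvec l : (l < 8)%N -> t (nb_vec l) = w l *: nb_vec l.
    move=> l8; rewrite tE (@sum_vec_eq0 (fun k => w k * (nc k (nb_vec l) : K)) l) //.
      by rewrite nb_coord_vec // eqxx mulr1.
    move=> k kl; rewrite /w /torus_weight; have [k8|k8] := ltnP k 8; last by rewrite nth_default ?mul0r.
    by rewrite nb_coord_vec // (negPf kl) mulr0.
  have wE i : (0 < i)%N -> (i < 8)%N -> w i = s ^+ i.-1 * s^-1 ^+ 3.
    rewrite /w /torus_weight.
    by case: i => [|[|[|[|[|[|[|[|//]]]]]]]] //= _ _; field; rewrite s0.
  have ft : (f h s \o t)%VF = (t \o h)%VF; last by rewrite -!comp_lfunE ft.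
  apply: lfun_eq_vec => l l8; rewrite !comp_lfunE tvec // linearZ /= fE //.
  rewrite scaler_sumr [h _]nb_expand_sum linear_sum; apply: eq_bigr => i _.
  have tZ (a : K) u : t (a *: u) = a *: t u by rewrite linearZ.
  rewrite [RHS](tZ _ _) tvec // !scalerA -/(c h i l); congr (_ *: _).
  have [il|li] := ltnP i l; first by rewrite (ctri h) // !(mulr0, mul0r).
  have [l0|l0] := posnP l.
    have c0 : c h i l = (i == 0%N :> nat)%:R.
      have [_ h1 _] := hG; rewrite /c l0 (_ : nb_vec 0 = uno); last by rewrite -(nb1 x y z).
      by rewrite h1 -[uno](nb1 x y z) -/(nb_vec 0) nb_coord_vec.
    rewrite c0 l0; case: eqP => [->|_]; last by rewrite !(mulr0, mul0r).
    by rewrite subnn expr0 /w /torus_weight /= !mulr1.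
  rewrite !wE ?(leq_trans l0) // [RHS]mulrC mulrA; congr (_ * _).
  rewrite mulrAC -exprD; congr (s ^+ _ * _); lia.
have gVB : B (g^-1)%VF := group_inv triangular_aut_group gB.
have [[g0 g1 gM] gF] := gB.
have fB s : s != 0 -> B (f g s).
  move=> s0; have [t tB ft] := conj s s0; have tP := triangular_aut_group.
  rewrite (_ : f g s = t \o g \o t^-1)%VF.
    by apply: (group_comp tP); [exact: (group_comp tP) | exact: (group_inv tP)].
  apply/lfunP => v; rewrite !comp_lfunE /= -(ft g gB); congr (f g s _).
  by rewrite (group_Kinv tP).
have frv v : vec_fun (regular_off 1) (fun s => f g s v).
  apply: (vec_fun_bilinear dP (b := fun (h : 'End(C)) (v : C) => h v) _ _ (freg g) (vec_fun_cst dP v)).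
    by move=> a h1 h2 u; rewrite add_lfunE scale_lfunE.
  by move=> a u1 u2 h; rewrite linearP.
(* The conditions on an automorphism pass to the limit [s = 0]; invertibility does
   because the curve of the inverse of [g] has a limit as well. *)
have f0 : B (f g 0).
  split; last exact: ftri.
  split.
  - have inv v : f (g^-1)%VF 0 (f g 0 v) = v.
      apply/subr0_eq; apply: (@regular_off1_zero _ (fun s => f (g^-1)%VF s (f g s v) - v)).
        apply: (vec_fun_add dP); last exact: (vec_fun_cst dP).
        apply: (vec_fun_bilinear dP (b := fun (h : 'End(C)) (v : C) => h v) _ _ (freg _) (frv v)).
          by move=> a h1 h2 u; rewrite add_lfunE scale_lfunE.
        by move=> a u1 u2 h; rewrite linearP.
      move=> s s0; have [t tB ft] := conj s s0; have tP := triangular_aut_group.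
      rewrite -{1}(group_Kinv tP v tB) ft // ft // lker0_lfunK // (group_Kinv tP) //.
      exact: subrr.
    by apply/lker0P => u v e; rewrite -(inv u) e inv.
  - apply/subr0_eq; apply: (@regular_off1_zero _ (fun s => f g s uno - uno)).
      by apply: (vec_fun_add dP); [exact: frv | exact: (vec_fun_cst dP)].
    by move=> s /fB[[_ -> _] _]; rewrite subrr.
  - move=> u v; apply/subr0_eq.
    apply: (@regular_off1_zero _ (fun s => f g s (u ** v) - f g s u ** f g s v)).
      apply: (vec_fun_add dP); first exact: frv.
      apply: (vec_fun_opp dP).
      apply: (vec_fun_bilinear dP (b := fun u v : C => u ** v) _ _ (frv u) (frv v)).
        by move=> a u1 u2 w; rewrite omulDl omulZl.
      by move=> a u1 u2 w; rewrite omulDr omulZr.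
    by move=> s /fB[[_ _ ->] _]; rewrite subrr.
exists (f g); split=> // [s|j j8]; first by have [->|/fB] := eqVneq s 0.
exists (c g j j); rewrite fE // (@sum_vec_eq0 (fun i => 0 ^+ (i - j) * c g i j) j) //.
  by rewrite subnn expr0 mul1r.
move=> k; rewrite neq_ltn => /orP[kj|jk]; first by rewrite ctri ?mulr0.
by rewrite expr0n subn_eq0 leqNgt jk mul0r.
Qed.

(** Every element is joined by [scale_curve] to the torus, and from there by
    [torus_curve] to the identity. *)
Lemma triangular_aut_connected : connected (B : set (affine_space 'End(C))).
Proof.
have B1 : B \1%VF := group_id triangular_aut_group.
have /choice[A AP] g : exists A : set (affine_space 'End(C)),
    B g -> [/\ connected A, A `<=` B, A \1%VF & A g].
  have [gB|gB] := pselect (B g); last by exists set0.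
  have [f [freg fB f1 fd]] := scale_curve gB.
  have [p [q [p0 q0 fE]]] := diagonal_torus (fB 0).1 fd.
  have [A [cA AB A1 Ag]] := torus_curve (fB 0).1 p0 q0 fE.
  pose D : set (affine_space 'End(C)) := f @` [set s | (1 : {poly K}).[s] != 0].
  have Df s : D (f s) by exists s => //=; rewrite hornerC oner_neq0.
  exists (A `|` D) => _; split; [|by move=> h [/AB//|[s _ <-]]|by left|right].
    apply: (@connected_setU (affine_space 'End(C)) A D (f 0)) => //.
    by apply: rational_curve_connected => //; exact: oner_neq0.
  by rewrite -f1.
have -> : (B : set (affine_space 'End(C))) = \bigcup_(g in B) A g.
  apply/seteqP; split=> [g gB|h [g /AP[_ AB _ _]]]; last exact: AB.
  by exists g => //; case: (AP g gB).
apply: bigcup_connected => [|g /AP[]//].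
by exists \1%VF => g /AP[].
Qed.

Lemma flag1 : F 1 = im C.
Proof.
apply/vspaceP => v; rewrite mem_im.
have e : nc 0%N v = dot uno v :> K.
  by rewrite dot_formE /nb_dual /= (nb1 x y z) dotC.
apply/flagP/eqP => [/(_ 0%N isT) h|h [|//] _]; first by rewrite -e h.
by apply/eqP; rewrite -[_ == _]/(nc 0%N v == 0 :> K) e h.
Qed.

(** On the quotient of [F j] by [F j.+2] the regular unipotent element is a
    nontrivial Jordan block. *)
Lemma unipotent_step g : (forall a0 a1 a2 a3 a4 a5 a6 a7,
    g (nb a0 a1 a2 a3 a4 a5 a6 a7) = nb a0 a1 (a2 + a1) (a3 + a2) (a4 - 2 * 'i * (a3 + a2))
    (a5 + (a3 + a2) + 'i * a4) (a6 - a5) (a7 - (a6 - a5))) ->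
  forall j v, (0 < j)%N -> (j < 7)%N -> v \in F j ->
    nc j (g v) = nc j v :> K /\ exists2 c : K, c != 0 &
    nc j.+1 (g v) = (nc j.+1 v : K) + c * (nc j v : K) :> K.
Proof.
move=> gE j v j0 j7 /flagP vj; have neg1 : (-1 : K) != 0 by rewrite oppr_eq0 oner_eq0.
have [a0 [a1 [a2 [a3 [a4 [a5 [a6 [a7 vE]]]]]]]] := nb_surj bt v.
have vz i : (i < j)%N -> [:: a0; a1; a2; a3; a4; a5; a6; a7]`_i = 0.
  move=> ij; have := vj i ij; rewrite vE nb_coordE //.
  by rewrite (ltn_trans ij) // (ltn_trans j7).
rewrite vE gE !nb_coordE ?(ltn_trans j7) //.
case: j j0 j7 vz {vj} => [|[|[|[|[|[|[|//]]]]]]] //= _ _ vz.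
- by split=> //; exists 1; rewrite ?oner_neq0 ?mul1r.
- have /= -> := vz 1%N isT; split; first by rewrite addr0.
  by exists 1; rewrite ?oner_neq0 ?mul1r.
- have /= -> := vz 2%N isT; split; first by rewrite addr0.
  exists (- (2 * 'i)); first by rewrite oppr_eq0 mulf_neq0 ?neq0Ci.
  by rewrite addr0 mulNr.
- have /= -> := vz 3%N isT; have /= -> := vz 2%N isT; split; first by rewrite addr0 mulr0 subr0.
  by exists 'i; rewrite ?neq0Ci // !addr0.
- have /= -> := vz 4%N isT; have /= -> := vz 3%N isT; have /= -> := vz 2%N isT.
  split; first by rewrite mulr0 !addr0.
  by exists (-1) => //; rewrite mulN1r.
- have /= -> := vz 5%N isT; split; first by rewrite subr0.
  by exists (-1) => //; rewrite subr0 mulN1r.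
Qed.

(** By Lie-Kolchin, a connected solvable group stabilizes a line of
    [im C / F k], if it stabilizes [F k]. When the group contains the regular unipotent
    element, this line is [F k.-1 / F k] by [unipotent_step], so that starting
    from [F 8 = 0] the group stabilizes the whole flag. *)
Lemma triangular_aut_maximal H : connected_solvable_subgroup (G : set 'End(C)) H ->
  B `<=` H -> H = B.
Proof.
case=> HG [D cD HD] cH [n Hn] BH.
have HsubG : H `<=` G by rewrite [H]HD => g [].
have [u uG uE] := ex_regular_unipotent.
have step := unipotent_step uE.
have uB : B u.
  split=> //; apply/triangularP => i j ij j8; have i8 := ltn_trans ij j8.
  rewrite /nb_vec uE nb_coordE //.
  move: j ij j8; case: i i8 => [|[|[|[|[|[|[|[|//]]]]]]]] _ [|[|[|[|[|[|[|[|//]]]]]]]] //= _ _;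
    by rewrite ?(addr0, subr0, mulr0).
(* Let [j] be the first nonzero coordinate of [v]. If [j < k.-1], comparing the
   coordinates [j] and [j.+1] of [u v] and [c *: v] is contradictory. *)
have key k v c : (k <= 8)%N -> v \in F 1 -> v \notin F k -> u v - c *: v \in F k -> v \in F k.-1.
  move=> k8 v1 vk uv.
  have [j0 j0k vj0] : exists2 j, (j < k)%N & nc j v != 0.
    apply: contrapT => h; case/negP: vk; apply/flagP => j jk.
    by apply: contrapT => /eqP e; apply: h; exists j.
  have exj : exists j, (j < k)%N && (nc j v != 0) by exists j0; rewrite j0k.
  have [j /andP[jk vj] jmin] := ex_minnP exj.
  have vFj : v \in F j.
    apply/flagP => i ij; apply/eqP; apply: contraT => vi.
    by have := jmin i; rewrite vi (ltn_trans ij jk) leqNgt ij => /(_ isT).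
  have [jk1|jk1] := leqP k.-1 j; first by apply: (subvP _ _ vFj); exact: flagS.
  have j1 : (0 < j)%N.
    by case: (j) vj => // /eqP; case; move/flagP: v1 => /(_ 0%N isT).
  have jk2 : (j.+1 < k)%N by rewrite -ltn_predRL.
  have [e1 [d d0 e2]] := step j v j1 (leq_trans jk2 k8) vFj.
  move/flagP: uv => uv.
  have ncB i' w w' : nc i' (w - c *: w') = (nc i' w : K) - c * (nc i' w' : K) :> K.
    by rewrite linearB linearZ.
  have h1 : (1 - c) * (nc j v : K) = 0 by rewrite mulrBl mul1r -{1}e1 -ncB; exact: uv.
  have h2 : (nc j.+1 v : K) + d * (nc j v : K) - c * (nc j.+1 v : K) = 0.
    by rewrite -e2 -ncB; exact: uv.
  move/eqP: h1; rewrite mulf_eq0 (negPf vj) orbF subr_eq0 => /eqP c1.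
  by move: h2; rewrite -c1 mul1r addrC addKr => /eqP; rewrite mulf_eq0 (negPf d0) (negPf vj).
have H1 : preserves H (F 1).
  by move=> g /HsubG gG v; rewrite flag1 (aut_im gG).
have HF m : forall k, (k + m = 8)%N -> preserves H (F k).
  elim: m => [|m IHm] k.
    rewrite addn0 => -> g _ v; rewrite (flag_full nb_expand_sum) // memv0 => /eqP ->.
    by rewrite linear0 mem0v.
  rewrite addnS -addSn => km; have HW := IHm _ km.
  case: k km HW => [|k] km HW; first by move=> g _ v _; apply/flagP.
  have k8 : (k.+1 < 8)%N by rewrite -km leq_addr.
  have [|||||||||v [v1 vk vc]] := @lie_kolchin K C n H (F 1) (F k.+2) (nb_vec k.+1).
  - exact: HG.
  - exact: cH.
  - exact: aut_regular_inverse.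
  - exact: Hn.
  - exact: H1.
  - exact: HW.
  - exact: flagS.
  - by apply: (subvP (flagS nc (isT : (1 <= k.+1)%N))); apply: (flag_basis nb_coord_vec).
  - apply/negP => /flagP/(_ k.+1 (ltnSn _)); rewrite nb_coord_vec // eqxx.
    by move/eqP; rewrite oner_eq0.
  have [c uv] := vc u (BH _ uB).
  have vF : v \in F k.+1 by exact: key k8 v1 vk uv.
  have vk0 : (nc k.+1 v : K) != 0.
    apply: contraNneq vk => vk0; apply/flagP => i; rewrite ltnS leq_eqVlt.
    by case/orP => [/eqP -> //|ik]; move/flagP: vF; apply.
  move=> g gH w wF; pose a : K := (nc k.+1 w : K) / (nc k.+1 v : K).
  have w'F : w - a *: v \in F k.+2.
    have ncB i : nc i (w - a *: v) = (nc i w : K) - a * (nc i v : K) :> K.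
      by rewrite linearB linearZ.
    apply/flagP => i; rewrite ltnS leq_eqVlt => /orP[/eqP ->|ik].
      by rewrite -[LHS]/(nc k.+1 (w - a *: v) : K) ncB /a divfK // subrr.
    move/flagP: wF => /(_ i ik) wi; move/flagP: vF => /(_ i ik) vi.
    by rewrite -[LHS]/(nc i (w - a *: v) : K) ncB wi vi mulr0 subrr.
  have [c' gv] := vc g gH.
  have sub := subvP (flagS nc (leqnSn k.+1)).
  have gvF : g v \in F k.+1.
    by rewrite -(subrK (c' *: v) (g v)) rpredD ?memvZ //; exact: sub.
  have gE : g w = g (w - a *: v) + a *: g v by rewrite -linearZ -linearD subrK.
  by rewrite gE rpredD ?memvZ //; apply: sub; exact: HW w'F.
apply/seteqP; split=> [g gH|]; last exact: BH.
split=> [|k v vk]; first exact: HsubG.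
have [k8|k8] := leqP k 8; first by apply: (HF (8 - k)%N) gH _ vk; rewrite subnKC.
by move: vk; rewrite (flag_full nb_expand_sum) 1?ltnW // memv0 => /eqP ->; rewrite linear0 mem0v.
Qed.

Theorem triangular_aut_borel : borel_subgroup (G : set 'End(C)) B.
Proof.
split; last exact: triangular_aut_maximal.
split; [exact: triangular_aut_group | exact: triangular_aut_closed
  | exact: triangular_aut_connected | exact: triangular_aut_solvable].
Qed.

End Borel.

(** * The dense orbit of the Borel subgroup *)

Section Projection.
Local Open Scope ring_scope.
Variables (K : numClosedFieldType) (C : compAlg K).
Local Notation "x ** y" := (omul x y) (at level 40, left associativity).
Local Notation uno := (@oone K C).
Implicit Types (u v w t s : C).

Definition gram u v : K := dot u u * dot v v - dot u v ^+ 2.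

(** [gram u v] times the orthogonal projection to [<u, v, cross u v>]. *)
Definition scaled_proj u v t : C :=
  (dot t u * dot v v - dot t v * dot u v) *: u +
  (dot t v * dot u u - dot t u * dot u v) *: v + dot t (cross u v) *: cross u v.

Lemma scaled_projE u v t s : dot uno u = 0 -> dot uno v = 0 ->
  s \in <<[:: u; v; cross u v]>>%VS -> dot (scaled_proj u v t) s = gram u v * dot t s.
Proof.
move=> u1 v1 /memv_span3[p [q [r ->]]].
have w1 : dot uno (cross u v) = 0 by apply: imP; exact: cross_im.
have uw : dot u (cross u v) = 0 by exact: dot_cross.
have vw : dot v (cross u v) = 0.
  by have := dot_cross v1 u1; rewrite (cross_anti u1 v1) dotNr => /eqP; rewrite oppr_eq0 => /eqP.
have ww := norm_cross u1 v1.
rewrite /scaled_proj !(dotDl, dotZl) !(dotDr, dotZr) (dotC v u) (dotC (cross u v) u).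
rewrite (dotC (cross u v) v) uw vw ww /gram; ring.
Qed.

Lemma mem_scaled_proj u v t : scaled_proj u v t \in <<[:: u; v; cross u v]>>%VS.
Proof.
apply/memv_span3; rewrite /scaled_proj.
by do 3! eexists.
Qed.

(** This polynomial in [u], [v] does not vanish when the span of [u], [v],
    [cross u v] is nondegenerate and the projections of [n], [m] to it span a
    nondegenerate plane, the first one being anisotropic. *)
Definition genericity u v n m : K :=
  gram u v * dot (scaled_proj u v n) (scaled_proj u v n) *
  gram (scaled_proj u v n) (scaled_proj u v m).

(** Normalizing the projection [a] of [n] gives [x]; the remainder [n - a] is
    perpendicular to the space and gives [z]; and Gram-Schmidt applied to the
    projection [b] of [m] gives [y]. The null vector [n] is then the last
    vector of the null basis up to a factor, and [n ** m = 0] together with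
    the known projection of [m] leaves [m] only its last two coordinates. *)
Lemma adapted_triple u v n m : dot uno u = 0 -> dot uno v = 0 -> free [:: u; v; cross u v] ->
    dot uno n = 0 -> dot uno m = 0 -> dot n n = 0 -> n ** m = 0 -> genericity u v n m != 0 ->
  exists x y z, [/\ basic_triple x y z, <<[:: u; v; cross u v]>>%VS = nondeg_space x y z,
    exists2 r, r != 0 & n = nb x y z 0 0 0 0 0 0 0 r &
    exists c6 c7, c6 != 0 /\ m = nb x y z 0 0 0 0 0 0 c6 c7].
Proof.
move=> u1 v1 fr n1 m1 nn nm; rewrite /genericity !mulf_eq0 !negb_or.
set U := <<_>>%VS; set D := gram u v => /andP[/andP[D0 An0] Gr0].
have U1 s : s \in U -> dot uno s = 0.
  case/memv_span3 => [p [q [r ->]]]; rewrite !(dotDr, dotZr) u1 v1 (imP (cross_im _ _)).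
  by rewrite !mulr0 !addr0.
have proj t : exists a, [/\ a \in U, scaled_proj u v t = D *: a & forall s, s \in U -> dot a s = dot t s].
  exists (D^-1 *: scaled_proj u v t); split.
  - by rewrite memvZ // mem_scaled_proj.
  - by rewrite scalerA divff // scale1r.
  - by move=> s sU; rewrite dotZl scaled_projE // -/D mulKf.
have [a [aU nE aE]] := proj n; have [b [bU mE bE]] := proj m.
have qa0 : dot a a != 0.
  by apply: contraNneq An0 => e; rewrite nE dotZl dotZr e !mulr0.
have ab0 : gram a b != 0.
  apply: contraNneq Gr0 => e; rewrite nE mE.
  have gramZ d s t : gram (d *: s) (d *: t) = d ^+ 4 * gram s t.
    by rewrite /gram !dotZl !dotZr; ring.
  by rewrite gramZ e mulr0.
have {nE mE} ii : 'i * 'i = -1 :> K := sqr_i K; have i0 : 'i != 0 :> K := neq0Ci K.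
have root (q : K) : q != 0 -> exists2 r, r != 0 & r * r = q.
  by move=> q0; exists (sqrtC q); rewrite ?sqrtC_eq0 // -expr2 sqrtCK.
have [r r0 rr] := root _ qa0.
have [x [xU xx rx xE]] : exists x, [/\ x \in U, dot x x = 1, r *: x = a
    & forall t, dot x t = r^-1 * dot a t].
  exists (r^-1 *: a); split; first by rewrite memvZ.
  - by rewrite dotZl dotZr -rr; field.
  - by rewrite scalerA divff // scale1r.
  - by move=> t; rewrite dotZl.
have [z [zU z1 zz irz]] : exists z, [/\ forall s, s \in U -> dot z s = 0, dot uno z = 0,
    dot z z = 1 & ('i * r) *: z = n - a].
  have ir0 : 'i * r != 0 by rewrite mulf_neq0.
  have irr : 'i * r * ('i * r) = 0 - r * r by ring: ii.
  exists (('i * r)^-1 *: (n - a)); split.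
  - by move=> s sU; rewrite dotZl dotDl dotNl aE // subrr mulr0.
  - by rewrite dotZr dotDr dotNr n1 (U1 _ aU) subrr mulr0.
  - rewrite dotZl dotZr dotDl !dotDr !dotNl !dotNr nn (dotC n a) (aE a aU) opprK (dotC n).
    rewrite (dotC a n) -(aE a aU) addNr addr0 -rr -irr.
    by move: ('i * r) ir0 => q q0; field.
  - by rewrite scalerA divff ?scale1r.
have x1 := U1 _ xU.
have [y0 [y0U y0x y0E bxE]] : exists y0, [/\ y0 \in U, dot x y0 = 0,
    dot a a * dot y0 y0 = gram a b & b = y0 + dot x b *: x].
  have y0x : dot x (b - dot x b *: x) = 0 by rewrite dotDr dotNr dotZr xx mulr1 subrr.
  exists (b - dot x b *: x); split=> //; last by rewrite subrK.
    by rewrite rpredB // memvZ.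
  rewrite dotDl dotNl dotZl y0x mulr0 subr0 dotDr dotNr dotZr (dotC b x) xE /gram -rr.
  by field.
have yy0 : dot y0 y0 != 0 by apply: contraNneq ab0 => e; rewrite -y0E e mulr0.
have [c c0 cc] := root _ yy0.
have [y [yU xy yy cy]] : exists y, [/\ y \in U, dot x y = 0, dot y y = 1 & c *: y = y0].
  exists (c^-1 *: y0); split; first by rewrite memvZ.
  - by rewrite dotZr y0x mulr0.
  - by rewrite dotZl dotZr -cc; field.
  - by rewrite scalerA divff // scale1r.
have y1 := U1 _ yU.
have kU : x ** y \in U.
  have <- : cross x y = x ** y by rewrite crossE // xy scale0r addr0.
  exact: cross_closed_span.
have bt : basic_triple x y z.
  split; first by split.
  by split; split=> //; rewrite dotC zU.
have nE : n = nb x y z 0 0 0 0 0 0 0 r.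
  rewrite /nb !(add0r, subr0, oppr0, mulr0, scale0r, addr0) rx irz.
  by rewrite addrC subrK.
exists x, y, z; split=> //.
- by apply: span3_eq => //; [exact: eqnP fr | exact: basic_pair_free].
- by exists r.
have mI : m \in im C by rewrite mem_im m1.
have [m1' [m2' [m3' [m4' [m5' [m6' [m7' mE]]]]]]] := nb_im_surj bt mI.
move: nm; rewrite nE mE nb_mul // => /(nb_eq0 bt) [[e0 _ _ _] [_ e5 e6 e7]].
have cancel (d e : K) : d != 0 -> d * e = 0 -> e = 0.
  by move=> d0 /eqP; rewrite mulf_eq0 (negPf d0) => /eqP.
have two : 2 != 0 :> K := two_neq0 K.
have h1 : m1' = 0.
  apply: (cancel (2 * r)); first by rewrite mulf_neq0.
  by apply: (lincomb1 (c := -1)) e0 _; ring.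
have h2 : m2' = 0.
  apply: (cancel (2 * r)); first by rewrite mulf_neq0.
  by apply: (lincomb1 (c := 1)) e5 _; ring.
have h3 : m3' = 0.
  apply: (cancel (2 * r)); first by rewrite mulf_neq0.
  by apply: (lincomb1 (c := -1)) e6 _; ring.
have h4 : m4' = 0.
  apply: (cancel ('i * r)); first by rewrite mulf_neq0.
  by apply: (lincomb1 (c := 1)) e7 _; ring.
move: mE; rewrite h1 h2 h3 h4 => mE.
have [k1 kx ky kk] := basic_pair_table x1 y1 xy xx yy.
pose h : K := 2^-1; have hh : 2 * h = 1 by rewrite divff.
have hh2 : h + h = 1 by rewrite -hh; ring.
have kE : x ** y = nb x y z 0 0 0 h 0 h 0 0.
  by rewrite /nb !(add0r, subr0, subrr, oppr0, mulr0, scale0r, addr0) hh2 scale1r.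
have yE : y = nb x y z 0 0 h 0 0 0 h 0.
  by rewrite /nb !(add0r, subr0, subrr, oppr0, mulr0, scale0r, addr0) hh2 scale1r.
have m5 : m5' = 0.
  have : dot m (x ** y) = 0 by rewrite -bE // bxE -cy dotDl !dotZl kx ky !mulr0 addr0.
  rewrite kE mE nb_dot // => e; apply: (lincomb2 (c := - m5') (d := 1)) hh e _; ring.
have m6 : m6' = c.
  have : dot m y = c by rewrite -bE // bxE -cy dotDl !dotZl yy xy mulr0 addr0 mulr1.
  rewrite {1}yE mE nb_dot // => e; apply: (lincomb2 (c := - m6') (d := 1)) hh e _; ring.
by exists c, m7'; rewrite c0 m5 m6.
Qed.

End Projection.

Section DenseOrbit.
Local Open Scope classical_set_scope.
Local Open Scope ring_scope.
Variables (K : numClosedFieldType) (C : compAlg K).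
Local Notation "x ** y" := (omul x y) (at level 40, left associativity).
Local Notation uno := (@oone K C).
Local Notation G := (@alg_aut K C).
Local Notation X := (@subalg_variety K C).
Variables x y z : C.
Hypothesis bt : basic_triple x y z.
Local Notation nc := (@nb_coord K C x y z).
Local Notation F := (@flag K C nc).
Local Notation vec := (nb_vec x y z).
Local Notation B := (triangular_aut x y z).
Implicit Types (u v w : C) (g h : 'End(C)).

(** The flag is determined by its line and its plane: [F 5] is the annihilator of
    the line, and the remaining spaces are orthogonal complements. *)
Lemma aut_triangular g : G g -> g (vec 7) \in F 7 -> g (vec 6) \in F 6 -> B g.
Proof.
move=> gG g7 g6; split=> //.
have e8 : forall v, v = \sum_(k < 8) (nc k v : K) *: vec k := nb_expand_sum bt.
have F7E v : v \in F 7 -> v = (nc 7 v : K) *: vec 7.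
  move=> v7; apply/subr0_eq/eqP; rewrite -memv0 -(flag_full e8 (leqnn 8)).
  by apply: (flag_step (N := 8)) => //; exact: nb_coord_vec.
have F7 v : v \in F 7 -> g v \in F 7 by move=> /F7E ->; rewrite linearZ memvZ.
have F67 : (F 7 <= F 6)%VS by exact: flagS.
have F6 v : v \in F 6 -> g v \in F 6.
  move=> v6; have v7 : v - (nc 6 v : K) *: vec 6 \in F 7.
    by apply: (flag_step (N := 8)) => //; exact: nb_coord_vec.
  have gE : g v = g (v - (nc 6 v : K) *: vec 6) + (nc 6 v : K) *: g (vec 6).
    by rewrite -linearZ -linearD subrK.
  by rewrite gE rpredD ?memvZ //; apply: (subvP F67); exact: F7.
have [g0 g1 gM] := gG.
have im1 v : (v \in F 1) = (v \in im C) by rewrite flag1.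
have F5P v : v \in im C -> (v \in F 5 <-> vec 7 ** v = 0).
  move=> vI; have [a1 [a2 [a3 [a4 [a5 [a6 [a7 ->]]]]]]] := nb_im_surj bt vI.
  have two : 2 != 0 :> K := two_neq0 K; have i0 : 'i != 0 :> K := neq0Ci K.
  have cancel (d e : K) : d != 0 -> d * e = 0 -> e = 0.
    by move=> d0 /eqP; rewrite mulf_eq0 (negPf d0) => /eqP.
  split=> [/flagP h|].
    have nc0 i : (i < 5)%N -> nc i (nb x y z 0 a1 a2 a3 a4 a5 a6 a7) = 0 :> K by exact: h.
    have /= e1 := nc0 1%N isT; have /= e2 := nc0 2%N isT; have /= e3 := nc0 3%N isT.
    have /= e4 := nc0 4%N isT; move: e1 e2 e3 e4; rewrite !nb_coordE //= => -> -> -> ->.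
    by rewrite /nb_vec /= nb_mul // -[RHS](nb0 x y z); congr nb; ring.
  rewrite /nb_vec /= nb_mul // => /(nb_eq0 bt) [[e0 _ _ _] [_ e5 e6 e7]].
  have h1 : a1 = 0 by apply: (cancel 2) => //; apply: (lincomb1 (c := -1)) e0 _; ring.
  have h2 : a2 = 0 by apply: (cancel 2) => //; apply: (lincomb1 (c := 1)) e5 _; ring.
  have h3 : a3 = 0 by apply: (cancel 2) => //; apply: (lincomb1 (c := -1)) e6 _; ring.
  have h4 : a4 = 0 by apply: (cancel 'i) => //; apply: (lincomb1 (c := 1)) e7 _; ring.
  apply/flagP => i i5; rewrite h1 h2 h3 h4.
  by apply: (etrans (nb_coordE _ _ _ _ _ _ _ _ bt (ltn_trans i5 _))) => //;
    case: i i5 => [|[|[|[|[|//]]]]].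
have [r r0 g7E] : exists2 r : K, r != 0 & g (vec 7) = r *: vec 7.
  exists (nc 7 (g (vec 7))).
    apply: contraTneq (oner_neq0 K) => e; have := F7E _ g7; rewrite e scale0r -(linear0 g).
    move=> /(lker0P g0) e7; have := nb_coord_vec bt (isT : 7 < 8)%N (isT : 7 < 8)%N.
    rewrite e7 linear0 eqxx => e1; have {}e1 : 0 = 1 :> K := e1.
    by rewrite -e1 eqxx.
  exact: F7E.
have F5 v : v \in F 5 -> g v \in F 5.
  move=> v5; have vI : v \in im C.
    by rewrite -im1; apply: (subvP (flagS nc (isT : (1 <= 5)%N))).
  apply/F5P; rewrite ?(aut_im gG) //.
  rewrite -[vec 7](scalerK r0) -g7E omulZl -gM.
  by have /F5P := v5 => /(_ vI) ->; rewrite linear0 scaler0.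
have FG l : (5 <= l)%N -> (l <= 7)%N -> forall v, v \in F l -> g v \in F l.
  by case: l => [|[|[|[|[|[|[|[|//]]]]]]]].
have Fl l : (5 <= l)%N -> (l <= 7)%N -> forall v, v \in F l -> exists2 w, w \in F l & v = g w.
  move=> l5 l7 v vl; have gl : (g @: F l)%VS = F l.
    apply/eqP; rewrite eqEdim limg_dim_eq ?(eqP g0) ?capv0 // leqnn andbT.
    apply/subvP => _ /memv_imgP[w wk ->].
    exact: FG.
  by move: vl; rewrite -{1}gl => /memv_imgP[w wk ->]; exists w.
apply/(triangularP bt) => i j ij j8.
have vj : vec j \in F j by apply: (flag_basis (N := 8)) => //; exact: nb_coord_vec.
have [j5|j5] := leqP 5 j.
  by have /flagP := FG j j5 j8 _ vj; apply.
have gI : g (vec j) \in im C.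
  rewrite (aut_im gG) -im1; apply: (subvP (flagS nc _)) vj.
  exact: leq_ltn_trans ij.
case: i ij => [|i] ij.
  by move: gI; rewrite -im1 => /flagP; exact.
have h0 : (2^-1 : K) != 0 by rewrite invr_eq0 two_neq0.
have i3 : (i < 3)%N by clear - ij j5; lia.
have dE : nb_dual x y z i.+1 = 2^-1 *: vec (7 - i)%N.
  by case: i i3 {ij} => [|[|[|//]]] _; rewrite /nb_dual /nb_vec /= nbZ !(mulr0, mulr1).
have vl : vec (7 - i)%N \in F (7 - i)%N.
  by apply: (flag_basis (N := 8)); [exact: nb_coord_vec | rewrite ltnS leq_subr].
have [|w wF wE] := Fl (7 - i)%N _ (leq_subr _ _) _ vl; first by clear - i3; lia.
rewrite -[LHS]/(nb_coord x y z i.+1 (g (vec j)) : K) dot_formE dE dotZr wE (aut_dot gG).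
rewrite [X in _ * X](_ : _ = 0) ?mulr0 //.
have [b0 [b1 [b2 [b3 [b4 [b5 [b6 [b7 wE']]]]]]]] := nb_surj bt w.
have bz k : (k < 7 - i)%N -> [:: b0; b1; b2; b3; b4; b5; b6; b7]`_k = 0.
  move=> k7; move/flagP: wF => /(_ k k7) => wk.
  have : nc k w = 0 :> K by exact: wk.
  by rewrite wE' nb_coordE //; clear - k7; lia.
rewrite wE' /nb_vec nb_dot //; have j4 : (j <= 4)%N by [].
case: i ij i3 bz {dE vl wE wF} => [|[|[|//]]]; case: j j8 vj j5 gI j4 => [|[|[|[|[|//]]]]] //= _ _ _ _ _ _ _ bz;
  have e4 : b4 = 0 := bz 4%N isT; have e3 : b3 = 0 := bz 3%N isT;
  have e2 : b2 = 0 := bz 2%N isT; have e1 : b1 = 0 := bz 1%N isT;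
  have e0 : b0 = 0 := bz 0%N isT;
  try (have e5 : b5 = 0 := bz 5%N isT); try (have e6 : b6 = 0 := bz 6%N isT);
  subst; ring.
Qed.

Let nm_facts : [/\ dot uno (vec 7) = 0, dot uno (vec 6) = 0, dot (vec 7) (vec 7) = 0
  & vec 7 ** vec 6 = 0].
Proof.
rewrite /nb_vec /=; split; first by apply: imP; rewrite nb_im.
- by apply: imP; rewrite nb_im.
- by rewrite nb_dot //; ring.
- by rewrite nb_mul // -[RHS](nb0 x y z); congr nb; ring.
Qed.

(** The automorphism that carries the given triple to the adapted one
    preserves the line of [vec 7] and the plane of [vec 6] and [vec 7], hence
    the flag. *)
Lemma generic_orbit u v : dot uno u = 0 -> dot uno v = 0 -> free [:: u; v; cross u v] ->
    genericity u v (vec 7) (vec 6) != 0 ->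
  exists2 g, B g & <<[:: u; v; cross u v]>>%VS = (g @: nondeg_space x y z)%VS.
Proof.
move=> u1 v1 fr gen; have [n1 m1 nn nm] := nm_facts.
have [x' [y' [z' [bt' UE [r r0 nE] [c6 [c7 [c60 mE]]]]]]] := adapted_triple u1 v1 fr n1 m1 nn nm gen.
have [g gG [gx gy gz]] := basic_triple_trans bt bt'.
have gE a0 a1 a2 a3 a4 a5 a6 a7 : g (nb x y z a0 a1 a2 a3 a4 a5 a6 a7) =
    nb x' y' z' a0 a1 a2 a3 a4 a5 a6 a7 by rewrite aut_nb // gx gy gz.
have vF i : (i < 8)%N -> vec i \in F i.
  by move=> i8; apply: (flag_basis (N := 8)) => //; exact: nb_coord_vec.
have v76 : vec 7 \in F 6 by apply: (subvP (flagS nc (isT : (6 <= 7)%N))); exact: vF.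
exists g; last first.
  by rewrite UE -[nondeg_space x y z]/(model_space 0 x y z) aut_model // gx gy gz.
apply: aut_triangular => //.
  have -> : g (vec 7) = r^-1 *: vec 7.
    by rewrite [in RHS]nE /nb_vec /= gE nbZ !mulr0 mulVf.
  by rewrite memvZ // vF.
have -> : g (vec 6) = c6^-1 *: vec 6 + (- (c6^-1 * c7 * r^-1)) *: vec 7.
  rewrite [in RHS]mE [in RHS]nE /nb_vec /= gE !nbZ nbD; congr nb; by field; rewrite ?c60 ?r0.
by rewrite rpredD // memvZ // vF.
Qed.

Lemma nondeg_nondegenerate t : t \in nondeg_space x y z ->
  (forall s, s \in nondeg_space x y z -> dot t s = 0) -> t = 0.
Proof.
move=> /memv_span3[p [q [r ->]]] h.
have [[x1 y1 z1] [[xx yy zz] [xy xz yz kz]]] := bt.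
have [k1 kx ky kk] := basic_pair_table x1 y1 xy xx yy.
have hx := h x (memv_span (mem_head _ _)).
have hy : dot (p *: x + q *: y + r *: (x ** y)) y = 0.
  by apply: h; rewrite memv_span // !inE eqxx orbT.
have hk : dot (p *: x + q *: y + r *: (x ** y)) (x ** y) = 0.
  by apply: h; rewrite memv_span // !inE eqxx !orbT.
move: hx hy hk; rewrite !(dotDl, dotZl) xx yy kk (dotC y x) xy kx ky (dotC _ x) kx (dotC _ y) ky.
rewrite !(mulr0, mulr1, addr0, add0r) => -> -> ->.
by rewrite !scale0r !addr0.
Qed.

(** The projections of [vec 7] and [vec 6] to the model space are [x] and [y]. *)
Lemma genericity_nondeg u v : dot uno u = 0 -> dot uno v = 0 ->
    <<[:: u; v; cross u v]>>%VS = nondeg_space x y z ->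
  genericity u v (vec 7) (vec 6) != 0.
Proof.
move=> u1 v1 UE; have [[x1 y1 z1] [[xx yy zz] [xy xz yz kz]]] := bt.
have [k1 kx ky kk] := basic_pair_table x1 y1 xy xx yy.
have fr : free [:: u; v; cross u v].
  by rewrite /free UE (eqnP (basic_pair_free x1 y1 xy xx yy)).
have vw : dot v (cross u v) = 0.
  by have := dot_cross v1 u1; rewrite (cross_anti u1 v1) dotNr => /eqP; rewrite oppr_eq0 => /eqP.
have D0 : gram u v != 0.
  apply/eqP => D0; have w0 : cross u v = 0.
    apply: nondeg_nondegenerate; first by rewrite -UE memv_span // !inE eqxx !orbT.
    move=> s; rewrite -UE => /memv_span3[p [q [r ->]]].
    rewrite !(dotDr, dotZr) (dotC _ u) (dotC _ v) vw dot_cross // norm_cross //.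
    by rewrite -/(gram u v) D0 !mulr0 !addr0.
  have e : 0 *: u + 0 *: v + 1 *: cross u v = 0 by rewrite w0 !scale0r scaler0 !addr0.
  by have [_ _ /eqP] := free3E fr e; rewrite oner_eq0.
have sp t s : s \in nondeg_space x y z ->
    (forall r, r \in nondeg_space x y z -> dot t r = dot s r) -> scaled_proj u v t = gram u v *: s.
  move=> sU ts; apply/subr0_eq; apply: nondeg_nondegenerate.
    by rewrite rpredB ?memvZ // -UE mem_scaled_proj.
  by move=> r rU; rewrite dotDl dotNl dotZl scaled_projE ?UE // ts // subrr.
have xU : x \in nondeg_space x y z by rewrite memv_span // mem_head.
have yU : y \in nondeg_space x y z by rewrite memv_span // !inE eqxx orbT.
pose h : K := 2^-1; have hh : 2 * h = 1 by rewrite divff // two_neq0.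
have hh2 : h + h = 1 by rewrite -hh; ring.
have xE : x = nb x y z 0 h 0 0 0 0 0 h.
  by rewrite /nb !(add0r, subr0, subrr, oppr0, mulr0, scale0r, addr0) hh2 scale1r.
have yE : y = nb x y z 0 0 h 0 0 0 h 0.
  by rewrite /nb !(add0r, subr0, subrr, oppr0, mulr0, scale0r, addr0) hh2 scale1r.
have kE : x ** y = nb x y z 0 0 0 h 0 h 0 0.
  by rewrite /nb !(add0r, subr0, subrr, oppr0, mulr0, scale0r, addr0) hh2 scale1r.
clearbody h.
have [n1 n2 n3] : [/\ dot (vec 7) x = 1, dot (vec 7) y = 0 & dot (vec 7) (x ** y) = 0].
  rewrite /nb_vec /=; split.
  - rewrite [X in dot _ X]xE nb_dot //; apply: (lincomb1 (c := 1)) hh _; ring.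
  - by rewrite [X in dot _ X]yE nb_dot //; ring.
  - by rewrite [X in dot _ X]kE nb_dot //; ring.
have [m1 m2 m3] : [/\ dot (vec 6) x = 0, dot (vec 6) y = 1 & dot (vec 6) (x ** y) = 0].
  rewrite /nb_vec /=; split.
  - by rewrite [X in dot _ X]xE nb_dot //; ring.
  - rewrite [X in dot _ X]yE nb_dot //; apply: (lincomb1 (c := 1)) hh _; ring.
  - by rewrite [X in dot _ X]kE nb_dot //; ring.
have nE : scaled_proj u v (vec 7) = gram u v *: x.
  apply: sp => // t /memv_span3[p [q [r ->]]].
  by rewrite !(dotDr, dotZr) xx xy kx n1 n2 n3.
have mE : scaled_proj u v (vec 6) = gram u v *: y.
  apply: sp => // t /memv_span3[p [q [r ->]]].
  by rewrite !(dotDr, dotZr) yy (dotC y x) xy ky m1 m2 m3.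
rewrite /genericity nE mE; move: (gram u v) D0 => D D0.
by rewrite /gram !dotZl !dotZr xx yy xy !(mulr0, mulr1) expr0n subr0 !mulf_neq0.
Qed.

Lemma vec_fun_dot (T : Type) (A : set (T -> K)) (f g : T -> C) : fun_algebra A ->
  vec_fun A f -> vec_fun A g -> A (fun t => dot (f t) (g t)).
Proof.
move=> AP Af Ag; have := @vec_fun_bilinear _ _ _ AP C C K^o (@dot K C) f g.
move=> /(_ _ _ Af Ag \1%VF); rewrite (_ : (fun t => _) = fun t => dot (f t) (g t)); last first.
  by apply: funext => t; rewrite id_lfunE.
by apply=> a u v w; rewrite ?(dotDl, dotZl) ?(dotDr, dotZr).
Qed.

Lemma genericity_fun (T : Type) (A : set (T -> K)) (f g : T -> C) n m : fun_algebra A ->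
  vec_fun A f -> vec_fun A g -> A (fun t => genericity (f t) (g t) n m).
Proof.
move=> AP Af Ag; have cst v : vec_fun A (fun=> v) := vec_fun_cst AP v.
have D := vec_fun_dot AP.
have gramA (f' g' : T -> C) : vec_fun A f' -> vec_fun A g' -> A (fun t => gram (f' t) (g' t)).
  move=> Af' Ag'; apply: (fun_sub AP); first by apply: (fun_mul AP); exact: D.
  by apply: (fun_ext (fun t => expr2 _)); apply: (fun_mul AP); exact: D.
have crA : vec_fun A (fun t => cross (f t) (g t)).
  by apply: (vec_fun_bilinear AP _ _ Af Ag) => *; rewrite ?cross_linl ?cross_linr.
have spA v : vec_fun A (fun t => scaled_proj (f t) (g t) v).
  apply: (vec_fun_add AP); last by apply: (vec_fun_scale AP) => //; exact: D.
  by apply: (vec_fun_add AP); apply: (vec_fun_scale AP) => //;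
    apply: (fun_sub AP); apply: (fun_mul AP); exact: D.
apply: (fun_mul AP); last exact: gramA.
by apply: (fun_mul AP); [exact: gramA | exact: D].
Qed.

(** On the line of generator pairs from any point to the model space,
    [genericity] is a polynomial in the parameter that is nonzero at the end,
    hence at almost all parameters. *)
Theorem triangular_aut_dense (U0 : grassmannian 3 (im C)) : X U0 ->
  val U0 = nondeg_space x y z -> dense_in X (grass_orbit B U0).
Proof.
move=> XU0 U0E; split=> [W [g [gG _] WE]|].
  by have [W' XW' W'E] := aut_acts gG XU0; rewrite (_ : W = W') //; apply: val_inj; rewrite WE W'E.
apply: curve_dense; first exact: plucker_neq0.
move=> U XU; have [f [g [yy [Af Ag _ [yU _] [U0s f1 g1 yX]]]]] := subalg_line XU XU0.
exists yy => //.
have [G0 G0E] := genericity_fun (vec 7) (vec 6) (@polynomial_functions K) Af Ag.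
have GE (s : K) : genericity (f s) (g s) (vec 7) (vec 6) = G0.[s].
  by have := congr1 (fun h : K -> K => h s) G0E.
exists G0.
  apply: (@horner_neq0 _ _ 1); rewrite -GE; apply: genericity_nondeg => //.
  by rewrite -U0s U0E.
move=> s a ya; rewrite -GE => gs; have [Z [XZ yZ ZE]] := yX s a ya.
exists Z => //; have /andP[_ /eqP dZ] := valP Z.
have fr : free [:: f s; g s; cross (f s) (g s)] by rewrite /free -ZE dZ.
have [h hB hE] := generic_orbit (f1 s) (g1 s) fr gs.
by exists h => //; rewrite ZE U0E hE.
Qed.

End DenseOrbit.

(** * The theorem *)

Section Octonions.
Local Open Scope classical_set_scope.
Variable K : numClosedFieldType.
Local Notation G := (@alg_aut K (octs K)).
Local Notation X := (@subalg_variety K (octs K)).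

Lemma alg_aut_octonion : G = G2 K. Proof. by []. Qed.

Lemma subalg_variety_octonion : X = CG K.
Proof.
rewrite /subalg_variety /CG.
(* Only the projections of [oct_alg] are reduced: the octonion product itself, if
   unfolded, would make the comparison of the two sides explode. *)
by cbv beta iota delta [octs oct_alg oone omul ca_sort im].
Qed.

Lemma subalg_spherical : spherical G X.
Proof.
have [x [y [z bt]]] := ex_basic_triple (octs K).
have [U0 XU0 U0E] := ex_model 0 bt.
exists (triangular_aut x y z); first exact: triangular_aut_borel.
by exists U0 => //; exact: triangular_aut_dense.
Qed.

(** The orbit of the Borel subgroup lies in that of the group. *)
Lemma spherical_quasi_homogeneous : spherical G X -> quasi_homogeneous G X.
Proof.
case=> B [[_ [D _ BE] _ _] _] [U XU [_ d]]; exists U => //; split=> [W [g gG WE]|].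
  have [W' XW' W'E] := aut_acts gG XU.
  by rewrite (_ : W = W') //; apply: val_inj; rewrite WE W'E.
apply: subset_trans d _; apply: closureS => W [g gB WE].
by exists g => //; move: gB; rewrite BE => -[].
Qed.

Theorem cayley_grassmannian :
  [/\ closed (CG K), irreducible (CG K), smooth (CG K) & krull_dim (CG K) 8] /\
  [/\ acts_on (G2 K) (CG K), spherical (G2 K) (CG K), quasi_homogeneous (G2 K) (CG K)
    & (orbits (G2 K) (CG K) #= `I_3)%card].
Proof.
have : [/\ closed X, irreducible X, smooth X & krull_dim X 8] /\
    [/\ acts_on G X, spherical G X, quasi_homogeneous G X & (orbits G X #= `I_3)%card].
  split; split.
  - exact: subalg_closed.
  - exact: subalg_irreducible.
  - exact: subalg_smooth.
  - exact: subalg_krull_dim.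
  - exact: aut_acts.
  - exact: subalg_spherical.
  - exact: spherical_quasi_homogeneous subalg_spherical.
  - exact: card_orbits.
by rewrite subalg_variety_octonion alg_aut_octonion.
Qed.

End Octonions.

Local Open Scope classical_set_scope.
Local Open Scope card_scope.
Local Open Scope complex_scope.

Theorem theorem1p1 (R : realType) :
  [/\ closed (CG R[i]), irreducible (CG R[i]), smooth (CG R[i])
    & krull_dim (CG R[i]) 8] /\
  [/\ acts_on (G2 R[i]) (CG R[i]),
      spherical (G2 R[i]) (CG R[i]),
      quasi_homogeneous (G2 R[i]) (CG R[i])
    & orbits (G2 R[i]) (CG R[i]) #= `I_3].
Proof. exact: (cayley_grassmannian R[i]). Qed.
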